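(* Let $\mathcal X\subseteq\mathbb R^d$ be a nonempty closed convex set of diameter at most $R>0$, and let $F(x)=\frac1n\sum_{i=1}^n f_i(x)$ where each $f_i:\mathcal X\to\mathbb R$ is convex and $L$-smooth ($L>0$). Let $\epsilon>0$. Then RECAPP (given in the context) with parameters $\lambda=\frac Ln$ and $T=O\left(R\sqrt{L n^{-1}\epsilon^{-1}}\right)$, using OneEpochSvrg to implement ApproxProx and WarmStart-SVRG to implement WarmStart, outputs $x\in\mathcal X$ with $$\mathbb E F(x)-\min_{x'\in\mathcal X}F(x')\le\epsilon,$$ and its total number of gradient queries is, in expectation, $$O\left(n\log\log n+\sqrt{\frac{nLR^2}{\epsilon}}\right).$$ Further, if $F$ is $\gamma$-strongly-convex with $\gamma\le O(L/n)$, then restarted RECAPP (given in the context), with suitable iteration number and epoch number, finds an $\epsilon$-approximate solution, i.e. $x\in\mathcal X$ with $\mathbb E F(x)-\min_{x'\in\mathcal X}F(x')\le\epsilon$, using, in expectation, $$O\left(n\log\log n+\sqrt{\frac{nL}{\gamma}}\,\log\frac{LR^2}{n\epsilon}\right)$$ gradient queries.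
   Context: A gradient query is one evaluation of $\nabla f_i(x)$ for some $i\in[n]$, $x\in\mathcal X$. Inside $O(\cdot)$, $\log z$ and $\log\log n$ are read as $\max\{1,\log z\}$ and $\max\{1,\log\log n\}$. $\|\cdot\|$ is the Euclidean norm; $\mathrm{Proj}_{\mathcal X}$ is Euclidean projection. A differentiable convex function on $\mathcal X$ is $L$-smooth if its gradient is $L$-Lipschitz on $\mathcal X$. $F$ is $\gamma$-strongly-convex if $F(x')\ge F(x)+\langle\nabla F(x),x'-x\rangle+\frac\gamma2\|x'-x\|^2$ for all $x,x'\in\mathcal X$. OneEpochSvrg$(\Phi,x_{\rm full},x_{\rm init},\eta,T')$ for $\Phi=\frac1n\sum_i\phi_i$: compute $\nabla\Phi(x_{\rm full})$; $x_0=x_{\rm init}$; for $t=0,\dots,T'-1$ sample $i_t$ uniformly from $[n]$, $g_t=\nabla\phi_{i_t}(x_t)-\nabla\phi_{i_t}(x_{\rm full})+\nabla\Phi(x_{\rm full})$, $x_{t+1}=\mathrm{Proj}_{\mathcal X}(x_t-\eta g_t)$; return $\frac1{T'}\sum_{t=1}^{T'}x_t$. ApproxProx: $\mathrm{ApproxProx}_{F,\lambda}(s;x_{\rm init},x_{\rm prev})$ is implemented as OneEpochSvrg$(\Phi,x_{\rm prev},x_{\rm init},\eta,T')$ with $\phi_i(x)=f_i(x)+\frac\lambda2\|x-s\|^2$, $\eta=\frac1{32L}$, $T'=\lceil\frac{32}{\eta\lambda}\rceil$. WarmStart-SVRG (from an initial point $x_{\rm init}\in\mathcal X$): $x^{(0)}=x_{\rm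 init}$; for $k=0,\dots,K-1$, $\eta_{k+1}=\left(8Ln^{2^{-k-1}}\right)^{-1}$ and $x^{(k+1)}=$ OneEpochSvrg$(F,x^{(k)},x^{(k)},\eta_{k+1},32n)$; return $x^{(K)}$, with $K=\log\log n$ (read as $\max\{1,\lceil\log_2\log_2 n\rceil\}$, and as $1$ if $n=1$). UnbiasedProx: $\mathrm{UnbiasedProx}_{F,\lambda}(s;x_{\rm prev})$ is implemented as follows: $x^{(0)}=\mathrm{ApproxProx}_{F,\lambda}(s;s,x_{\rm prev})$; sample $J_+\in\{0,1,\dots\}$ independently with $\mathbb P[J_+=k]=2^{-k-1}$; $J=2+J_+$; for $j=0,\dots,J-1$, $x^{(j+1)}=\mathrm{ApproxProx}_{F,\lambda}(s;x^{(j)},x^{(j)})$; return $x^{(2)}+2^{J_++1}\left(x^{(J)}-x^{(\max\{J-1,2\})}\right)$. RECAPP (parameters $\lambda,T$): $\alpha_0=1$, $x_0=v_0=$ output of WarmStart. For $t=0,\dots,T-1$: let $\alpha_{t+1}\in[0,1]$ satisfy $\frac1{\alpha_{t+1}^2}-\frac1{\alpha_{t+1}}=\frac1{\alpha_t^2}$; $s_t=(1-\alpha_{t+1})x_t+\alpha_{t+1}v_t$; $x_{t+1}=\mathrm{ApproxProx}_{F,\lambda}(s_t;s_t,x_t)$; $\tilde x_{t+1}=\mathrm{UnbiasedProx}_{F,\lambda}(s_t;x_t)$; $v_{t+1}=\mathrm{Proj}_{\mathcal X}\left(v_t-\frac1{\alpha_{t+1}}(s_t-\tilde x_{t+1})\right)$.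 Return $x_T$. Restarted RECAPP (parameters $\lambda,T,K'$): $x^{(0)}=$ output of WarmStart; for $k=0,\dots,K'-1$ let $x^{(k+1)}$ be the output of $T$ iterations of RECAPP started at $x_0=v_0=x^{(k)}$, $\alpha_0=1$ (no warm start); return $x^{(K')}$. *)

(* Defs.v *)
From HB Require Import structures.
From mathcomp Require Import all_boot all_order all_algebra.
From mathcomp Require Import all_classical all_reals all_analysis.
From mathcomp Require Import ring.

Set Implicit Arguments.
Unset Strict Implicit.
Unset Printing Implicit Defensive.
Import Order.TTheory GRing.Theory Num.Theory.
Import numFieldNormedType.Exports.
Local Open Scope classical_set_scope.
Local Open Scope ring_scope.

Section Euclidean.
Context {R : realType} {d : nat}.
Local Notation V := 'rV[R]_d.

Definition dotv (u v : V) : R := \sum_(i < d) u ord0 i * v ord0 i.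

(* The norm `|u| that the library puts on row vectors is the sup norm. *)
Definition enorm (u : V) : R := Num.sqrt (dotv u u).

(* The default value 0 is used only when there is no nearest point. *)
Definition proj (X : set V) (x : V) : V :=
  xget 0 [set p | X p /\ forall q, X q -> enorm (x - p) <= enorm (x - q)].

(* The increment of f is only tested within X: f stands for a function on X,
   and X may have an empty interior. *)
Definition is_gradient_on (X : set V) (f : V -> R) (g : V -> V) : Prop :=
  forall x, X x -> forall e : R, 0 < e ->
    \forall y \near within X (nbhs x),
      `|f y - f x - dotv (g x) (y - x)| <= e * enorm (y - x).

Definition smooth_on (X : set V) (L : R) (f : V -> R) (g : V -> V) : Prop :=
  is_gradient_on X f g /\
  forall x y, X x -> X y -> enorm (g x - g y) <= L * enorm (x - y).

Definition strongly_convex_on (X : set V) (gamma : R) (F : V -> R)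
    (gF : V -> V) : Prop :=
  forall x x', X x -> X x' ->
    F x + dotv (gF x) (x' - x) + gamma / 2 * enorm (x' - x) ^+ 2 <= F x'.

Definition is_min_on (X : set V) (F : V -> R) (m : R) : Prop :=
  (exists2 x, X x & F x = m) /\ forall x, X x -> m <= F x.

Definition avgf (n : nat) (f : 'I_n -> V -> R) (x : V) : R :=
  n%:R^-1 * \sum_(i < n) f i x.

Definition avgg (n : nat) (g : 'I_n -> V -> V) (x : V) : V :=
  n%:R^-1 *: \sum_(i < n) g i x.

End Euclidean.

(* Randomized procedures that return a value in A and access n functions on V
   only through gradient queries.  [Query i x k] continues with k applied to the
   gradient of the i-th function at x, [Unif k] with k applied to a fresh uniform
   index, and [Geom k] with k applied to a fresh j that has probability
   2^-(j+1). *)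
Inductive prog (V : Type) (n : nat) (A : Type) : Type :=
| Ret of A
| Query of 'I_n & V & (V -> prog V n A)
| Unif of ('I_n -> prog V n A)
| Geom of (nat -> prog V n A).
Arguments Ret {V n A} _.
Arguments Query {V n A} _ _ _.
Arguments Unif {V n A} _.
Arguments Geom {V n A} _.

Fixpoint bind {V : Type} {n : nat} {A B : Type} (p : prog V n A)
    (h : A -> prog V n B) : prog V n B :=
  match p with
  | Ret a => h a
  | Query i x k => Query i x (fun v => bind (k v) h)
  | Unif k => Unif (fun i => bind (k i) h)
  | Geom k => Geom (fun j => bind (k j) h)
  end.

Notation "'let*' x := p 'in' q" := (bind p (fun x => q))
  (at level 200, x name, p at level 100, q at level 200, right associativity).

(* [forM m body s]: body 0, then body 1, up to body m.-1, threading the state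
   s. *)
Fixpoint forM {V : Type} {n : nat} {S : Type} (m : nat)
    (body : nat -> S -> prog V n S) (s : S) : prog V n S :=
  match m with
  | 0 => Ret s
  | m'.+1 => bind (forM m' body s) (body m')
  end.

(* A returned value together with the number of gradient queries made. *)
Definition outcome (A : Type) : Type := (A * nat)%type.

HB.instance Definition _ (A : pointedType) :=
  Pointed.copy (outcome A) (A * nat)%type.

(* The law of an outcome is supported on a countable set, so every set of
   outcomes is measurable. *)
HB.instance Definition _ (A : pointedType) :=
  @isMeasurable.Build default_measure_display (outcome A) discrete_measurable
    discrete_measurable0 discrete_measurableC discrete_measurableU.

Section Law.
Context {R : realType} {V : Type} {n : nat} {A : pointedType}.
Variable grad : 'I_n -> V -> V.
Local Open Scope ereal_scope.

(* The law of the outcome of p, when c queries were made before p starts. *)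
Fixpoint lawc (p : prog V n A) (c : nat) (U : set (outcome A)) : \bar R :=
  match p with
  | Ret a => \d_((a, c) : outcome A) U
  | Query i x k => lawc (k (grad i x)) c.+1 U
  | Unif k => (n%:R^-1)%:E * \sum_(i < n) lawc (k i) c U
  | Geom k => \sum_(j <oo) ((2 ^- j.+1)%R)%:E * lawc (k j) c U
  end.

Definition law (p : prog V n A) : set (outcome A) -> \bar R := lawc p 0.

Lemma lawc_ge0 p c U : 0 <= lawc p c U.
Proof.
elim: p c => [a|i x k IH|k IH|k IH] c //=.
- by rewrite mule_ge0 ?lee_fin ?invr_ge0// sume_ge0.
- by apply: nneseries_ge0 => j _ _; rewrite mule_ge0// lee_fin invr_ge0 exprn_ge0.
Qed.

Lemma lawc0 p c : lawc p c set0 = 0.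
Proof.
elim: p c => [a|i x k IH|k IH|k IH] c /=.
- by rewrite measure0.
- exact: IH.
- by rewrite big1 ?mule0.
- by rewrite eseries0// => j _ _; rewrite IH mule0.
Qed.

Lemma lawc_bigcup p c (F : (set (outcome A))^nat) : trivIset setT F ->
  lawc p c (\bigcup_i F i) = \sum_(i <oo) lawc p c (F i).
Proof.
move=> tF; elim: p c => [a|i x k IH|k IH|k IH] c /=.
- by rewrite measure_semi_bigcup.
- exact: IH.
- rewrite nneseriesZl; last by move=> *; rewrite sume_ge0// => *; exact: lawc_ge0.
  rewrite nneseries_sum; last by move=> *; exact: lawc_ge0.
  by congr (_ * _); apply: eq_bigr.
- rewrite nneseries_interchange; last first.
    by move=> i j; rewrite mule_ge0 ?lawc_ge0// lee_fin invr_ge0 exprn_ge0.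
  apply: eq_eseriesr => j _; rewrite IH nneseriesZl// => *; exact: lawc_ge0.
Qed.

Lemma law_sigma_additive p : semi_sigma_additive (law p).
Proof.
move=> F mF tF mUF; rewrite /law lawc_bigcup//.
apply: is_cvg_nneseries => i _ _; exact: lawc_ge0.
Qed.

HB.instance Definition _ p := isMeasure.Build _ _ _ (law p)
  (lawc0 p 0) (lawc_ge0 p 0) (@law_sigma_additive p).

Lemma law_setT (n_gt0 : (0 < n)%N) p : law p setT = 1.
Proof.
rewrite /law; move: 0%N => c.
elim: p c => [a|i x k IH|k IH|k IH] c /=.
- by rewrite diracT.
- exact: IH.
- under eq_bigr do rewrite IH.
  rewrite sumEFin -EFinM sumr_const card_ord mulVf//.
  by rewrite pnatr_eq0 -lt0n.
- under eq_eseriesr do rewrite IH mule1.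
  apply: cvg_lim => //.
  have -> : (fun m => \sum_(0 <= j < m) ((2 ^- j.+1 : R)%R)%:E) =
      EFin \o series (geometric (2^-1 : R)%R (2^-1)%R).
    apply/funext => m /=; rewrite sumEFin /series/=; congr (_%:E).
    by apply: eq_bigr => j _; rewrite -exprVn exprS.
  apply: cvg_EFin; first exact: nearW.
  have e1 : (1 = 2^-1 * (1 - 2^-1)^-1 :> R)%R by field.
  rewrite [X in _ --> X]e1.
  by apply: cvg_geometric_series; rewrite ger0_norm// invf_lt1// ltr1n.
Qed.

End Law.

Arguments law R {V n A} grad p _.

(* A component gradient of F costs one query, and so does a component gradient
   of the proximal objective F + lambda / 2 * |. - s|^2. *)
Section Algorithms.
Context {R : realType} {d n : nat}.
Local Notation V := 'rV[R]_d.
Variables (X : set V) (L : R).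

Definition query (i : 'I_n) (x : V) : prog V n V := Query i x Ret.

Definition query_prox (lambda : R) (s : V) (i : 'I_n) (x : V) : prog V n V :=
  let* v := query i x in Ret (v + lambda *: (x - s)).

Definition full_gradient (gphi : 'I_n -> V -> prog V n V) (x : V) :
    prog V n V :=
  let* w := foldr (fun i p => let* u := p in let* v := gphi i x in Ret (u + v))
              (Ret 0) (enum 'I_n) in
  Ret (n%:R^-1 *: w).

(* The state is the current iterate and the sum of the iterates x_1, x_2 and so
   on produced so far. *)
Definition one_epoch_svrg (gphi : 'I_n -> V -> prog V n V) (xfull xinit : V)
    (eta : R) (T' : nat) : prog V n V :=
  let* mu := full_gradient gphi xfull in
  let* st := forM T' (fun _ st =>
    let* i := Unif Ret in
    let* u := gphi i st.1 in
    let* v := gphi i xfull in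
    let x := proj X (st.1 - eta *: (u - v + mu)) in
    Ret (x, st.2 + x)) (xinit, 0) in
  Ret (T'%:R^-1 *: st.2).

Definition prox_eta : R := (32 * L)^-1.

Definition prox_steps (lambda : R) : nat :=
  `|Num.ceil (32 / (prox_eta * lambda))|%N.

Definition approx_prox (lambda : R) (s xinit xprev : V) : prog V n V :=
  one_epoch_svrg (query_prox lambda s) xprev xinit prox_eta (prox_steps lambda).

(* xs lists x^(0), x^(1) and so on. *)
Definition unbiased_prox (lambda : R) (s xprev : V) : prog V n V :=
  let* x0 := approx_prox lambda s s xprev in
  let* Jp := Geom Ret in
  let J := (2 + Jp)%N in
  let* xs := forM J (fun j xs =>
    let* x := approx_prox lambda s (nth 0 xs j) (nth 0 xs j) in
    Ret (rcons xs x)) [:: x0] in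
  Ret (nth 0 xs 2 + 2 ^+ Jp.+1 *: (nth 0 xs J - nth 0 xs (maxn J.-1 2))).

(* The nested [up_log 2] is the ceiling of log_2 log_2 n when 1 < n, because the
   inner rounding does not change the outer one, and it is 0 when n = 1. *)
Definition warm_epochs : nat := maxn 1 (up_log 2 (up_log 2 n)).

Definition warm_eta (k : nat) : R := (8 * L * n%:R `^ (2 ^- k.+1))^-1.

Definition warm_start (xinit : V) : prog V n V :=
  forM warm_epochs
    (fun k x => one_epoch_svrg query x x (warm_eta k) (32 * n)) xinit.

Definition next_alpha (a : R) : R :=
  xget 0 [set b | 0 <= b <= 1 /\ (b ^+ 2)^-1 - b^-1 = (a ^+ 2)^-1].

(* T iterations from x_0 = v_0 = xinit and alpha_0 = 1; the state is
   (x_t, v_t, alpha_t). *)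
Definition recapp_iters (lambda : R) (T : nat) (xinit : V) : prog V n V :=
  let* st := forM T (fun _ st =>
    let x := st.1.1 in
    let v := st.1.2 in
    let alpha := next_alpha st.2 in
    let s := (1 - alpha) *: x + alpha *: v in
    let* x' := approx_prox lambda s s x in
    let* xt := unbiased_prox lambda s x in
    let v' := proj X (v - alpha^-1 *: (s - xt)) in
    Ret (x', v', alpha)) (xinit, xinit, 1) in
  Ret st.1.1.

Definition recapp (lambda : R) (T : nat) (xinit : V) : prog V n V :=
  let* x0 := warm_start xinit in recapp_iters lambda T x0.

Definition restarted_recapp (lambda : R) (T K' : nat) (xinit : V) :
    prog V n V :=
  let* x0 := warm_start xinit in
  forM K' (fun _ x => recapp_iters lambda T x) x0.

End Algorithms.

Section Guarantees.
Context {R : realType} {d n : nat}.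
Local Notation V := 'rV[R]_d.
Variable grad : 'I_n -> V -> V.

(* The output is almost surely in X, and E F(output) - min_X F <= eps. *)
Definition finds_approx_min (X : set V) (F : V -> R) (eps : R)
    (p : prog V n V) : Prop :=
  law R grad p [set o | X o.1] = 1%E /\
  exists2 m, is_min_on X F m &
    (\int[law R grad p]_o (F o.1)%:E - m%:E <= eps%:E)%E.

Definition expected_queries (p : prog V n V) : \bar R :=
  (\int[law R grad p]_o (o.2%:R)%:E)%E.

End Guarantees.

(* Main.v *)
Require Import Defs.
From HB Require Import structures.
From mathcomp Require Import all_boot all_order all_algebra.
From mathcomp Require Import all_classical all_reals all_analysis.
From mathcomp Require Import ring lra.

Set Implicit Arguments.
Unset Strict Implicit.
Unset Printing Implicit Defensive.
Import Order.TTheory GRing.Theory Num.Theory.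
Import numFieldNormedType.Exports.
Local Open Scope classical_set_scope.
Local Open Scope ring_scope.

(** The accelerated proximal point method minimizes [F] by a sequence of proximal
points of [F + lambda / 2 * |. - s|^2], with the rate of Nesterov's method for a
[lambda]-smooth function: [T] steps give an error of order [lambda * D^2 / T^2].
With [lambda = L / n] one proximal point costs [O(n)] queries by SVRG, because the
objective has condition number [n]. The proof has to show that an accuracy
relative to the progress of the method is enough, so that no logarithmic factor
appears.

Variance. The error of a stochastic gradient centred at a reference point is
measured by [gvar], the mean square variation of the component gradients, and by
its scaled version [gdev]. On a domain [X] with a boundary, the gradient step that
proves cocoercivity may leave [X], so [gvar] is only dominated by the symmetric
Bregman divergence of [F] ([cocoercive]), and this for the components of the
gradients along the affine hull of [X]. Two consequences shape the proof. An epoch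
must control [gvar] at its output, not only the function value there; this is done
by a regret bound against the random average itself ([one_epoch_bounds]). And the
acceleration must gain both orders of the divergence between successive proximal
points, while the usual argument gains only one of them.

Oracles. One call of the approximate proximal point reduces the sum of the scaled
squared distance and of [gdev], both relative to the exact proximal point, by a
factor below 1/7 ([approx_prox_bounds]). The factor is below 1/2, so the random
number of further calls gives an unbiased estimate whose variance is small in the
same units ([unbiased_prox_le]).

Acceleration. Beside the state of the method, its exact proximal points [p] are
recorded. The optimality of the new point gives the usual decrease of
[a^2 * (F p - F xs) + lambda / 2 * |v - xs|^2], where [a] is the inverse momentum
parameter, and also one order of the divergence ([prox_value_step]). The optimality
of the previous point gives the other order ([breg_prev_le]), at the price of an
inner product that is added to the potential with a small coefficient. The errors
of the iterate with respect to [p] are added as well. Once [a] grows by small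
factors, after forty steps, the resulting potential [pot] does not increase in
expectation ([pot_step_le], from the numerical inequality [refined_arith]); before
that, all errors grow by bounded factors ([crude_step_le]). The outcome is
[recapp_iters_le]: [T^2] times the expected merit of the last iterate is at most a
constant times the merit and the scaled squared distance of the first one. The
merit is the gap plus the variance at the proximal point of the iterate.

Warm start. The error target [lambda * D^2] is missed initially by a factor [n],
and every epoch replaces this factor by its square root; after [log_2 (log_2 n)]
epochs it is at most 2 ([warm_epochs_excess], [warm_start_le]).

Conclusion. [T] of order [D * sqrt (lambda / eps)] gives the first bound. Under
strong convexity the squared distance is at most a multiple of the gap, so
[T] of order [sqrt (lambda / gamma)] halves the merit, and the number of restarts
is logarithmic ([restarted_bound]). The estimates are carried out with a real
expectation [expect], defined by recursion over a procedure, which agrees with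
integration against its law ([integral_expect]); queries are counted by [cost]. *)

Local Notation proj := Defs.proj.

(** * The Euclidean inner product *)

Notation nsq u := (dotv u u) (only parsing).

Section InnerProduct.
Context {R : realType} {d : nat}.
Local Notation V := 'rV[R]_d.
Implicit Types (u v w x y : V) (a b c : R).

Lemma dotvC u v : dotv u v = dotv v u.
Proof. by apply: eq_bigr => i _; rewrite mulrC. Qed.

Lemma dotvDl u v w : dotv (u + v) w = dotv u w + dotv v w.
Proof. by rewrite -big_split; apply: eq_bigr => i _; rewrite mxE mulrDl. Qed.

Lemma dotvZl a u v : dotv (a *: u) v = a * dotv u v.
Proof. by rewrite mulr_sumr; apply: eq_bigr => i _; rewrite mxE mulrA. Qed.

Lemma dotvNl u v : dotv (- u) v = - dotv u v.
Proof. by rewrite -scaleN1r dotvZl mulN1r. Qed.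

Lemma dotv0l v : dotv 0 v = 0.
Proof. by rewrite -(scale0r v) dotvZl mul0r. Qed.

Lemma dotvDr u v w : dotv w (u + v) = dotv w u + dotv w v.
Proof. by rewrite !(dotvC w) dotvDl. Qed.

Lemma dotvZr a u v : dotv v (a *: u) = a * dotv v u.
Proof. by rewrite !(dotvC v) dotvZl. Qed.

Lemma dotvNr u v : dotv v (- u) = - dotv v u.
Proof. by rewrite !(dotvC v) dotvNl. Qed.

Lemma dotv0r v : dotv v 0 = 0.
Proof. by rewrite dotvC dotv0l. Qed.

Definition dotvE := (dotvDl, dotvDr, dotvNl, dotvNr, dotvZl, dotvZr).

Lemma dotv_suml (I : Type) (s : seq I) (P : pred I) (F : I -> V) v :
  dotv (\sum_(i <- s | P i) F i) v = \sum_(i <- s | P i) dotv (F i) v.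
Proof. by apply: (big_morph (dotv^~ v)) => [x y|]; rewrite ?dotvDl ?dotv0l. Qed.

Lemma dotv_sumr (I : Type) (s : seq I) (P : pred I) (F : I -> V) v :
  dotv v (\sum_(i <- s | P i) F i) = \sum_(i <- s | P i) dotv v (F i).
Proof. by rewrite dotvC dotv_suml; apply: eq_bigr => i _; rewrite dotvC. Qed.

Lemma nsq_ge0 u : 0 <= nsq u.
Proof. by apply: sumr_ge0 => i _; rewrite -expr2 sqr_ge0. Qed.

Lemma nsq_eq0 u : (nsq u == 0) = (u == 0).
Proof.
apply/idP/idP => [|/eqP->]; last by rewrite dotv0l.
rewrite psumr_eq0 => [/allP h|i _]; last by rewrite -expr2 sqr_ge0.
apply/eqP/rowP => i; rewrite mxE.
by have := h i (mem_index_enum i); rewrite -expr2 sqrf_eq0 => /eqP.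
Qed.

Lemma enorm_sqr u : enorm u ^+ 2 = nsq u.
Proof. by rewrite sqr_sqrtr ?nsq_ge0. Qed.

Lemma enorm_ge0 u : 0 <= enorm u.
Proof. exact: sqrtr_ge0. Qed.

Lemma enorm_le_nsq u v a : 0 <= a ->
  (enorm u <= a * enorm v) = (nsq u <= a ^+ 2 * nsq v).
Proof.
move=> a0; rewrite -!enorm_sqr -exprMn ler_pXn2r// nnegrE ?enorm_ge0//.
by rewrite mulr_ge0 ?enorm_ge0.
Qed.

Lemma enorm_leE u v : (enorm u <= enorm v) = (nsq u <= nsq v).
Proof. by rewrite -[enorm v]mul1r enorm_le_nsq// expr1n mul1r. Qed.

Lemma nsqN u : nsq (- u) = nsq u.
Proof. by rewrite !dotvE opprK. Qed.

Lemma nsqB u v : nsq (u - v) = nsq (v - u).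
Proof. by rewrite -nsqN opprB. Qed.

(** Young's inequality, the substitute for Cauchy-Schwarz everywhere below. *)
Lemma dotv_young c u v : 0 < c -> dotv u v <= c / 2 * nsq u + (2 * c)^-1 * nsq v.
Proof.
move=> c0; have := nsq_ge0 (c *: u - v); rewrite !dotvE (dotvC v u) => h.
have -> : c / 2 * nsq u + (2 * c)^-1 * nsq v =
   dotv u v + (2 * c)^-1 * (c * (c * nsq u) + c * - dotv u v + (- (c * dotv u v) - - nsq v)).
  by field; rewrite gt_eqF.
rewrite lerDl; apply: mulr_ge0; last by lra.
by rewrite invr_ge0 mulr_ge0// ltW.
Qed.

Lemma dotv_le_lip c u v : 0 <= c -> nsq u <= c ^+ 2 * nsq v ->
  dotv u v <= c * nsq v.
Proof.
move=> + h; rewrite le_eqVlt => /predU1P[c0|c0].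
  move: h; rewrite -c0 expr0n/= mul0r => h.
  have /eqP : nsq u == 0 by rewrite eq_le h nsq_ge0.
  by move/eqP; rewrite nsq_eq0 => /eqP->; rewrite dotv0l.
apply: le_trans (@dotv_young c^-1 u v _) _; first by rewrite invr_gt0.
rewrite invfM invrK.
have -> : c * nsq v = c^-1 / 2 * (c ^+ 2 * nsq v) + 2^-1 * c * nsq v.
  by field; rewrite gt_eqF.
rewrite lerD2r; apply: ler_wpM2l => //; apply: divr_ge0 => //; rewrite invr_ge0; exact: ltW.
Qed.

Lemma nsqD_le c u v : 0 < c -> nsq (u + v) <= (1 + c) * nsq u + (1 + c^-1) * nsq v.
Proof.
move=> c0; have := dotv_young u v c0; rewrite !dotvE (dotvC v u) invfM.
move: (nsq u) (nsq v) (dotv u v) => a b e; set ic := c^-1 => h.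
by lra.
Qed.

Lemma nsqD2_le u v : nsq (u + v) <= 2 * nsq u + 2 * nsq v.
Proof. by have := @nsqD_le 1 u v ltr01; rewrite invr1. Qed.

(** Jensen's inequality for the squared norm, along a list. *)
Lemma nsq_sum_le (I : Type) (s : seq I) (F : I -> V) :
  nsq (\sum_(i <- s) F i) <= (size s)%:R * \sum_(i <- s) nsq (F i).
Proof.
elim: s => [|i s IH]; first by rewrite !big_nil dotv0l mulr0.
rewrite !big_cons /=; case: (posnP (size s)) => [/size0nil->|s0].
  by rewrite !big_nil !addr0 mul1r.
have sR : 0 < (size s)%:R :> R by rewrite ltr0n.
apply: le_trans (nsqD_le _ _ sR) _.
rewrite -natr1 addrC [leRHS]mulrDr [leRHS]addrC; apply: lerD; last by rewrite addrC.
apply: le_trans (_ : _ <= (1 + (size s)%:R^-1) * ((size s)%:R * \sum_(i <- s) nsq (F i))) _.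
  by rewrite ler_wpM2l// addr_ge0// invr_ge0 ltW.
by rewrite mulrA mulrDl mulVf ?gt_eqF// mul1r.
Qed.

End InnerProduct.

(** * The relative interior of a convex set *)

Section TangentProjector.
Context {R : realType} {d : nat}.
Local Notation V := 'rV[R]_d.

Definition lconvex (X : set V) := forall x y (t : R), X x -> X y ->
  0 <= t -> t <= 1 -> X (t *: x + (1 - t) *: y).

Lemma convex_set_lconvex (X : set V) : @convex_set R 'rV[R]_d X -> lconvex X.
Proof.
move=> cX x y t Xx Xy t0 t1.
have h := cX x y (Itv01 t0 t1) (mem_set Xx) (mem_set Xy).
exact: set_mem h.
Qed.

Lemma dotv_mulmx (u v : V) : dotv u v = (u *m v^T) 0 0.
Proof. by rewrite mxE; apply: eq_bigr => i _; rewrite mxE (ord1 ord0). Qed.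

Lemma dotv_sym (P : 'M[R]_d) (u v : V) : P^T = P ->
  dotv (u *m P) v = dotv u (v *m P).
Proof. by move=> PT; rewrite !dotv_mulmx trmx_mul PT mulmxA. Qed.

Definition orth_projector (P : 'M[R]_d) := P^T = P /\ P *m P = P.

Lemma orth_projector_trace_le P : orth_projector P -> \tr P <= d%:R.
Proof.
move=> [PT PP]; rewrite /mxtrace -[X in _ <= X%:R]card_ord -sum1_card natr_sum.
apply: ler_sum => i _; set a := P i i.
have : a ^+ 2 <= a.
  rewrite {2}/a -PP mxE (bigD1 i)//= -expr2 lerDl sumr_ge0// => j _.
  have -> : P j i = P i j by rewrite -{1}PT mxE.
  by rewrite -expr2 sqr_ge0.
by rewrite -subr_ge0 => h; nra.
Qed.

Lemma orth_projector_nsq P u : orth_projector P -> nsq (u *m P) <= nsq u.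
Proof.
move=> [PT PP]; have := nsq_ge0 (u - u *m P).
have e : dotv (u *m P) (u *m P) = dotv u (u *m P).
  by rewrite dotv_sym// -mulmxA PP.
by rewrite !dotvE (dotvC (u *m P) u) e; lra.
Qed.

Definition relative_ball (X : set V) (P : 'M[R]_d) (b : V) (rho : R) :=
  [/\ 0 < rho, X b & forall w, w *m P = w -> nsq w <= rho -> X (b + w)].

(** A point [x] outside the affine space through [b] adds one dimension: around
the midpoint of [b] and [x] there is a ball in the range of [P] enlarged by the
normal component [u] of [x - b]. *)
Lemma relative_ball_extend (X : set V) P b rho x : lconvex X ->
  orth_projector P -> relative_ball X P b rho -> X x -> (x - b) *m P != x - b ->
  exists P' b' rho', [/\ orth_projector P', relative_ball X P' b' rho' &
    \tr P' = \tr P + 1].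
Proof.
move=> cX oP [rho0 Xb ball] Xx; have [PT PP] := oP.
set y := (x - b) *m P; set u := x - b - y => ne.
have u0 : nsq u != 0 by rewrite nsq_eq0 subr_eq0 eq_sym.
have uE : u = x - b - y by [].
have uP : u *m P = 0 by rewrite mulmxBl /y -mulmxA PP subrr.
clearbody u.
have up : 0 < nsq u by rewrite lt_neqAle eq_sym u0 nsq_ge0.
have Pu : P *m u^T = 0 by rewrite -{1}PT -trmx_mul uP trmx0.
set s := (nsq u)^-1.
have uu : u *m u^T = (nsq u)%:M.
  by apply/matrixP => i j; rewrite !ord1 dotv_mulmx !mxE eqxx mulr1n.
have oP' : orth_projector (P + s *: (u^T *m u)).
  split; first by rewrite linearD/= linearZ/= trmx_mul trmxK PT.
  have h1 : P *m (u^T *m u) = 0 by rewrite mulmxA Pu mul0mx.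
  have h2 : (u^T *m u) *m P = 0 by rewrite -mulmxA uP mulmx0.
  have h3 : (u^T *m u) *m (u^T *m u) = nsq u *: (u^T *m u).
    by rewrite -mulmxA (mulmxA u) uu mul_scalar_mx -scalemxAr.
  move: h1 h2 h3; set Q := u^T *m u => h1 h2 h3.
  have h4 : P *m (s *: Q) = 0 by rewrite -scalemxAr h1 scaler0.
  have h5 : (s *: Q) *m P = 0 by rewrite -scalemxAl h2 scaler0.
  have h6 : (s *: Q) *m (s *: Q) = s *: Q.
    by rewrite -scalemxAl -scalemxAr h3 !scalerA -mulrA (mulVf u0) mulr1.
  by rewrite mulmxDl !mulmxDr PP h4 h5 h6 addr0 add0r.
exists (P + s *: (u^T *m u)), (2^-1 *: b + (1 - 2^-1) *: x).
exists (Num.min (nsq u / 16) (rho / (32 * (1 + nsq y / nsq u)))).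
have den : 0 < 32 * (1 + nsq y / nsq u).
  by rewrite mulr_gt0// ltr_pwDl// divr_ge0 ?nsq_ge0.
split => //; last first.
  by rewrite mxtraceD mxtraceZ mxtrace_mulC uu mxtrace_scalar mulr1n /s mulVf.
split; first by rewrite lt_min !divr_gt0.
  by apply: cX => //; lra.
move=> w wP'; rewrite le_min => /andP[w1 w2].
set c := s * dotv w u.
have wE : w = w *m P + c *: u.
  rewrite -{1}wP' mulmxDr -scalemxAr mulmxA; congr (_ + _).
  have -> : w *m u^T = (dotv w u)%:M.
    by apply/matrixP => i j; rewrite !ord1 dotv_mulmx !mxE eqxx mulr1n.
  by rewrite mul_scalar_mx scalerA.
have nw : nsq w = nsq (w *m P) + c ^+ 2 * nsq u.
  have e : dotv (w *m P) u = 0 by rewrite dotv_sym// uP dotv0r.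
  have e' : dotv u (w *m P) = 0 by rewrite dotvC.
  by rewrite [in LHS]wE !dotvE e e'; ring.
set w' := w *m P in wE nw *.
have c2 : c ^+ 2 <= nsq w / nsq u.
  by rewrite ler_pdivlMr// nw lerDr nsq_ge0.
have c16 : c ^+ 2 <= 1 / 16.
  by apply: le_trans c2 _; rewrite ler_pdivrMr//; lra.
have cb : c <= 1 / 4 /\ - (1 / 4) <= c by split; nra.
have -> : 2^-1 *: b + (1 - 2^-1) *: x + w =
   (2^-1 - c) *: (b + (2^-1 - c)^-1 *: (w' - c *: y)) + (1 - (2^-1 - c)) *: x.
  rewrite scalerDr scalerA mulfV ?scale1r; last by lra.
  rewrite wE uE; apply/rowP => i; rewrite !mxE; lra.
apply: cX => //; [apply: ball|lra|lra].
  rewrite -scalemxAl mulmxBl -scalemxAl; congr (_ *: (_ - _ *: _)).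
    by rewrite /w' -mulmxA PP.
  by rewrite /y -mulmxA PP.
set k := (2^-1 - c)^-1.
have k4 : k ^+ 2 <= 16.
  have k1 : k <= 4.
    rewrite -[4]invrK lef_pV2 ?posrE//; lra.
  have : 0 <= k by rewrite invr_ge0; lra.
  by move=> ?; nra.
have -> : nsq (k *: (w' - c *: y)) = k ^+ 2 * nsq (w' - c *: y).
  by rewrite dotvZl dotvZr; ring.
have h1 : nsq (w' - c *: y) <= 2 * nsq w + 2 * (nsq w / nsq u * nsq y).
  have := nsqD2_le w' (- (c *: y)).
  rewrite nsqN => /le_trans; apply; apply: lerD.
    by rewrite ler_wpM2l// nw lerDl mulr_ge0 ?nsq_ge0 ?sqr_ge0.
  rewrite ler_wpM2l// !dotvE mulrA -expr2.
  by rewrite ler_wpM2r ?nsq_ge0.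
apply: (@le_trans _ _ (16 * (2 * nsq w + 2 * (nsq w / nsq u * nsq y)))).
  apply: le_trans (ler_wpM2r (nsq_ge0 _) k4) _.
  by rewrite ler_wpM2l.
move: w2; rewrite ler_pdivlMr// => w2.
by rewrite (le_trans _ w2)//; lra.
Qed.

(** Every convex set has an interior relative to its affine hull. The
dimension of a ball in [X], which is the trace of [P], grows as long as the range
of [P] misses a direction of [X], and it is at most [d]. *)
Lemma tangent_projector (X : set V) x0 : lconvex X -> X x0 ->
  exists P b rho, [/\ orth_projector P, relative_ball X P b rho &
    forall x y, X x -> X y -> (x - y) *m P = x - y].
Proof.
move=> cX Xx0; apply: contrapT => nex.
have Q (k : nat) : exists P b rho,
    [/\ orth_projector P, relative_ball X P b rho & \tr P = k%:R].
  elim: k => [|k [P [b [rho [oP bP tP]]]]].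
    exists 0, x0, 1; split; [split; rewrite ?trmx0 ?mul0mx//| |exact: mxtrace0].
    by split=> // w; rewrite mulmx0 => <- _; rewrite addr0.
  have [x [Xx xb]] : exists x, X x /\ (x - b) *m P != x - b.
    apply: contrapT => nx; apply: nex; exists P, b, rho; split => // x y Xx Xy.
    have h z : X z -> (z - b) *m P = z - b.
      by move=> Xz; apply: contrapT => /eqP hz; apply: nx; exists z.
    have -> : x - y = (x - b) - (y - b) by rewrite opprB addrA subrK.
    by rewrite mulmxBl !h.
  have [P' [b' [rho' [oP' bP' tP']]]] := relative_ball_extend cX oP bP Xx xb.
  by exists P', b', rho'; split => //; rewrite tP' tP natr1.
have [P [_ [_ [oP _ tP]]]] := Q d.+1.
by have := orth_projector_trace_le oP; rewrite tP ler_nat ltnn.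
Qed.

End TangentProjector.

(** * Gradients on a convex set *)

Section Gradients.
Context {R : realType} {d : nat}.
Local Notation V := 'rV[R]_d.
Variables (X : set V) (f : V -> R) (g : V -> V).
Hypothesis cX : lconvex X.

Lemma enormZ (t : R) (u : V) : 0 <= t -> enorm (t *: u) = t * enorm u.
Proof.
by move=> t0; rewrite /enorm dotvZl dotvZr mulrA -expr2 sqrtrM ?sqr_ge0// sqrtr_sqr ger0_norm.
Qed.

Lemma convex_gradient_ineq : @convex_function R V X f ->
  is_gradient_on X f g ->
  forall x y, X x -> X y -> f x + dotv (g x) (y - x) <= f y.
Proof.
move=> cf gf x y Xx Xy; apply/ler_addgt0Pr => e e0.
set z := fun t : R => x + t *: (y - x).
have zE t : z t = t *: y + (1 - t) *: x.
  by rewrite /z scalerBr scalerBl scale1r addrCA.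
have e'0 : 0 < e / (1 + enorm (y - x)).
  by rewrite divr_gt0// ltr_pwDl// enorm_ge0.
have := gf x Xx _ e'0; rewrite /prop_near1 /within/= => near_x.
have cz : z t @[t --> 0^'+] --> x.
  apply: cvg_at_right_filter.
  rewrite [X in _ --> X](_ : x = x + 0 *: (y - x)); last by rewrite scale0r addr0.
  by apply: cvgD; [exact: cvg_cst|apply: cvgZr_tmp; exact: cvg_id].
have [t [/= h t0 t1]] : exists t : R, [/\
    X (z t) -> `|f (z t) - f x - dotv (g x) (z t - x)| <= e / (1 + enorm (y - x)) * enorm (z t - x),
    0 < t & t < 1].
  apply: (@filter_ex _ (0 : R)^'+).
  near=> t; split; near: t; [exact: cz near_x|exact: nbhs_right_gt|].
  exact: nbhs_right_lt.
have Xz : X (z t) by rewrite zE; apply: cX => //; exact: ltW.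
move: (h Xz); have -> : z t - x = t *: (y - x) by rewrite /z addrAC subrr add0r.
rewrite dotvZr enormZ ?(ltW t0)// ler_norml => /andP[h1 _].
have h2 : f (z t) <= t * f y + (1 - t) * f x.
  rewrite zE.
  exact: (cf (Itv01 (ltW t0) (ltW t1)) y x (mem_set Xy) (mem_set Xx)).
have h3 : e / (1 + enorm (y - x)) * enorm (y - x) <= e.
  rewrite mulrAC ler_pdivrMr ?ltr_pwDl ?enorm_ge0//.
  by rewrite ler_wpM2l ?(ltW e0)// lerDr.
rewrite -(ler_pM2l t0); nra.
Unshelve. all: by end_near. Qed.

Hypothesis gi : forall x y, X x -> X y -> f x + dotv (g x) (y - x) <= f y.
Variable L : R.
Hypothesis L0 : 0 <= L.
Hypothesis lip : forall x y, X x -> X y -> nsq (g x - g y) <= L ^+ 2 * nsq (x - y).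

Lemma le_of_le_invn (a b c : R) : (forall N, a <= b + c / N.+1%:R) -> a <= b.
Proof.
move=> h; apply/ler_addgt0Pr => e e0.
have [c0|c0] := leP c 0.
  apply: le_trans (h 0%N) _; rewrite divr1 lerD2l; exact: le_trans c0 (ltW e0).
apply: le_trans (h (Num.truncn (c / e))) _; rewrite lerD2l ler_pdivrMr//.
rewrite mulrC -ler_pdivrMr//.
by apply/ltW; have := Num.Theory.truncnS_gt (c / e).
Qed.

(** The usual quadratic bound. Summing the gradient inequalities along a fine
subdivision of the segment replaces the integral of the gradient. *)
Lemma smooth_upper_bound x y : X x -> X y ->
  f y <= f x + dotv (g x) (y - x) + L / 2 * nsq (y - x).
Proof.
move=> Xx Xy.
apply: (@le_of_le_invn _ _ (L / 2 * nsq (y - x))) => N.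
set M : R := N.+1%:R; have M0 : 0 < M by rewrite ltr0n.
have [h hE] : exists h, h = M^-1 *: (y - x) by eexists.
pose z (k : nat) := x + k%:R *: h.
have Xz k : (k <= N.+1)%N -> X (z k).
  move=> kN; have -> : z k = (k%:R / M) *: y + (1 - k%:R / M) *: x.
    by rewrite /z hE scalerA scalerBr scalerBl scale1r addrCA.
  apply: cX => //; first by rewrite divr_ge0// ltW.
  by rewrite ler_pdivrMr// mul1r ler_nat.
have st k : (k <= N)%N ->
    f (z k.+1) <= f (z k) + dotv (g x) h + L * k.+1%:R * nsq h.
  move=> kN; have := gi (Xz k.+1 kN) (Xz k (leqW kN)).
  have -> : z k - z k.+1 = - h.
    by rewrite /z -natr1 scalerDl scale1r opprD addrACA subrr add0r opprD addrA subrr add0r.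
  have := @dotv_le_lip _ _ (L * k.+1%:R) (g (z k.+1) - g x) h _ _.
  have -> : nsq (g (z k.+1) - g x) <= (L * k.+1%:R) ^+ 2 * nsq h.
    apply: le_trans (lip (Xz k.+1 kN) Xx) _.
    rewrite [z _ - x]addrAC subrr add0r dotvZl dotvZr exprMn -!mulrA; by lra.
  rewrite mulr_ge0// => /(_ isT isT).
  by rewrite !dotvE; lra.
have sm k : (k <= N.+1)%N -> f (z k) <= f x + k%:R * dotv (g x) h +
    L / 2 * (k%:R * (k%:R + 1)) * nsq h.
  elim: k => [_|k IH kN]; first by rewrite /z scale0r addr0; lra.
  have := IH (ltnW kN); have := st k kN; rewrite -natr1.
  by set dg := dotv _ _; set nh := dotv _ _; set fz := f _; nra.
have := sm N.+1 (leqnn _); rewrite -/M.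
have -> : z N.+1 = y by rewrite /z hE scalerA mulfV ?gt_eqF// scale1r addrC subrK.
rewrite hE !(dotvZl, dotvZr) => /le_trans; apply.
by rewrite le_eqVlt; apply/orP; left; apply/eqP; field; rewrite gt_eqF.
Qed.

End Gradients.

(** * Symmetric cocoercivity *)

Section Cocoercivity.
Context {R : realType} {d : nat}.
Local Notation V := 'rV[R]_d.
Variables (X : set V) (f : V -> R) (g : V -> V) (L : R) (P : 'M[R]_d).
Hypothesis cX : lconvex X.
Hypothesis L0 : 0 < L.
Hypothesis gi : forall x y, X x -> X y -> f x + dotv (g x) (y - x) <= f y.
Hypothesis lip : forall x y, X x -> X y -> nsq (g x - g y) <= L ^+ 2 * nsq (x - y).
Hypothesis oP : orth_projector P.
Hypothesis tP : forall x y, X x -> X y -> (x - y) *m P = x - y.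

Lemma dotv_tangent u x y : X x -> X y -> dotv (u *m P) (x - y) = dotv u (x - y).
Proof. by move=> Xx Xy; rewrite dotv_sym ?oP.1// tP. Qed.

Let G x := g x *m P.

Lemma tangent_lip x y : X x -> X y -> nsq (G x - G y) <= L ^+ 2 * nsq (x - y).
Proof.
move=> Xx Xy; rewrite /G -mulmxBl; apply: le_trans (lip Xx Xy).
exact: orth_projector_nsq.
Qed.

Let has_ball r x := X x /\ forall w, w *m P = w -> nsq w <= r -> X (x + w).

(* The gradient step below stays in X, so the classical proof applies. *)
Let local_bregman r x y : has_ball r x -> X y -> nsq (x - y) <= r ->
  (2 * L)^-1 * nsq (G x - G y) <= f x - f y - dotv (g y) (x - y).
Proof.
move=> [Xx bx] Xy xyr; have Lx := tangent_lip Xx Xy.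
have [De DeE] : exists De, De = G x - G y by eexists.
have DeP : De *m P = De by rewrite DeE /G -mulmxBl -mulmxA oP.2.
have Xz : X (x + (- L^-1) *: De).
  apply: bx; first by rewrite -scalemxAl DeP.
  apply: le_trans xyr; rewrite dotvZl dotvZr mulrA mulrNN -expr2 exprVn.
  by rewrite mulrC ler_pdivrMr ?exprn_gt0// mulrC DeE.
have := gi Xy Xz; have := smooth_upper_bound cX gi (ltW L0) lip Xx Xz.
have -> : x + - L^-1 *: De - x = - L^-1 *: De by rewrite addrAC subrr add0r.
have -> : x + - L^-1 *: De - y = (x - y) + - L^-1 *: De by rewrite addrAC.
rewrite -DeE; set fz := f (x + _).
have : dotv (g x - g y) De = nsq De.
  by rewrite {2}DeE /G -mulmxBl dotv_sym ?oP.1// DeP.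
rewrite !(dotvDr, dotvZr, dotvZl, dotvDl (g x), dotvNl (g y)) => e1 h1 h2.
have e2 : L / 2 * (- L^-1 * (- L^-1 * dotv De De)) = (2 * L)^-1 * dotv De De.
  by field; rewrite gt_eqF.
have e3 : L^-1 * dotv (g x) De = L^-1 * dotv (g y) De + 2 * ((2 * L)^-1 * dotv De De).
  have -> : dotv (g x) De = dotv (g y) De + dotv De De by lra.
  by field; rewrite gt_eqF.
by move: e2 e3 h1 h2; set iL := L^-1; set iL2 := (2 * L)^-1; lra.
Qed.

Let local_coco r x y : has_ball r x -> has_ball r y -> nsq (x - y) <= r ->
  nsq (G x - G y) <= L * dotv (G x - G y) (x - y).
Proof.
move=> bx b_y r1; have Xx := bx.1; have Xy := b_y.1.
have r2 : nsq (y - x) <= r by rewrite nsqB.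
have := local_bregman b_y Xx r2; have := local_bregman bx Xy r1.
rewrite (nsqB (G y)) -(dotv_tangent _ Xx Xy) -(dotv_tangent _ Xy Xx) -/(G x) -/(G y).
move=> h1 h2.
have : L^-1 * nsq (G x - G y) <= dotv (G x - G y) (x - y).
  have -> : L^-1 = (2 * L)^-1 + (2 * L)^-1 by field; rewrite gt_eqF.
  move: h1 h2; set nn := nsq (G x - G y); rewrite mulrDl dotvDl dotvNl -(opprB x y) dotvNr.
  by lra.
by rewrite mulrC ler_pdivrMr// mulrC.
Qed.

Let segment_coco r x y : 0 < r -> has_ball r x -> has_ball r y ->
  nsq (G x - G y) <= L * dotv (G x - G y) (x - y).
Proof.
move=> r0 [Xx bx] [Xy b_y].
pose N := (Num.truncn (nsq (y - x) / r)).
set M : R := N.+1%:R; have M0 : 0 < M by rewrite ltr0n.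
have M1 : 1 <= M by rewrite ler1n.
have [h hE] : exists h, h = M^-1 *: (y - x) by eexists.
have hM : M *: h = y - x by rewrite hE scalerA mulfV ?scale1r// gt_eqF.
have hr : nsq h <= r.
  rewrite hE dotvZl dotvZr mulrA -invfM mulrC ler_pdivrMr ?mulr_gt0//.
  have : nsq (y - x) / r < M by exact: Num.Theory.truncnS_gt.
  rewrite ltr_pdivrMr// => /ltW/le_trans; apply; rewrite mulrC ler_wpM2l ?(ltW r0)//.
  by rewrite ler_peMr// ltW.
pose z (k : nat) := x + k%:R *: h.
have bz k : (k <= N.+1)%N -> has_ball r (z k).
  move=> kN; have zE w : z k + w = (k%:R / M) *: (y + w) + (1 - k%:R / M) *: (x + w).
    by rewrite /z hE; apply/rowP => i; rewrite !mxE; ring.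
  have [k0 k1] : 0 <= k%:R / M /\ k%:R / M <= 1.
    by rewrite divr_ge0 ?(ltW M0)// ler_pdivrMr// mul1r ler_nat.
  split; first by rewrite -[z k]addr0 zE; apply: cX => //; rewrite addr0.
  by move=> w wP wr; rewrite zE; apply: cX => //; [exact: b_y|exact: bx].
have zN : z N.+1 = y by rewrite /z hM addrC subrK.
have z0 : z 0%N = x by rewrite /z scale0r addr0.
have zS k : z k.+1 - z k = h.
  by rewrite /z -natr1 scalerDl scale1r addrA [X in X - _]addrC addrK.
have tel : \sum_(0 <= k < N.+1) (G (z k.+1) - G (z k)) = G y - G x.
  by rewrite (telescope_sumr (fun k => G (z k)))// zN z0.
rewrite nsqB -tel; apply: le_trans (nsq_sum_le _ _) _.
rewrite size_iota subn0 -/M.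
apply: (@le_trans _ _ (M * \sum_(0 <= k < N.+1) L * dotv (G (z k.+1) - G (z k)) h)).
  rewrite ler_wpM2l ?(ltW M0)// big_nat_cond [leRHS]big_nat_cond.
  apply: ler_sum => k; rewrite andbT => /andP[_ kN].
  by rewrite -(zS k); apply: (@local_coco r); rewrite ?zS//; apply: bz => //; exact: ltnW.
rewrite -mulr_sumr -dotv_suml tel mulrCA -(dotvZr M) hM.
by rewrite -(opprB (G x)) -(opprB x) dotvNl dotvNr opprK.
Qed.

Variables (b : V) (rho : R).
Hypothesis ball : relative_ball X P b rho.

(** Cocoercivity survives on [X] only in this symmetric form: the inequality
with the Bregman divergence in place of the inner product can fail, since the
gradient step behind it can leave [X]. The segment is first
pushed into the relative interior, towards [b], and cut into pieces so short
that gradient steps stay in [X]. *)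
Lemma cocoercive x y : X x -> X y ->
  nsq (G x - G y) <= L * dotv (G x - G y) (x - y).
Proof.
move=> Xx Xy; have [rho0 Xb bb] := ball.
set K := L ^+ 2 * (2 * nsq (b - x) + 2 * nsq (b - y)).
have K0 : 0 <= K.
  by rewrite mulr_ge0 ?sqr_ge0// addr_ge0// mulr_ge0// nsq_ge0.
have [a aE] : exists a, a = G x - G y by eexists.
have [u uE] : exists u, u = x - y by eexists.
rewrite -aE -uE.
apply: (@le_of_le_invn _ _ _ (nsq a + K + L * (nsq u + K) + L * (nsq a + nsq u))) => N.
set t : R := N.+1%:R^-1.
have t0 : 0 < t by rewrite invr_gt0 ltr0n.
have t1 : t <= 1 by rewrite invf_le1 ?ltr0n// ler1n.
pose p z := t *: b + (1 - t) *: z.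
have Xp z : X z -> X (p z) by move=> Xz; apply: cX => //; exact: ltW.
have pb z : X z -> has_ball (t ^+ 2 * rho) (p z).
  move=> Xz; split; [exact: Xp|move=> w wP wr].
  have -> : p z + w = t *: (b + t^-1 *: w) + (1 - t) *: z.
    by rewrite /p scalerDr scalerA mulfV ?gt_eqF// scale1r addrAC.
  apply: cX => //; last exact: ltW.
  apply: bb; first by rewrite -scalemxAl wP.
  by rewrite dotvZl dotvZr mulrA -expr2 exprVn mulrC ler_pdivrMr ?exprn_gt0// mulrC.
have r0 : 0 < t ^+ 2 * rho by rewrite mulr_gt0// exprn_gt0.
have := segment_coco r0 (pb x Xx) (pb y Xy).
have [e eE] : exists e, e = (G (p x) - G x) - (G (p y) - G y) by eexists.
have -> : G (p x) - G (p y) = a + e.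
  by rewrite eE aE; apply/rowP => i; rewrite !mxE; ring.
have -> : p x - p y = (1 - t) *: u.
  by rewrite /p uE; apply/rowP => i; rewrite !mxE; ring.
have pz z : p z - z = t *: (b - z).
  by rewrite /p; apply/rowP => i; rewrite !mxE; ring.
have ne : nsq e <= t ^+ 2 * K.
  rewrite eE; apply: le_trans (nsqD2_le _ _) _; rewrite nsqN.
  have := tangent_lip (Xp x Xx) Xx; have := tangent_lip (Xp y Xy) Xy.
  rewrite !pz !(dotvZl t, dotvZr t) /K.
  by set A := nsq (b - x); set B := nsq (b - y); lra.
have y1 := dotv_young (- a) e t0; have y2 := dotv_young u e t0.
have y3 := @dotv_young _ _ 1 (- a) u ltr01.
have nie : (2 * t)^-1 * nsq e <= t / 2 * K.
  have -> : t / 2 * K = (2 * t)^-1 * (t ^+ 2 * K) by field; rewrite gt_eqF.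
  by rewrite ler_wpM2l// invr_ge0 mulr_ge0// ltW.
move: y1 y2 y3; rewrite !dotvE !opprK (dotvC e a) (dotvC e u).
have := nsq_ge0 e; have := nsq_ge0 a; have := nsq_ge0 u.
move: nie; rewrite -/t.
set ne' := nsq e; set na := nsq a; set nu := nsq u.
set ae := dotv a e; set ue := dotv u e; set au := dotv a u; set it := (2 * t)^-1.
move=> nie nu0 na0 ne0 y1 y2 y3 h.
have y1' : - ae <= t / 2 * na + t / 2 * K by lra.
have y2' : (1 - t) * ue <= (1 - t) * (t / 2 * nu + t / 2 * K).
  by rewrite ler_wpM2l; lra.
have y2'' : t * (t / 2 * nu + t / 2 * K) >= 0.
  by rewrite mulr_ge0 ?(ltW t0)// addr_ge0// mulr_ge0// divr_ge0// ltW.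
have y4 : L * ((1 - t) * ue) <= L * (t / 2 * nu + t / 2 * K).
  by rewrite ler_pM2l//; lra.
have y5 : L * (t * (- au)) <= L * (t * (1 / 2 * na + (2 * 1)^-1 * nu)).
  by rewrite !ler_pM2l.
have y6 : 0 <= L * t * (nu + K) by rewrite !mulr_ge0 ?(ltW t0) ?(ltW L0)// addr_ge0.
have y7 : 0 <= L * t * (na + nu) by rewrite !mulr_ge0 ?(ltW t0) ?(ltW L0)// addr_ge0.
move: h y5 y6 y7 y4; rewrite (_ : (2 * 1)^-1 = 1 / 2); last by rewrite mulr1 div1r.
nra.
Qed.

End Cocoercivity.

(** * Averages and existence of minimizers *)

Section Mean.
Context {R : realType} {n : nat}.
Implicit Types a b : 'I_n -> R.

Definition mean a := n%:R^-1 * \sum_(i < n) a i.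

Lemma meanD a b : mean (fun i => a i + b i) = mean a + mean b.
Proof. by rewrite /mean big_split mulrDr. Qed.

Lemma meanZ c a : mean (fun i => c * a i) = c * mean a.
Proof. by rewrite /mean -mulr_sumr mulrCA. Qed.

Lemma meanB a b : mean (fun i => a i - b i) = mean a - mean b.
Proof. by rewrite /mean sumrB mulrBr. Qed.

Lemma le_mean a b : (forall i, a i <= b i) -> mean a <= mean b.
Proof.
move=> h; rewrite /mean ler_wpM2l ?invr_ge0 ?ler0n//.
by apply: ler_sum => i _; exact: h.
Qed.

Lemma mean_cst c : (0 < n)%N -> mean (fun=> c) = c.
Proof.
move=> n0; rewrite /mean sumr_const card_ord -(mulr_natl c) mulrA mulVf ?mul1r//.
by rewrite pnatr_eq0 -lt0n.
Qed.

Lemma eq_mean a b : a =1 b -> mean a = mean b.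
Proof. by move=> h; rewrite /mean; congr (_ * _); apply: eq_bigr. Qed.

Lemma mean_ge0 a : (forall i, 0 <= a i) -> 0 <= mean a.
Proof. by move=> h; rewrite mulr_ge0 ?invr_ge0 ?ler0n// sumr_ge0. Qed.

Context {d : nat}.
Implicit Types g h : 'I_n -> 'rV[R]_d -> 'rV[R]_d.

Lemma dotv_avgg g x u : dotv (avgg g x) u = mean (fun i => dotv (g i x) u).
Proof. by rewrite /avgg dotvZl dotv_suml. Qed.

End Mean.

Section SmoothProblem.
Context {R : realType} {d n : nat}.
Local Notation V := 'rV[R]_d.

(** What the analysis uses of the component functions; [G] is the family of
tangential gradients. *)
Record smooth_problem (X : set V) (L : R) (f : 'I_n -> V -> R)
    (G : 'I_n -> V -> V) : Prop := SmoothProblem {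
  sp_convex : lconvex X;
  sp_closed : closed X;
  sp_bounded : exists D, forall x y, X x -> X y -> nsq (x - y) <= D;
  sp_n : (0 < n)%N;
  sp_L : 0 < L;
  sp_grad : forall i x y, X x -> X y -> f i x + dotv (G i x) (y - x) <= f i y;
  sp_smooth : forall i x y, X x -> X y ->
    f i y <= f i x + dotv (G i x) (y - x) + L / 2 * nsq (y - x);
  sp_lip : forall i x y, X x -> X y ->
    nsq (G i x - G i y) <= L ^+ 2 * nsq (x - y);
  sp_coco : forall i x y, X x -> X y ->
    nsq (G i x - G i y) <= L * dotv (G i x - G i y) (x - y) }.

(** The component of a gradient that is normal to [X] is invisible to [f] and to
the projected iteration, but it would spoil cocoercivity, so it is projected
away. *)
Lemma tangent_smooth_problem (X : set V) (L D : R) f grad x0 :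
  (0 < n)%N -> 0 < L -> closed X -> @convex_set R V X ->
  (forall x y, X x -> X y -> enorm (x - y) <= D) ->
  (forall i, @convex_function R V X (f i)) ->
  (forall i, smooth_on X L (f i) (grad i)) -> X x0 ->
  exists G, smooth_problem X L f G /\
    forall i u x y, X x -> X y -> dotv (grad i u) (x - y) = dotv (G i u) (x - y).
Proof.
move=> n0 L0 clX /convex_set_lconvex cX bX cf sf Xx0.
have [P [b [rho [oP bP tP]]]] := tangent_projector cX Xx0.
have tg i u x y : X x -> X y ->
    dotv (grad i u) (x - y) = dotv (grad i u *m P) (x - y).
  by move=> Xx Xy; rewrite (dotv_tangent oP tP).
have lip i x y : X x -> X y -> nsq (grad i x - grad i y) <= L ^+ 2 * nsq (x - y).
  by move=> Xx Xy; rewrite -enorm_le_nsq ?(ltW L0)//; exact: (sf i).2.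
have gi i := convex_gradient_ineq cX (cf i) (sf i).1.
exists (fun i x => grad i x *m P); split => //; split => //.
- exists (D ^+ 2) => x y Xx Xy; have h := bX _ _ Xx Xy.
  rewrite -enorm_sqr ler_pXn2r// nnegrE ?enorm_ge0//.
  exact: le_trans (enorm_ge0 _) h.
- by move=> i x y Xx Xy; rewrite -tg//; exact: gi.
- move=> i x y Xx Xy; rewrite -tg//.
  exact: (smooth_upper_bound cX (gi i) (ltW L0) (lip i)).
- by move=> i x y Xx Xy; exact: (tangent_lip (lip i) oP).
- by move=> i x y Xx Xy; exact: (cocoercive cX L0 (gi i) (lip i) oP tP bP).
Qed.

Context (X : set V) (L : R) (f : 'I_n -> V -> R) (G : 'I_n -> V -> V).
Hypothesis sp : smooth_problem X L f G.
Local Notation F := (avgf f).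
Local Notation GF := (avgg G).
Let L0 := sp_L sp.
Let n0 := sp_n sp.

Lemma avgf_grad x y : X x -> X y -> F x + dotv (GF x) (y - x) <= F y.
Proof.
move=> Xx Xy; rewrite dotv_avgg -[F x]/(mean _) -meanD.
by apply: le_mean => i; exact: (sp_grad sp).
Qed.

Lemma avgf_smooth x y : X x -> X y ->
  F y <= F x + dotv (GF x) (y - x) + L / 2 * nsq (y - x).
Proof.
move=> Xx Xy; rewrite dotv_avgg -[F x]/(mean _) -meanD.
rewrite -(mean_cst (L / 2 * _) n0) -meanD.
by apply: le_mean => i; exact: (sp_smooth sp).
Qed.

(** The mean square variation of the component gradients, which is what the
variance of the stochastic gradient is compared with. *)
Definition gvar x y := mean (fun i => nsq (G i x - G i y)).

Lemma gvar_ge0 x y : 0 <= gvar x y.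
Proof. by apply: mean_ge0 => i; exact: nsq_ge0. Qed.

Lemma gvar_le_sym x y : X x -> X y ->
  gvar x y <= L * dotv (GF x - GF y) (x - y).
Proof.
move=> Xx Xy; rewrite dotvDl dotvNl !dotv_avgg -mulN1r -meanZ -meanD -meanZ.
apply: le_mean => i; rewrite mulN1r -dotvNl -dotvDl; exact: (sp_coco sp).
Qed.

Lemma gvar_le_nsq x y : X x -> X y -> gvar x y <= L ^+ 2 * nsq (x - y).
Proof.
move=> Xx Xy; rewrite -(mean_cst (_ * _) n0).
by apply: le_mean => i; exact: (sp_lip sp).
Qed.

Lemma gvar_triangle c x y z : 0 < c ->
  gvar x z <= (1 + c) * gvar x y + (1 + c^-1) * gvar y z.
Proof.
move=> c0; rewrite -!meanZ -meanD; apply: le_mean => i.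
by have := nsqD_le (G i x - G i y) (G i y - G i z) c0; rewrite addrA subrK.
Qed.

Lemma gvarC x y : gvar x y = gvar y x.
Proof. by apply: eq_mean => i; rewrite nsqB. Qed.

Lemma dotv_continuous (a : V) : continuous (fun y : V => dotv a y).
Proof.
apply: continuous_big => [|i _ x]; first exact: add_continuous.
have h := @coord_continuous R 1 d ord0 i x.
exact: cvgM (cvg_cst _) h.
Qed.

Lemma nsq_continuous (s : V) : continuous (fun y : V => nsq (y - s)).
Proof.
apply: continuous_big => [|i _ x]; first exact: add_continuous.
have h : (fun y : V => (y - s) ord0 i) @ x --> (x - s) ord0 i.
  have -> : (fun y : V => (y - s) ord0 i) = (fun y => y ord0 i - s ord0 i).
    by apply/funext => y; rewrite !mxE.
  rewrite !mxE; have h := @coord_continuous R 1 d ord0 i x.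
  exact: cvgB h (cvg_cst _).
exact: (cvgM h h).
Qed.

Lemma bounded_compact : compact X.
Proof.
have [D XD] := sp_bounded sp.
apply: bounded_closed_compact (sp_closed sp).
have [[x0 Xx0]|X0] := pselect (exists x, X x); last first.
  by exists 0; split=> // r _ x Xx; exfalso; apply: X0; exists x.
exists (`|x0| + Num.sqrt D); split; first exact: num_real.
move=> r rM x Xx /=; apply: le_trans (ltW rM).
rewrite -lerBlDl; apply: le_trans (lerB_dist _ _) _.
rewrite /Num.norm/= mx_normrE; apply/bigmax_leP; split=> [|[i j] _ /=].
  exact: sqrtr_ge0.
rewrite -sqrtr_sqr ler_sqrt; last exact: le_trans (nsq_ge0 _) (XD _ _ Xx Xx0).
apply: le_trans (XD _ _ Xx Xx0).
rewrite ord1 /dotv (bigD1 j)//= -expr2 lerDl sumr_ge0// => k _.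
by rewrite -expr2 sqr_ge0.
Qed.

Lemma attains_min (h : V -> R) x0 : X x0 ->
  (forall x, X x -> h @ within X (nbhs x) --> h x) ->
  exists2 p, X p & forall y, X y -> h p <= h y.
Proof.
move=> Xx0 ch.
have ne : X !=set0 by exists x0.
have ch' : {within X, continuous h} by exact/subspace_continuousP.
have [p Xp pm] := EVT_min_rV ne bounded_compact ch'.
by exists p => [|y Xy]; [exact: set_mem|apply: pm; exact: mem_set].
Qed.

Lemma avgf_continuous x : X x -> F @ within X (nbhs x) --> F x.
Proof.
move=> Xx.
have ev (h : V -> R) : continuous h -> h @ within X (nbhs x) --> h x.
  by move=> ch; apply: cvg_within_filter; exact: ch.
apply: (@squeeze_cvgr _ _ _ _ (fun y => F x + dotv (GF x) y - dotv (GF x) x)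
  (fun y => F x + dotv (GF x) y - dotv (GF x) x + L / 2 * nsq (y - x))).
- near=> y; have Xy : X y by near: y; exact: withinT.
  have := avgf_grad Xx Xy; have := avgf_smooth Xx Xy.
  by rewrite !(dotvDr _ _ (GF x)) dotvNr => h1 h2; apply/andP; split; lra.
- have := cvgB (cvgD (cvg_cst (F x)) (ev _ (@dotv_continuous (GF x))))
    (cvg_cst (dotv (GF x) x)).
  by rewrite addrK => h; apply: h.
- have := cvgD (cvgB (cvgD (cvg_cst (F x)) (ev _ (@dotv_continuous (GF x))))
    (cvg_cst (dotv (GF x) x))) (cvgM (cvg_cst (L / 2)) (ev _ (@nsq_continuous x))).
  by rewrite addrK subrr dotv0l mulr0 addr0 => h; apply: h.
Unshelve. all: by end_near. Qed.

End SmoothProblem.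

(** * Projections and proximal points *)

Section Prox.
Context {R : realType} {d n : nat}.
Local Notation V := 'rV[R]_d.
Context (X : set V) (L : R) (f : 'I_n -> V -> R) (G : 'I_n -> V -> V).
Hypothesis sp : smooth_problem X L f G.
Local Notation F := (avgf f).
Local Notation GF := (avgg G).
Variable x0 : V.
Hypothesis Xx0 : X x0.
Let L0 := sp_L sp.
Let cX := sp_convex sp.

Lemma first_order_le (a b : R) : 0 <= b ->
  (forall t, 0 < t -> t <= 1 -> 0 <= t * a + t ^+ 2 * b) -> 0 <= a.
Proof.
move=> b0 h; rewrite -oppr_le0; apply: (@le_of_le_invn _ _ _ b) => N.
set t : R := N.+1%:R^-1.
have t0 : 0 < t by rewrite invr_gt0 ltr0n.
have t1 : t <= 1 by rewrite invf_le1 ?ltr0n// ler1n.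
by have := h t t0 t1; rewrite add0r expr2 -mulrA -mulrDr pmulr_rge0// -/t; lra.
Qed.

Lemma projP z : X (proj X z) /\ forall q, X q -> nsq (z - proj X z) <= nsq (z - q).
Proof.
have [|p Xp pm] := attains_min sp (h := fun y => nsq (y - z)) Xx0.
  by move=> x Xx; apply: cvg_within_filter; exact: nsq_continuous.
have : exists p, [set p | X p /\ forall q, X q -> enorm (z - p) <= enorm (z - q)] p.
  exists p; split=> // q Xq; rewrite enorm_leE !(nsqB z); exact: pm.
move=> /(xgetPex 0) [X1 X2]; split=> // q Xq.
by rewrite -enorm_leE; exact: X2.
Qed.

Lemma proj_in z : X (proj X z). Proof. exact: (projP z).1. Qed.

Lemma proj_variational z w : X w -> dotv (z - proj X z) (w - proj X z) <= 0.
Proof.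
move=> Xw; have [Xp pm] := projP z; move: (proj X z) Xp pm => p Xp pm.
rewrite -oppr_ge0.
suff : 0 <= 2 * - dotv (z - p) (w - p) by rewrite pmulr_rge0.
apply: (@first_order_le _ (nsq (w - p)) (nsq_ge0 _)) => t t0 t1.
have := pm _ (cX Xw Xp (ltW t0) t1).
have -> : z - (t *: w + (1 - t) *: p) = (z - p) - t *: (w - p).
  by apply/rowP => i; rewrite !mxE; ring.
move: (z - p) (w - p) => u v; rewrite !dotvE (dotvC v u); lra.
Qed.

Lemma proj_monotone z z' : nsq (proj X z - proj X z') <=
  dotv (z - z') (proj X z - proj X z').
Proof.
have := proj_variational z (proj_in z'); have := proj_variational z' (proj_in z).
move: (proj X z) (proj X z') => p p'.
rewrite !dotvE (dotvC p' p); lra.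
Qed.

Lemma proj_nsq_le z w : X w -> nsq (proj X z - w) <= nsq (z - w).
Proof.
move=> Xw; have := proj_variational z Xw; have := nsq_ge0 (z - proj X z).
move: (proj X z) => p; rewrite !dotvE (dotvC w p) (dotvC p z) (dotvC w z); lra.
Qed.

(** First-order optimality of [p] for [F + lambda / 2 * |. - s|^2] on [X]. *)
Definition is_prox (lambda : R) (s p : V) :=
  X p /\ forall y, X y -> 0 <= dotv (GF p + lambda *: (p - s)) (y - p).

Definition prox (lambda : R) (s : V) : V :=
  xget s [set p | is_prox lambda s p].

Lemma prox_is_prox lambda s : 0 <= lambda -> is_prox lambda s (prox lambda s).
Proof.
move=> l0.
have [|p Xp pm] := attains_min sp (h := fun y => F y + lambda / 2 * nsq (y - s)) Xx0.
  move=> x Xx; apply: cvgD; first exact: (avgf_continuous sp).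
  by apply: cvgM; [exact: cvg_cst|apply: cvg_within_filter; exact: nsq_continuous].
suff h : is_prox lambda s p by apply: (@xgetPex _ s [set p | is_prox lambda s p]); exists p.
split=> // y Xy; apply: (@first_order_le _ ((L + lambda) / 2 * nsq (y - p))).
  by rewrite mulr_ge0 ?nsq_ge0// divr_ge0// addr_ge0// ltW.
move=> t t0 t1.
have Xt := cX Xy Xp (ltW t0) t1.
have := pm _ Xt; have := avgf_smooth sp Xp Xt.
have -> : t *: y + (1 - t) *: p - p = t *: (y - p).
  by apply/rowP => i; rewrite !mxE; ring.
have -> : t *: y + (1 - t) *: p - s = (p - s) + t *: (y - p).
  by apply/rowP => i; rewrite !mxE; ring.
rewrite !(dotvDl (GF p)); move: (p - s) (y - p) => u v.
rewrite !dotvE (dotvC v u); set fy := F _; lra.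
Qed.

Section IsProx.
Variables (lambda : R) (s p : V).
Hypothesis pP : is_prox lambda s p.

Lemma is_prox_grad y : X y -> lambda * dotv (s - p) (y - p) <= dotv (GF p) (y - p).
Proof. by move=> /pP.2; rewrite !dotvE; lra. Qed.

Lemma is_prox_le y : X y -> F p + lambda * dotv (s - p) (y - p) <= F y.
Proof.
move=> Xy; apply: le_trans (avgf_grad sp pP.1 Xy).
by rewrite lerD2l is_prox_grad.
Qed.

Lemma is_prox_strong y : X y ->
  F p + lambda / 2 * nsq (p - s) + lambda / 2 * nsq (y - p) <= F y + lambda / 2 * nsq (y - s).
Proof.
move=> Xy; have := is_prox_le Xy.
rewrite !dotvE (dotvC p y) (dotvC s y) (dotvC p s); lra.
Qed.

End IsProx.

End Prox.

(** * Expected values of randomized procedures *)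

Section HalfPowers.
Context {R : realType}.

Lemma sum_halves N : \sum_(0 <= j < N) (2 ^- j.+1 : R) = 1 - 2 ^- N.
Proof.
elim: N => [|N IH]; first by rewrite big_nil expr0 invr1 subrr.
rewrite big_nat_recr//= IH.
have -> : 2 ^- N = 2 * 2 ^- N.+1 :> R by rewrite exprS invfM mulrA mulfV// mul1r.
by set a := 2 ^- N.+1; lra.
Qed.

Lemma half_pow_ge0 N : 0 <= 2 ^- N :> R.
Proof. by rewrite invr_ge0 exprn_ge0. Qed.

Lemma cvg_halves : (2 ^- N : R) @[N --> \oo] --> (0 : R).
Proof.
have -> : (fun N => 2 ^- N : R) = geometric 1 (2^-1).
  by apply/funext => N; rewrite /geometric/= mul1r exprVn.
by apply: cvg_geometric; rewrite ger0_norm// invf_lt1// ltr1n.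
Qed.

Lemma le_sum_halves_bound (x : nat -> R) (M : R) N : (forall j, x j <= M) -> 0 <= M ->
  \sum_(0 <= j < N) 2 ^- j.+1 * x j <= M.
Proof.
move=> xM M0; apply: (@le_trans _ _ (\sum_(0 <= j < N) 2 ^- j.+1 * M)).
  by apply: ler_sum => j _; rewrite ler_wpM2l// half_pow_ge0.
by rewrite -mulr_suml sum_halves -[leRHS]mul1r ler_wpM2r// gerBl half_pow_ge0.
Qed.

Lemma is_cvg_halves (x : nat -> R) (M : R) : (forall j, `|x j| <= M) ->
  cvgn (series (fun j => 2 ^- j.+1 * x j)).
Proof.
move=> xM; apply: normed_cvg; have M0 := le_trans (normr_ge0 _) (xM 0%N).
apply: nondecreasing_is_cvgn.
  by apply/nondecreasing_seqP => k; rewrite /normed_series_of seriesSr lerDl normr_ge0.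
exists M => _ [N _ <-]; rewrite /normed_series_of /series/=.
under eq_bigr do rewrite normrM (ger0_norm (half_pow_ge0 _)).
exact: le_sum_halves_bound.
Qed.

End HalfPowers.

Section Semantics.
Context {R : realType} {V : Type} {n : nat}.
Variable grad : 'I_n -> V -> V.

(** Real-valued expectation. A [Geom] node is the limit of a series, so the usual
rules hold for functions that are bounded on the outcomes. *)
Fixpoint expect {A : Type} (p : prog V n A) (h : A -> R) : R :=
  match p with
  | Ret a => h a
  | Query i x k => expect (k (grad i x)) h
  | Unif k => mean (fun i => expect (k i) h)
  | Geom k => limn (series (fun j => 2 ^- j.+1 * expect (k j) h))
  end.

(** This ranges over all outcomes and so is stronger than an almost sure
property. *)
Fixpoint always {A : Type} (p : prog V n A) (Q : A -> Prop) : Prop :=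
  match p with
  | Ret a => Q a
  | Query i x k => always (k (grad i x)) Q
  | Unif k => forall i, always (k i) Q
  | Geom k => forall j, always (k j) Q
  end.

(** Such a procedure has finitely many outcomes, and every function is bounded on
them. *)
Fixpoint geomfree {A : Type} (p : prog V n A) : Prop :=
  match p with
  | Ret a => True
  | Query i x k => geomfree (k (grad i x))
  | Unif k => forall i, geomfree (k i)
  | Geom k => False
  end.

(** Unlike [expect], this is meaningful without any bound, since its terms are
nonnegative. *)
Fixpoint cost {A : Type} (p : prog V n A) : \bar R :=
  (match p with
  | Ret a => 0
  | Query i x k => 1 + cost (k (grad i x))
  | Unif k => (n%:R^-1)%:E * \sum_(i < n) cost (k i)
  | Geom k => \sum_(j <oo) ((2 ^- j.+1)%R)%:E * cost (k j)
  end)%E.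

Definition bounded_on {A : Type} (p : prog V n A) (h : A -> R) :=
  exists M, always p (fun a => `|h a| <= M).

Section Rules.
Context {A B : Type}.
Implicit Types (p : prog V n A) (q : A -> prog V n B) (h : A -> R).

Lemma expect_bind p q (h' : B -> R) : expect (bind p q) h' = expect p (fun a => expect (q a) h').
Proof.
elim: p => [a|i x k IH|k IH|k IH] //=; first exact: eq_mean.
by congr (limn (series _)); apply/funext => j; rewrite IH.
Qed.

Lemma always_sub p (Q Q' : A -> Prop) : (forall a, Q a -> Q' a) ->
  always p Q -> always p Q'.
Proof.
move=> QQ'; elim: p => [a|i x k IH|k IH|k IH] /=; [exact: QQ'|exact: IH| |];
by move=> h i; apply: IH; exact: h.
Qed.

Lemma always_true p (Q : A -> Prop) : (forall a, Q a) -> always p Q.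
Proof. by move=> QT; elim: p => [a|i x k IH|k IH|k IH] //=; exact: IH. Qed.

Lemma always_bind p q (Q : B -> Prop) :
  always p (fun a => always (q a) Q) -> always (bind p q) Q.
Proof. by elim: p => [a|i x k IH|k IH|k IH] //=; [exact: IH| |]; move=> h i; exact: IH. Qed.

Lemma geomfree_bind p q : geomfree p -> (forall a, geomfree (q a)) -> geomfree (bind p q).
Proof.
move=> + gq; elim: p => [a|i x k IH|k IH|k IH] //=; first exact: IH.
by move=> h i; exact: IH.
Qed.

Lemma geomfree_bounded p h : geomfree p -> bounded_on p h.
Proof.
elim: p => [a _|i x k IH|k IH|k IH] //=; first by exists `|h a|; rewrite /= lexx.
  by move=> /IH [M hM]; exists M.
move=> gk; have /choice [M hM] : forall i, exists M, always (k i) (fun a => `|h a| <= M).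
  by move=> i; exact: IH (gk i).
exists (\sum_i `|M i|) => i /=; apply: always_sub (hM i) => a /le_trans; apply.
apply: le_trans (ler_norm (M i)) _.
by rewrite (bigD1 i)//= lerDl; apply: sumr_ge0 => j _; exact: normr_ge0.
Qed.

Hypothesis n0 : (0 < n)%N.

Lemma expect_norm_le p h M : always p (fun a => `|h a| <= M) -> `|expect p h| <= M.
Proof.
elim: p => [a|i x k IH|k IH|k IH] //=; first exact: IH.
  move=> hM; have {hM}IH i := IH i (hM i); rewrite ler_norml; apply/andP; split.
    rewrite -[leLHS](mean_cst _ n0); apply: le_mean => i.
    by have := IH i; rewrite ler_norml => /andP[].
  rewrite -[leRHS](mean_cst _ n0); apply: le_mean => i.
  by have := IH i; rewrite ler_norml => /andP[].
move=> hM; have {hM}IH i := IH i (hM i).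
have M0 := le_trans (normr_ge0 _) (IH 0%N).
have cv := is_cvg_halves IH.
have [IH1 IH2] : (forall j, expect (k j) h <= M) /\ (forall j, - expect (k j) h <= M).
  by split=> j; have := IH j; rewrite ler_norml; lra.
rewrite ler_norml; apply/andP; split.
  apply: limr_ge => //; apply: nearW => N; rewrite /series/= lerNl -sumrN.
  under eq_bigr do rewrite -mulrN.
  exact: le_sum_halves_bound.
by apply: limr_le => //; apply: nearW => N; exact: le_sum_halves_bound.
Qed.

Lemma expect_geom_cvg k h : bounded_on (Geom k : prog V n A) h ->
  (series (fun j => 2 ^- j.+1 * expect (k j) h)) @ \oo --> expect (Geom k) h.
Proof.
by move=> [M hM]; apply: (@is_cvg_halves _ _ M) => j; apply: expect_norm_le; exact: hM.
Qed.

Lemma expect_le p h h' : always p (fun a => h a <= h' a) ->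
  bounded_on p h -> bounded_on p h' -> expect p h <= expect p h'.
Proof.
elim: p => [a|i x k IH|k IH|k IH] //=; first exact: IH.
  move=> hh [M hM] [M' hM']; apply: le_mean => i; apply: IH => //.
    by exists M; exact: hM.
  by exists M'; exact: hM'.
move=> hh bh bh'; have := expect_geom_cvg bh'; have := expect_geom_cvg bh.
move=> /[dup] /cvg_lim <-// cv /[dup] /cvg_lim <-// cv'.
have [M hM] := bh; have [M' hM'] := bh'.
apply: ler_lim; [exact: (cvgP _ cv)|exact: (cvgP _ cv')|].
apply: nearW => N; apply: ler_sum => j _; rewrite ler_wpM2l ?half_pow_ge0//.
by apply: IH => //; [exists M; exact: hM|exists M'; exact: hM'].
Qed.

Lemma expectD p h h' : bounded_on p h -> bounded_on p h' ->
  expect p (fun a => h a + h' a) = expect p h + expect p h'.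
Proof.
elim: p => [a|i x k IH|k IH|k IH] //=; first exact: IH.
  move=> [M hM] [M' hM']; rewrite -meanD; apply: eq_mean => i.
  by apply: IH; [exists M; exact: hM|exists M'; exact: hM'].
move=> bh bh'; have [M hM] := bh; have [M' hM'] := bh'.
apply/cvg_lim => //.
rewrite [X in X @ _ --> _](_ : _ = series (fun j => 2 ^- j.+1 * expect (k j) h) +
  series (fun j => 2 ^- j.+1 * expect (k j) h')).
  exact: cvgD (expect_geom_cvg bh) (expect_geom_cvg bh').
apply/funext => N; rewrite fctE /series/= -big_split/=; apply: eq_bigr => j _.
rewrite -mulrDr; congr (_ * _).
by rewrite IH//; [exists M; exact: hM|exists M'; exact: hM'].
Qed.

Lemma expectZ p c h : bounded_on p h ->
  expect p (fun a => c * h a) = c * expect p h.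
Proof.
elim: p => [a|i x k IH|k IH|k IH] //=; first exact: IH.
  move=> [M hM]; rewrite -meanZ; apply: eq_mean => i.
  by apply: IH; exists M; exact: hM.
move=> bh; have [M hM] := bh.
apply/cvg_lim => //.
rewrite [X in X @ _ --> _](_ : _ =
  (fun N => c * series (fun j => 2 ^- j.+1 * expect (k j) h) N)).
  exact: cvgM (cvg_cst c) (expect_geom_cvg bh).
apply/funext => N; rewrite /series/= mulr_sumr; apply: eq_bigr => j _.
by rewrite mulrCA IH//; exists M; exact: hM.
Qed.

Lemma expect_cst p c : expect p (fun=> c) = c.
Proof.
elim: p => [a|i x k IH|k IH|k IH] //=; first by rewrite (eq_mean (b := fun=> c))// mean_cst.
apply/cvg_lim => //; under eq_fun do rewrite IH.
have -> : series (fun j => 2 ^- j.+1 * c) = (fun N => (1 - 2 ^- N) * c).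
  by apply/funext => N; rewrite /series/= -mulr_suml sum_halves.
have := cvgM (cvgB (cvg_cst (1 : R)) (@cvg_halves R)) (cvg_cst c).
by rewrite subr0 mul1r => h; apply: h.
Qed.

Lemma eq_expect p h h' : always p (fun a => h a = h' a) -> expect p h = expect p h'.
Proof.
elim: p => [a|i x k IH|k IH|k IH] //=; first exact: IH.
  by move=> hh; apply: eq_mean => i; exact: IH.
by move=> hh; congr (limn (series _)); apply/funext => j; rewrite (IH j (hh j)).
Qed.

End Rules.

End Semantics.

Section LawIntegral.
Context {R : realType} {V : Type} {n : nat} {A : pointedType}.
Variable grad : 'I_n -> V -> V.
Local Open Scope ereal_scope.

Let lawc_sigma_additive (p : prog V n A) c : semi_sigma_additive (lawc (R := R) grad p c).
Proof.
move=> S mS tS mUS; rewrite lawc_bigcup//.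
apply: is_cvg_nneseries => i _ _; exact: lawc_ge0.
Qed.

HB.instance Definition _ (p : prog V n A) c := isMeasure.Build _ _ _ (lawc (R := R) grad p c)
  (lawc0 grad p c) (lawc_ge0 grad p c) (@lawc_sigma_additive p c).

(** The integral of a nonnegative function against the law, computed along the
procedure; [c] counts the queries already made. *)
Fixpoint eint (p : prog V n A) (c : nat) (h : outcome A -> \bar R) : \bar R :=
  match p with
  | Ret a => h (a, c)
  | Query i x k => eint (k (grad i x)) c.+1 h
  | Unif k => (n%:R^-1)%:E * \sum_(i < n) eint (k i) c h
  | Geom k => \sum_(j <oo) ((2 ^- j.+1)%R)%:E * eint (k j) c h
  end.

Let integral_lawc (p : prog V n A) c (h : outcome A -> \bar R) : (forall o, 0 <= h o) ->
  \int[lawc grad p c]_o h o = eint p c h.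
Proof.
move=> h0; elim: p c => [a|i x k IH|k IH|k IH] c.
- rewrite (eq_measure_integral (\d_((a, c) : outcome A))).
    by rewrite integral_dirac// diracT mul1e.
  by move=> U _ _.
- by rewrite /= -IH; apply: eq_measure_integral => U _ _.
- have n0 : (0 <= (n%:R^-1 : R))%R by rewrite invr_ge0.
  pose m_ j : {measure set (outcome A) -> \bar R} :=
    if insub j is Some i then lawc grad (k i) c else mzero.
  rewrite (eq_measure_integral (mscale (NngNum n0) (msum m_ n))).
    rewrite ge0_integral_mscale// ge0_integral_measure_sum//=; congr (_ * _).
    by apply: eq_bigr => i _; rewrite /m_ valK IH.
  move=> U _ _; rewrite /= /mscale/= /msum; congr (_ * _).
  by apply: eq_bigr => i _; rewrite /m_ valK.
- have n0 j : (0 <= (2 ^- j.+1 : R))%R by rewrite invr_ge0 exprn_ge0.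
  pose m_ j : {measure set (outcome A) -> \bar R} :=
    mscale (NngNum (n0 j)) (lawc grad (k j) c).
  rewrite (eq_measure_integral (mseries m_ 0)).
    rewrite ge0_integral_measure_series//=; apply: eq_eseriesr => j _.
    by rewrite /m_ ge0_integral_mscale// IH.
  by move=> U _ _.
Qed.

Lemma integral_law (p : prog V n A) (h : outcome A -> \bar R) : (forall o, 0 <= h o) ->
  \int[Defs.law R grad p]_o h o = eint p 0 h.
Proof.
by move=> h0; rewrite -integral_lawc.
Qed.

Hypothesis n0 : (0 < n)%N.

Lemma eint_expect (p : prog V n A) c (h : A -> R) : (forall a, (0 <= h a)%R) ->
  bounded_on grad p h -> eint p c (fun o => (h o.1)%:E) = (expect grad p h)%:E.
Proof.
move=> h0; elim: p c => [a|i x k IH|k IH|k IH] c //=.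
- by move=> bh; exact: IH.
- move=> [M hM]; rewrite /mean EFinM -sumEFin; congr (_ * _).
  by apply: eq_bigr => i _; apply: IH; exists M; exact: hM.
- move=> bh; have [M hM] := bh; have := expect_geom_cvg n0 bh => cv.
  apply: cvg_lim => //.
  rewrite [X in X @ _ --> _](_ : _ = EFin \o series (fun j => 2 ^- j.+1 * expect grad (k j) h)%R).
    by apply: cvg_EFin => //; exact: nearW.
  apply/funext => N /=; rewrite /series/= -sumEFin; apply: eq_bigr => j _.
  by rewrite EFinM IH//; exists M; exact: hM.
Qed.

Lemma cost_ge0 B (p : prog V n B) : 0 <= cost (R := R) grad p.
Proof.
elim: p => [a|i x k IH|k IH|k IH] //=.
- exact: adde_ge0.
- by rewrite mule_ge0 ?lee_fin ?invr_ge0// sume_ge0.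
- by apply: nneseries_ge0 => j _ _; rewrite mule_ge0// lee_fin half_pow_ge0.
Qed.

Lemma eseries_halves (x : R) : (0 <= x)%R ->
  \sum_(j <oo) ((2 ^- j.+1)%R)%:E * x%:E = x%:E.
Proof.
move=> x0; under eq_eseriesr do rewrite muleC.
rewrite nneseriesZl; last by move=> j _; rewrite lee_fin half_pow_ge0.
rewrite [X in _ * X](_ : _ = 1) ?mule1//.
apply: cvg_lim => //.
rewrite [X in X @ _ --> _](_ : _ = EFin \o (fun N => 1 - 2 ^- N)%R).
  apply: cvg_EFin; first exact: nearW.
  by have := cvgB (cvg_cst (1 : R)%R) (@cvg_halves R); rewrite subr0 => h; apply: h.
by apply/funext => N /=; rewrite -sum_halves sumEFin.
Qed.

Lemma eint_cost (p : prog V n A) c :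
  eint p c (fun o => (o.2%:R)%:E) = (c%:R)%:E + cost grad p.
Proof.
elim: p c => [a|i x k IH|k IH|k IH] c //=.
- by rewrite adde0.
- by rewrite IH -natr1 EFinD addeA.
- under eq_bigr do rewrite IH.
  rewrite big_split/= sumEFin sumr_const card_ord ge0_muleDr; last 2 first.
  + by rewrite lee_fin mulrn_wge0.
  + by apply: sume_ge0 => i _; exact: cost_ge0.
  rewrite -EFinM -(mulr_natl c%:R) mulrA mulVf ?mul1r// pnatr_eq0 -lt0n//.
- under eq_eseriesr do rewrite IH ge0_muleDr ?lee_fin ?ler0n ?cost_ge0//.
  rewrite nneseriesD; last 2 first.
  + by move=> j _ _; rewrite mule_ge0 ?lee_fin ?half_pow_ge0 ?ler0n.
  + by move=> j _ _; rewrite mule_ge0 ?lee_fin ?half_pow_ge0 ?cost_ge0.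
  by rewrite eseries_halves.
Qed.

Lemma expected_queriesE (p : prog V n A) :
  \int[Defs.law R grad p]_o (o.2%:R)%:E = cost grad p.
Proof. by rewrite integral_law ?eint_cost ?add0e// => o; rewrite lee_fin. Qed.

End LawIntegral.

Section Loops.
Context {R : realType} {V : Type} {n : nat}.
Variable grad : 'I_n -> V -> V.
Hypothesis n0 : (0 < n)%N.
Local Notation expect := (expect (R := R) grad).
Local Notation always := (always grad).
Local Notation geomfree := (geomfree grad).
Local Notation cost := (cost (R := R) grad).

Lemma bindA {A B C : Type} (p : prog V n A) (q : A -> prog V n B) (r : B -> prog V n C) :
  bind (bind p q) r = bind p (fun a => bind (q a) r).
Proof.
by elim: p => [a|i x k IH|k IH|k IH] //=; congr (_ _); apply/funext => v; exact: IH.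
Qed.

Lemma bind_ret {A : Type} (p : prog V n A) : bind p Ret = p.
Proof.
by elim: p => [a|i x k IH|k IH|k IH] //=; congr (_ _); apply/funext => v; exact: IH.
Qed.

Section ForM.
Context {S : Type}.
Implicit Types (body : nat -> S -> prog V n S) (s : S).

Lemma forM_recl m (b : S -> prog V n S) s :
  forM m.+1 (fun=> b) s = bind (b s) (forM m (fun=> b)).
Proof.
elim: m s => [|m IH] s; first by rewrite /= bind_ret.
by rewrite -[LHS]/(bind (forM m.+1 _ s) b) IH bindA.
Qed.

Lemma always_forM (Inv : nat -> S -> Prop) m body s : Inv 0%N s ->
  (forall t s, (t < m)%N -> Inv t s -> always (body t s) (Inv t.+1)) ->
  always (forM m body s) (Inv m).
Proof.
move=> I0; elim: m => [|m IH] // hI /=; apply: always_bind.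
apply: always_sub (IH _) => [s' Is'|t s' tm]; first exact: hI.
by apply: hI; exact: leqW.
Qed.

Lemma geomfree_forM m body s : (forall t s, geomfree (body t s)) ->
  geomfree (forM m body s).
Proof. by move=> gb; elim: m => [|m IH] //=; exact: geomfree_bind. Qed.

(** A potential that does not increase in expectation along one pass does not
increase along the loop. *)
Lemma expect_forM_geomfree_le (Inv : nat -> S -> Prop) (Pot : nat -> S -> R)
    m body s : (forall t s, geomfree (body t s)) -> Inv 0%N s ->
  (forall t s, (t < m)%N -> Inv t s -> always (body t s) (Inv t.+1)) ->
  (forall t s, (t < m)%N -> Inv t s -> expect (body t s) (Pot t.+1) <= Pot t s) ->
  expect (forM m body s) (Pot m) <= Pot 0%N s.
Proof.
move=> gb I0; elim: m => [|m IH] // hI hP.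
have hI' t s' : (t < m)%N -> Inv t s' -> always (body t s') (Inv t.+1).
  by move=> tm; apply: hI; exact: leqW.
have aI := always_forM I0 hI'.
rewrite /= expect_bind; apply: le_trans (IH hI' _); last first.
  by move=> t s' tm; apply: hP; exact: leqW.
apply: expect_le => //; try by apply: geomfree_bounded; exact: geomfree_forM.
by apply: always_sub aI => s' Is'; exact: hP.
Qed.

(** A loop may be analysed on a richer state, as long as the extra components
do not influence the others. *)
Lemma expect_forM_sim {S' : Type} (pi : S' -> S) (body' : nat -> S' -> prog V n S')
    m body (z : S') :
  (forall t z h, expect (body' t z) (h \o pi) = expect (body t (pi z)) h) ->
  forall h, expect (forM m body' z) (h \o pi) = expect (forM m body (pi z)) h.
Proof.
move=> hs; elim: m => [|m IH] h //=; rewrite !expect_bind -IH.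
by apply: eq_expect; apply: always_true => z'; exact: hs.
Qed.

Local Open Scope ereal_scope.

Lemma cost_bind_leD {B : Type} (p : prog V n S) (q : S -> prog V n B) (c : R) :
  (0 <= c)%R -> (forall a, cost (q a) <= c%:E) -> cost (bind p q) <= cost p + c%:E.
Proof.
move=> c0 qc; elim: p => [a|i x k IH|k IH|k IH] /=; first by rewrite add0e.
- by rewrite -addeA leeD2l.
- apply: (@le_trans _ _ ((n%:R^-1)%:E * \sum_(i < n) (cost (k i) + c%:E))).
    rewrite lee_wpmul2l ?lee_fin ?invr_ge0//.
    by apply: lee_sum => i _; exact: IH.
  rewrite big_split/= sumEFin sumr_const card_ord ge0_muleDr; last 2 first.
  + by apply: sume_ge0 => i _; exact: cost_ge0.
  + by rewrite lee_fin mulrn_wge0.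
  by rewrite -EFinM -(mulr_natl c) mulrA mulVf ?mul1r// pnatr_eq0 -lt0n.
- apply: (@le_trans _ _ (\sum_(j <oo) ((2 ^- j.+1)%R)%:E * (cost (k j) + c%:E))).
    apply: lee_nneseries => j _; first by rewrite mule_ge0 ?lee_fin ?half_pow_ge0 ?cost_ge0.
    by rewrite lee_wpmul2l ?lee_fin ?half_pow_ge0.
  under eq_eseriesr do rewrite ge0_muleDr ?lee_fin ?cost_ge0//.
  rewrite nneseriesD; last 2 first.
  + by move=> j _ _; rewrite mule_ge0 ?lee_fin ?half_pow_ge0 ?cost_ge0.
  + by move=> j _ _; rewrite mule_ge0 ?lee_fin ?half_pow_ge0.
  by rewrite eseries_halves.
Qed.

Lemma cost_bind_le {B : Type} (p : prog V n S) (q : S -> prog V n B) (c c' : R) :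
  (0 <= c')%R -> cost p <= c%:E -> (forall a, cost (q a) <= c'%:E) ->
  cost (bind p q) <= (c + c')%:E.
Proof.
move=> c0 pc qc; rewrite EFinD; apply: le_trans (leeD2r _ pc).
exact: cost_bind_leD.
Qed.

End ForM.

Lemma cost_forM_le {S : Type} m (body : nat -> S -> prog V n S) s (c : R) :
  (0 <= c)%R -> (forall t s, (cost (body t s) <= c%:E)%E) ->
  (cost (forM m body s) <= (m%:R * c)%:E)%E.
Proof.
move=> c0 bc; elim: m s => [|m IH] s; first by rewrite mul0r.
by rewrite -natr1 mulrDl mul1r; apply: cost_bind_le.
Qed.

End Loops.

(** * One epoch of SVRG *)

Section Epoch.
Context {R : realType} {d n : nat}.
Local Notation V := 'rV[R]_d.
Context (X : set V) (L : R) (f : 'I_n -> V -> R) (G : 'I_n -> V -> V).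
Hypothesis sp : smooth_problem X L f G.
Local Notation F := (avgf f).
Local Notation GF := (avgg G).
Local Notation gvar := (gvar G).
Let n0 := sp_n sp.
Let L0 := sp_L sp.

Context (lambda eta c1 : R) (s xf p : V).
Hypothesis lambda0 : 0 <= lambda.
Hypothesis eta0 : 0 < eta.
Hypothesis c10 : 0 < c1.
Hypothesis hc1 : 1 <= c1 * (1 - eta * (L + lambda)).
Hypothesis pP : is_prox X G lambda s p.
Let Xp : X p := pP.1.

Definition prox_obj x := F x + lambda / 2 * nsq (x - s).
Definition prox_grad x := GF x + lambda *: (x - s).
Local Notation Phi := prox_obj.
Local Notation GPhi := prox_grad.

(** The centred noise of the variance-reduced gradient at [x]. *)
Definition noise i x := (G i x - G i xf) - (GF x - GF xf).

Lemma mean_noise x u : mean (fun i => dotv (noise i x) u) = 0.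
Proof.
rewrite (eq_mean (b := fun i => (dotv (G i x) u - dotv (G i xf) u) +
   (- dotv (GF x - GF xf) u))); last by move=> i; rewrite !dotvE.
by rewrite meanD mean_cst// dotvDl dotvNl !dotv_avgg meanB subrr.
Qed.

Lemma mean_nsq_noise x : mean (fun i => nsq (noise i x)) <= gvar x xf.
Proof.
set m := GF x - GF xf.
rewrite (eq_mean (b := fun i => nsq (G i x - G i xf) +
   (- 2 * dotv (noise i x) m + - nsq m))); last first.
  by move=> i; rewrite /noise -/m; move: (G i x - _) m => a b; rewrite !dotvE (dotvC b a); ring.
rewrite meanD meanD meanZ mean_noise mean_cst// mulr0 add0r.
by rewrite gerDl oppr_le0 nsq_ge0.
Qed.

Lemma prox_obj_smooth x y : X x -> X y ->
  Phi y <= Phi x + dotv (GPhi x) (y - x) + (L + lambda) / 2 * nsq (y - x).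
Proof.
move=> Xx Xy; have := avgf_smooth sp Xx Xy; rewrite /prox_obj /prox_grad.
have -> : y - s = (x - s) + (y - x) by rewrite [RHS]addrC addrA subrK.
rewrite (dotvDl (GF x)) dotvZl; move: (x - s) (y - x) (dotv (GF x) _) => u v b.
by rewrite !dotvE (dotvC v u); lra.
Qed.

Lemma prox_obj_grad x y : X x -> X y -> Phi x + dotv (GPhi x) (y - x) <= Phi y.
Proof.
move=> Xx Xy; have := avgf_grad sp Xx Xy; rewrite /prox_obj /prox_grad.
have -> : y - s = (x - s) + (y - x) by rewrite [RHS]addrC addrA subrK.
rewrite (dotvDl (GF x)) dotvZl; have : 0 <= lambda / 2 * nsq (y - x).
  by rewrite mulr_ge0 ?nsq_ge0 ?divr_ge0.
move: (x - s) (y - x) (dotv (GF x) _) => u v b.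
by rewrite !dotvE (dotvC v u); lra.
Qed.

Lemma prox_obj_ge x : X x -> Phi p <= Phi x.
Proof.
by move=> Xx; have := prox_obj_grad Xp Xx; have := pP.2 _ Xx; rewrite -/(GPhi p); lra.
Qed.

(** The step inequality. The gradient of the objective need not vanish at the
constrained optimum, so the progress of the step is measured by the decrease
of [Phi], and only the noise enters quadratically. *)
Lemma svrg_step_ineq (g z x w : V) : X x -> X w ->
  (forall a b, X a -> X b -> dotv g (a - b) = dotv (GPhi x + z) (a - b)) ->
  2 * eta * dotv (GPhi x) (x - w) <= nsq (x - w) - nsq (proj X (x - eta *: g) - w)
    + 2 * eta * (Phi x - Phi (proj X (x - eta *: g)))
    + c1 * eta ^+ 2 * nsq z - 2 * eta * dotv z (x - w).
Proof.
move=> Xx Xw gE; have := proj_variational sp Xx (x - eta *: g) Xw.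
have := proj_in sp Xx (x - eta *: g).
move: (proj X _) => x' Xx'.
have -> : x - eta *: g - x' = (x - x') - eta *: g by rewrite addrAC.
rewrite dotvDl dotvNl dotvZl gE//.
have := prox_obj_smooth Xx Xx'; rewrite -(opprB x) nsqN.
have -> : x' - w = (x - w) - (x - x') by apply/rowP => i; rewrite !mxE; ring.
have -> : w - x' = (x - x') - (x - w) by apply/rowP => i; rewrite !mxE; ring.
move: (Phi x) (Phi x') (GPhi x) (x - x') (x - w) => ph ph' a u r hs hp.
have e0 : 0 < c1 * eta by rewrite mulr_gt0.
have hy : 2 * eta * dotv z u <= c1 * eta ^+ 2 * nsq z + c1^-1 * nsq u.
  have -> : c1 * eta ^+ 2 * nsq z + c1^-1 * nsq u =
    2 * eta * (c1 * eta / 2 * nsq z + (2 * (c1 * eta))^-1 * nsq u).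
    by field; rewrite !gt_eqF.
  by rewrite ler_wpM2l ?mulr_ge0 ?(ltW eta0)// dotv_young.
have hc : c1^-1 * nsq u <= (1 - eta * (L + lambda)) * nsq u.
  rewrite ler_wpM2r ?nsq_ge0// -[leLHS]mulr1.
  by rewrite ler_pdivrMl.
have hs' : 2 * eta * ph' <= 2 * eta * (ph + dotv a (- u) + (L + lambda) / 2 * nsq u).
  by rewrite ler_wpM2l ?mulr_ge0 ?(ltW eta0).
move: hp hs' hc hy; rewrite !dotvE (dotvC r u).
set uu := nsq u; set zz := nsq z; set ic := c1^-1.
by lra.
Qed.

Definition svrg_dir (gam : 'I_n -> V -> V) i x :=
  gam i x - gam i xf + avgg gam xf.

Section Direction.
Variables (grad : 'I_n -> V -> V) (gam : 'I_n -> V -> V).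
Hypothesis tg : forall i u x y, X x -> X y ->
  dotv (grad i u) (x - y) = dotv (G i u) (x - y).
Hypothesis gamE : forall i x, gam i x = grad i x + lambda *: (x - s).

Lemma svrg_dirE i x a b : X a -> X b ->
  dotv (svrg_dir gam i x) (a - b) = dotv (GPhi x + noise i x) (a - b).
Proof.
move=> Xa Xb; rewrite /svrg_dir /prox_grad /noise !gamE.
have -> : avgg gam xf = avgg grad xf + lambda *: (xf - s).
  rewrite /avgg; under eq_bigr do rewrite gamE.
  rewrite big_split scalerDr/=; congr (_ + _).
  rewrite sumr_const card_ord scalerMnl scalerA -(mulr_natl lambda) mulrA.
  by rewrite mulVf ?mul1r// pnatr_eq0 -lt0n.
have hA : dotv (avgg grad xf) (a - b) = dotv (GF xf) (a - b).
  by rewrite !dotv_avgg; apply: eq_mean => i'; exact: tg.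
have -> : grad i x + lambda *: (x - s) - (grad i xf + lambda *: (xf - s)) +
  (avgg grad xf + lambda *: (xf - s)) =
  grad i x - grad i xf + avgg grad xf + lambda *: (x - s).
  by apply/rowP => k; rewrite !mxE; ring.
have := tg i x Xa Xb; have := tg i xf Xa Xb; move: hA.
move: (a - b) (x - s) => u v.
by rewrite !(dotvDl, dotvNl, dotvZl) => -> -> ->; ring.
Qed.

Definition svrg_step i x := proj X (x - eta *: svrg_dir gam i x).

Lemma svrg_step_in i x : X x -> X (svrg_step i x).
Proof. by move=> Xx; exact: (proj_in sp Xx). Qed.

(* The average starts after one step, which is charged to the initial point. *)
Let first_bound x : X x ->
  mean (fun i => nsq (svrg_step i x - p) + 2 * eta * (Phi (svrg_step i x) - Phi p))
  <= nsq (x - p) + c1 * eta ^+ 2 * gvar x xf.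
Proof.
move=> Xx.
apply: (@le_trans _ _ (mean (fun i => nsq (x - p) + (c1 * eta ^+ 2 * nsq (noise i x) +
   - (2 * eta) * dotv (noise i x) (x - p))))).
  apply: le_mean => i; rewrite /svrg_step.
  have := svrg_step_ineq Xx Xp (@svrg_dirE i x).
  have := prox_obj_grad Xx Xp; rewrite -(opprB x) dotvNr.
  move: (proj _ _) => x'; move: (Phi x) (Phi x') (Phi p) => a b c.
  set e := dotv (GPhi x) _; set r := nsq (x' - _); set zz := nsq (noise _ _).
  move=> h1 h2; have : eta * (a - c) <= eta * e by rewrite ler_wpM2l ?(ltW eta0)//; lra.
  by lra.
rewrite !meanD !meanZ mean_cst// mean_noise mulr0 addr0 lerD2l.
by rewrite ler_wpM2l ?mean_nsq_noise// mulr_ge0 ?(ltW c10) ?sqr_ge0.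
Qed.

(* The state is the current iterate and the list of the earlier ones, each with
the noise of the step taken from it. *)
Let hist := (V * seq (V * V))%type.
Let hstep i (st : hist) : hist := (svrg_step i st.1, (st.1, noise i st.1) :: st.2).
Let hbody (_ : nat) (st : hist) : prog V n hist :=
  bind (Unif Ret) (fun i => Ret (hstep i st)).

Let visited (st : hist) := st.1 :: map fst st.2.
Let avg (st : hist) := (size (visited st))%:R^-1 *: \sum_(y <- visited st) y.
Let regret (st : hist) w := \sum_(y <- visited st) dotv (GPhi y) (y - w).

Let hinv y0 (t : nat) (st : hist) := [/\ size st.2 = t,
  forall y, y \in visited st -> X y &
  forall w, X w -> 2 * eta * (\sum_(e <- st.2) dotv (GPhi e.1) (e.1 - w))
    + nsq (st.1 - w) + 2 * eta * Phi st.1 + 2 * eta * (\sum_(e <- st.2) dotv e.2 (e.1 - w))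
    <= nsq (y0 - w) + 2 * eta * Phi y0 + c1 * eta ^+ 2 * \sum_(e <- st.2) nsq e.2].

Let hinv0 y0 : X y0 -> hinv y0 0 (y0, [::]).
Proof.
move=> Xy; split=> //=; first by move=> y; rewrite inE => /eqP->.
by move=> w Xw; rewrite !big_nil; lra.
Qed.

Let hinvS y0 t st : hinv y0 t st -> always grad (hbody t st) (hinv y0 t.+1).
Proof.
case: st => [x h] [/= sz Xv hw] i /=.
have Xx : X x by apply: Xv; rewrite /visited inE eqxx.
split=> /=; first by rewrite sz.
  by move=> y; rewrite inE => /predU1P[->|]; [exact: svrg_step_in|exact: Xv].
move=> w Xw; have := hw w Xw; have := svrg_step_ineq Xx Xw (@svrg_dirE i x).
rewrite -/(svrg_step i x) !big_cons/=.
move: (svrg_step i x) => x'; move: (Phi x) (Phi x') => a b.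
set e1 := dotv (GPhi x) _; set e2 := dotv (noise _ _) (x - w).
set e3 := nsq (noise _ _); set r := nsq (x' - w).
by lra.
Qed.

Let hist_regret y0 t st w : hinv y0 t st -> X w ->
  2 * eta * regret st w <= nsq (y0 - w) + 2 * eta * (Phi y0 - Phi p)
    + c1 * eta ^+ 2 * (\sum_(e <- st.2) nsq e.2)
    - 2 * eta * \sum_(e <- st.2) dotv e.2 (e.1 - w).
Proof.
case: st => x h [/= sz Xv hw] Xw; have := hw w Xw.
have Xx : X x by apply: Xv; rewrite /visited inE eqxx.
(* One more step, now without noise, accounts for the last iterate. *)
have gE a b : X a -> X b -> dotv (GPhi x) (a - b) = dotv (GPhi x + 0) (a - b).
  by rewrite addr0.
have := svrg_step_ineq Xx Xw gE; rewrite !dotv0l.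
have := prox_obj_ge (proj_in sp Xx (x - eta *: GPhi x)).
move: (proj _ _) => x'; rewrite /regret /visited big_cons big_map/=.
have := nsq_ge0 (x' - w); move: (nsq (x' - w)) (Phi x') (Phi p) => a b c a0 bc.
have : eta * c <= eta * b by rewrite ler_pM2l.
by lra.
Qed.

Let lconvex_avg (ys : seq V) : ys != [::] -> (forall y, y \in ys -> X y) ->
  X ((size ys)%:R^-1 *: \sum_(y <- ys) y).
Proof.
elim: ys => // y ys IH _ Xys; have Xy : X y by apply: Xys; rewrite inE eqxx.
have [->|ys0] := eqVneq ys [::]; first by rewrite big_seq1 invr1 scale1r.
have {}IH := IH ys0.
have {}IH : X ((size ys)%:R^-1 *: \sum_(y <- ys) y).
  by apply: IH => z zs; apply: Xys; rewrite inE zs orbT.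
have N0 : (0 : R) < (size ys)%:R by rewrite ltr0n lt0n size_eq0.
have := sp_convex sp Xy IH (t := (size ys).+1%:R^-1).
have -> : (1 - (size ys).+1%:R^-1) *: ((size ys)%:R^-1 *: \sum_(z <- ys) z)
    = (size ys).+1%:R^-1 *: \sum_(z <- ys) z :> V.
  rewrite scalerA; congr (_ *: _); rewrite -natr1; field.
  by rewrite !gt_eqF//= ltr_wpDl// ltW.
rewrite -scalerDr big_cons; apply; first by rewrite invr_ge0.
by rewrite invf_le1// ler1n.
Qed.

Section Average.
Variable ys : seq V.
Hypothesis ys0 : ys != [::].
Hypothesis Xys : forall y, y \in ys -> X y.
Let N : R := (size ys)%:R.
Let xb := N^-1 *: \sum_(y <- ys) y.
Let reg w := \sum_(y <- ys) dotv (GPhi y) (y - w).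

Let N_gt0 : 0 < N. Proof. by rewrite ltr0n lt0n size_eq0. Qed.
Let Xxb : X xb. Proof. exact: lconvex_avg. Qed.

Let sum_le (a b : V -> R) : (forall y, X y -> a y <= b y) ->
  \sum_(y <- ys) a y <= \sum_(y <- ys) b y.
Proof.
by move=> ab; rewrite big_seq [leRHS]big_seq; apply: ler_sum => y yy; apply: ab; exact: Xys.
Qed.

Let sum_cst (c : R) : \sum_(y <- ys) c = N * c.
Proof. by rewrite big_const_seq count_predT iter_addr_0 -(mulr_natl c). Qed.

Let sum_sub w : \sum_(y <- ys) (y - w) = N *: (xb - w).
Proof.
rewrite big_split/= big_const_seq count_predT iter_addr_0 scalerBr.
by rewrite scalerA mulfV ?gt_eqF// scale1r mulNrn scaler_nat.
Qed.

Let point_bound y : X y ->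
  lambda * nsq (y - p) + dotv (GF y - GF p) (y - p) <= dotv (GPhi y) (y - p).
Proof.
move=> Xy; have := pP.2 _ Xy; rewrite /prox_grad.
have -> : y - s = (y - p) + (p - s) by rewrite addrA subrK.
by move: (GF y) (GF p) (y - p) (p - s) => a b u v; rewrite !dotvE (dotvC v u); lra.
Qed.

Let sym_ge0 x y : X x -> X y -> 0 <= dotv (GF x - GF y) (x - y).
Proof.
move=> Xx Xy; have := le_trans (gvar_ge0 G x y) (gvar_le_sym sp Xx Xy).
by rewrite pmulr_rge0.
Qed.

Let gvar_p_le : \sum_(y <- ys) gvar y p <= L * reg p.
Proof.
rewrite mulr_sumr; apply: sum_le => y Xy; apply: le_trans (gvar_le_sym sp Xy Xp) _.
rewrite ler_wpM2l ?(ltW L0)//; apply: le_trans (point_bound Xy).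
by rewrite lerDr mulr_ge0 ?nsq_ge0.
Qed.

Lemma avg_gap : N * (Phi xb - Phi p) <= reg p.
Proof.
apply: (@le_trans _ _ (\sum_(y <- ys) (Phi y - Phi p))); last first.
  apply: sum_le => y Xy; have := prox_obj_grad Xy Xp.
  by rewrite -(opprB y) dotvNr; lra.
rewrite -sum_cst; apply: (@le_trans _ _ (\sum_(y <- ys)
   (Phi xb - Phi p + dotv (GPhi xb) (y - xb)))).
  by rewrite [leRHS]big_split/= -dotv_sumr sum_sub subrr scaler0 dotv0r addr0.
by apply: sum_le => y Xy; have := prox_obj_grad Xxb Xy; lra.
Qed.

Lemma avg_nsq : N * (lambda * nsq (xb - p)) <= reg p.
Proof.
apply: (@le_trans _ _ (\sum_(y <- ys) lambda * nsq (y - p))); last first.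
  apply: sum_le => y Xy; apply: le_trans (point_bound Xy).
  by rewrite lerDl sym_ge0.
rewrite mulrCA -mulr_sumr ler_wpM2l//.
have := nsq_sum_le ys (fun y => y - p); rewrite sum_sub dotvZl dotvZr.
by rewrite ler_pM2l.
Qed.

Lemma avg_gvar : N * gvar xb p <= 2 * L * reg xb + 2 * L * reg p.
Proof.
apply: (@le_trans _ _ (\sum_(y <- ys) (2 * gvar xb y + 2 * gvar y p))).
  rewrite -sum_cst; apply: sum_le => y Xy.
  by have := @gvar_triangle _ _ _ G 1 xb y p ltr01; rewrite invr1.
rewrite big_split/= -[X in X + _]mulr_sumr -[X in _ + X]mulr_sumr -!mulrA.
apply: lerD; rewrite ler_wpM2l//.
apply: (@le_trans _ _ (\sum_(y <- ys) L * dotv (GF y - GF xb) (y - xb))).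
  by apply: sum_le => y Xy; rewrite (gvarC G); exact: (gvar_le_sym sp).
rewrite -[leLHS]mulr_sumr ler_wpM2l ?(ltW L0)//.
have e (a : V) : \sum_(y <- ys) dotv a (y - xb) = 0.
  by rewrite -dotv_sumr sum_sub subrr scaler0 dotv0r.
rewrite -[leLHS]addr0 -[X in _ + X <= _](e (GF xb + lambda *: (xb - s))) -[leLHS]big_split/=.
apply: sum_le => y Xy; rewrite /prox_grad.
have -> : y - s = (y - xb) + (xb - s) by rewrite addrA subrK.
have : 0 <= lambda * nsq (y - xb) by rewrite mulr_ge0 ?nsq_ge0.
by move: (GF y) (GF xb) (y - xb) (xb - s) => a b u v; rewrite !dotvE; lra.
Qed.

Lemma avg_noise kappa : 0 < kappa ->
  \sum_(y <- ys) gvar y xf <= (1 + kappa) * (L * reg p) + N * ((1 + kappa^-1) * gvar p xf).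
Proof.
move=> k0; apply: (@le_trans _ _ (\sum_(y <- ys)
    ((1 + kappa) * gvar y p + (1 + kappa^-1) * gvar p xf))).
  by apply: sum_le => y Xy; exact: gvar_triangle.
rewrite big_split/= sum_cst -mulr_sumr lerD2r ler_wpM2l// addr_ge0// ltW//.
Qed.

End Average.

Let Zs (st : hist) : V := \sum_(e <- st.2) e.2.
Let Z2 (st : hist) := \sum_(e <- st.2) nsq e.2.
Let Zy (st : hist) := \sum_(e <- st.2) dotv e.2 (e.1 - p).
Let W (st : hist) := \sum_(e <- st.2) gvar e.1 xf.
Let hloop k y0 := forM k hbody (y0, [::]).
Let hprog k x0 := bind (Unif Ret) (fun i => hloop k (svrg_step i x0)).

Let hloop_geomfree k y0 : geomfree grad (hloop k y0).
Proof. exact: geomfree_forM. Qed.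

Let hprog_geomfree k x0 : geomfree grad (hprog k x0).
Proof. by move=> i; exact: hloop_geomfree. Qed.

Let hloop_inv k y0 : X y0 -> always grad (hloop k y0) (hinv y0 k).
Proof. by move=> Xy; apply: always_forM => [|t st _]; [exact: hinv0|exact: hinvS]. Qed.

(* The noise has zero mean given the past, so its partial sums grow in mean
square like a sum of variances. *)
Let hloop_noise k y0 r : 0 <= r ->
  expect grad (hloop k y0) (fun st => c1 * eta ^+ 2 * (Z2 st - W st) -
    2 * eta * Zy st + r * (nsq (Zs st) - W st)) <= 0.
Proof.
move=> r0; pose Pot (_ : nat) (st : hist) := c1 * eta ^+ 2 * (Z2 st - W st) -
    2 * eta * Zy st + r * (nsq (Zs st) - W st).
have -> : 0 = Pot 0%N (y0, [::]).
  by rewrite /Pot /Z2 /W /Zy /Zs !big_nil dotv0l; ring.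
apply: (@expect_forM_geomfree_le _ _ _ grad n0 _ (fun _ _ => True) Pot) => //.
move=> t [x h] _ _ /=.
rewrite (eq_mean (b := fun i => Pot t (x, h) + ((c1 * eta ^+ 2 + r) * nsq (noise i x) +
   (- (2 * eta) * dotv (noise i x) (x - p) +
   (2 * r * dotv (noise i x) (Zs (x, h)) + - ((c1 * eta ^+ 2 + r) * gvar x xf)))))).
  rewrite !meanD !meanZ !mean_noise !mean_cst// !mulr0 !add0r gerDl.
  have h1 := mean_nsq_noise x.
  have h2 : 0 <= c1 * eta ^+ 2 + r by rewrite addr_ge0// mulr_ge0 ?sqr_ge0// ltW.
  by have := ler_wpM2l h2 h1; lra.
move=> i; rewrite /Pot /Z2 /W /Zy /Zs !big_cons/=; move: (noise i x) (\sum_(e <- h) e.2) (x - p) => z zs u.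
by rewrite !dotvE (dotvC zs z); ring.
Qed.

Let B0 y0 := nsq (y0 - p) + 2 * eta * (Phi y0 - Phi p).

Let hloop_le k y0 c a r (h : hist -> R) : X y0 -> 0 <= r ->
  (forall st, hinv y0 k st -> h st <= c * B0 y0 + (c1 * eta ^+ 2 * (Z2 st - W st) -
    2 * eta * Zy st + r * (nsq (Zs st) - W st))) -> a = c * B0 y0 ->
  expect grad (hloop k y0) h <= a.
Proof.
move=> Xy r0 hh ->; apply: (@le_trans _ _ (expect grad (hloop k y0) (fun st =>
    c * B0 y0 + (c1 * eta ^+ 2 * (Z2 st - W st) -
    2 * eta * Zy st + r * (nsq (Zs st) - W st))))).
  apply: expect_le => //; try exact: geomfree_bounded.
  by apply: always_sub (hloop_inv k Xy) => st; exact: hh.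
rewrite expectD//; try exact: geomfree_bounded.
by rewrite expect_cst// gerDl; exact: hloop_noise.
Qed.

Let hprog_le k x0 c (h : hist -> R) : X x0 -> 0 <= c ->
  (forall y0, X y0 -> expect grad (hloop k y0) h <= c * B0 y0) ->
  expect grad (hprog k x0) h <= c * (nsq (x0 - p) + c1 * eta ^+ 2 * gvar x0 xf).
Proof.
move=> Xx c0 hh; rewrite expect_bind/=.
apply: (@le_trans _ _ (mean (fun i => c * B0 (svrg_step i x0)))).
  by apply: le_mean => i; apply: hh; exact: svrg_step_in.
by rewrite meanZ ler_wpM2l//; exact: first_bound.
Qed.

Let hprog_regret_opt k x0 : X x0 ->
  expect grad (hprog k x0) (fun st => 2 * eta * regret st p - c1 * eta ^+ 2 * W st)
  <= nsq (x0 - p) + c1 * eta ^+ 2 * gvar x0 xf.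
Proof.
move=> Xx; rewrite -[leRHS]mul1r; apply: hprog_le => // y0 Xy.
apply: (@hloop_le _ _ 1 _ 0) => // st hst; have := hist_regret hst Xp.
by rewrite -/(Z2 st) -/(Zy st) /B0; lra.
Qed.

Let hprog_regret_avg k x0 m : X x0 -> 0 < m ->
  expect grad (hprog k x0) (fun st => 2 * eta * regret st (avg st)
    - (2 + m) * nsq (avg st - p) - (c1 + m^-1) * eta ^+ 2 * W st)
  <= 2 * (nsq (x0 - p) + c1 * eta ^+ 2 * gvar x0 xf).
Proof.
move=> Xx m0; apply: hprog_le => // y0 Xy.
apply: (@hloop_le _ _ 2 _ (m^-1 * eta ^+ 2)) => //.
  by rewrite mulr_ge0 ?sqr_ge0// invr_ge0 ltW.
move=> st hst; have [_ Xv _] := hst.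
have Xa : X (avg st) by apply: lconvex_avg.
have := hist_regret hst Xa; rewrite -/(Z2 st).
have -> : \sum_(e <- st.2) dotv e.2 (e.1 - avg st) = Zy st - dotv (Zs st) (avg st - p).
  rewrite /Zy /Zs dotv_suml -sumrB; apply: eq_bigr => e _.
  by rewrite -dotvNr -dotvDr; congr dotv; apply/rowP => i; rewrite !mxE; ring.
have h1 : nsq (y0 - avg st) <= 2 * nsq (y0 - p) + 2 * nsq (avg st - p).
  by have := nsqD2_le (y0 - p) (p - avg st); rewrite addrA subrK (nsqB p).
have h2 : 2 * eta * dotv (Zs st) (avg st - p) <=
    m^-1 * eta ^+ 2 * nsq (Zs st) + m * nsq (avg st - p).
  have e0 : 0 < m^-1 * eta by rewrite mulr_gt0// invr_gt0.
  have -> : m^-1 * eta ^+ 2 * nsq (Zs st) + m * nsq (avg st - p) = 2 * eta *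
    (m^-1 * eta / 2 * nsq (Zs st) + (2 * (m^-1 * eta))^-1 * nsq (avg st - p)).
    by field; rewrite !gt_eqF.
  by rewrite ler_wpM2l ?mulr_ge0 ?(ltW eta0)// dotv_young.
have := ler_wpM2l (ltW eta0) (prox_obj_ge Xy).
move: h1 h2; rewrite /B0; set q := nsq (avg st - p); set im := m^-1.
by lra.
Qed.

Section Program.
Variables (gphi : 'I_n -> V -> prog V n V) (x0 : V).
Hypothesis Xx0 : X x0.
Hypothesis gphiP : forall i x, always grad (gphi i x) (fun v => v = gam i x).
Hypothesis gphi_geomfree : forall i x, geomfree grad (gphi i x).

Lemma expect_always_eq {A : Type} (q : prog V n A) (a : A) (h : A -> R) :
  always grad q (fun b => b = a) -> expect grad q h = h a.
Proof.
move=> qa; rewrite -(expect_cst grad n0 q (h a)); apply: eq_expect.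
by apply: always_sub qa => b ->.
Qed.

Lemma always_full_gradient x :
  always grad (full_gradient gphi x) (fun v => v = avgg gam x).
Proof.
apply: always_bind; rewrite /avgg -big_enum/=.
elim: (enum 'I_n) => [|i l IH] /=; first by rewrite big_nil.
apply: always_bind; apply: always_sub IH => u /= uE.
apply: always_bind; apply: always_sub (gphiP i x) => v -> /=.
by rewrite big_cons addrC scalerDr [in RHS]scalerDr -uE.
Qed.

Lemma geomfree_full_gradient x : geomfree grad (full_gradient gphi x).
Proof.
apply: geomfree_bind => //; elim: (enum 'I_n) => //= i l IH.
apply: geomfree_bind => // u; exact: geomfree_bind.
Qed.

Let body mu (_ : nat) (st : V * V) := let* i := Unif Ret in
    let* u := gphi i st.1 in
    let* v := gphi i xf in
    let x := proj X (st.1 - eta *: (u - v + mu)) in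
    Ret (x, st.2 + x).

Lemma geomfree_one_epoch k : geomfree grad (one_epoch_svrg X gphi xf x0 eta k).
Proof.
apply: geomfree_bind; first exact: geomfree_full_gradient.
move=> mu; apply: geomfree_bind => //; apply: geomfree_forM => t st.
by do 3 apply: geomfree_bind => // ?.
Qed.

Let expect_body t st (h : V * V -> R) : expect grad (body (avgg gam xf) t st) h =
  mean (fun i => h (svrg_step i st.1, st.2 + svrg_step i st.1)).
Proof.
rewrite expect_bind /=; apply: eq_mean => i.
rewrite expect_bind (expect_always_eq _ (gphiP i _)).
by rewrite expect_bind (expect_always_eq _ (gphiP i _)).
Qed.

Let hpi (st : hist) : V * V := (st.1, \sum_(y <- visited st) y).

Let expect_one_epoch k (h : V -> R) : expect grad (one_epoch_svrg X gphi xf x0 eta k.+1) h =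
  expect grad (hprog k x0) (fun st => h (avg st)).
Proof.
rewrite expect_bind (expect_always_eq _ (always_full_gradient xf)) expect_bind.
rewrite -[LHS]/(expect grad (forM k.+1 (fun=> body (avgg gam xf) 0) (x0, 0)) _).
rewrite forM_recl expect_bind expect_body [RHS]expect_bind /=; apply: eq_mean => i.
have -> : (svrg_step i x0, 0 + svrg_step i x0) = hpi (svrg_step i x0, [::]).
  by rewrite /hpi /visited /= big_seq1 add0r.
rewrite -(@expect_forM_sim _ _ _ grad _ _ hpi hbody) => [|t st h'].
  apply: eq_expect; apply: always_sub (hloop_inv k (svrg_step_in i Xx0)).
  by move=> st [sz _ _] /=; rewrite /avg /visited /= size_map sz.
rewrite -[RHS]/(expect grad (body (avgg gam xf) 0 (hpi st)) h') expect_body.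
apply: eq_mean => j /=.
by rewrite /hpi /visited /= !big_cons [svrg_step j _ + _]addrC.
Qed.

Lemma always_one_epoch k : always grad (one_epoch_svrg X gphi xf x0 eta k.+1) X.
Proof.
apply: always_bind; apply: always_sub (always_full_gradient xf) => mu ->.
apply: always_bind; pose Inv (t : nat) (st : V * V) := X st.1 /\
  exists ys : seq V, [/\ size ys = t, forall y, y \in ys -> X y & st.2 = \sum_(y <- ys) y].
have : always grad (forM k.+1 (body (avgg gam xf)) (x0, 0)) (Inv k.+1).
  apply: always_forM => [|t st _ [Xst [ys [sz Xys stE]]]].
    by split=> //; exists [::]; rewrite big_nil.
  move=> i /=; apply: always_bind; apply: always_sub (gphiP i _) => u ->.
  apply: always_bind; apply: always_sub (gphiP i _) => v -> /=.
  have Xp' := svrg_step_in i Xst.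
  split=> //; exists (svrg_step i st.1 :: ys); split => /=; first by rewrite sz.
    by move=> y; rewrite inE => /predU1P[->|]; [|exact: Xys].
  by rewrite big_cons stE addrC.
apply: always_sub => st [_ [ys [sz Xys stE]]] /=.
rewrite stE -sz; apply: lconvex_avg => //.
by rewrite -size_eq0 sz.
Qed.

(** The guarantee of one epoch. [S] and [M] bound the regret of the iterates
against the optimum [p] and against the returned average itself; the latter is
what controls the gradients at the returned point, since
[gvar] is only dominated by the symmetric Bregman divergence. *)
Lemma one_epoch_bounds k kappa m : 0 < kappa -> 0 < m ->
  let E h := expect grad (one_epoch_svrg X gphi xf x0 eta k.+1) h in
  let N : R := k.+1%:R in
  let b0 := nsq (x0 - p) + c1 * eta ^+ 2 * gvar x0 xf in
  exists S M,
  [/\ E (fun x => Phi x - Phi p) <= S,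
      lambda * E (fun x => nsq (x - p)) <= S,
      E (fun x => gvar x p) <= 2 * L * (M + S),
      2 * eta * N * S <= b0 + c1 * eta ^+ 2 *
        (N * ((1 + kappa) * L * S + (1 + kappa^-1) * gvar p xf)) &
      2 * eta * N * M <= 2 * b0 + (2 + m) * E (fun x => nsq (x - p)) +
        (c1 + m^-1) * eta ^+ 2 *
        (N * ((1 + kappa) * L * S + (1 + kappa^-1) * gvar p xf))].
Proof.
move=> kappa0 m0 E N b0.
have N0 : 0 < N by rewrite ltr0n.
pose H (h : hist -> R) := expect grad (hprog k x0) h.
have Hge (h h' : hist -> R) : (forall st, size st.2 = k ->
    (forall y, y \in visited st -> X y) -> h st <= h' st) -> H h <= H h'.
  move=> hh; apply: expect_le => //; try exact: geomfree_bounded.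
  move=> i; apply: always_sub (hloop_inv k (svrg_step_in i Xx0)).
  by move=> st [sz Xv _]; exact: hh.
have HD h h' : H (fun st => h st + h' st) = H h + H h'.
  by rewrite /H expectD//; exact: geomfree_bounded.
have HZ c h : H (fun st => c * h st) = c * H h.
  by rewrite /H expectZ//; exact: geomfree_bounded.
have HC c : H (fun=> c) = c by rewrite /H expect_cst.
have EH h : E h = H (fun st => h (avg st)) by exact: expect_one_epoch.
have vN (st : hist) : size st.2 = k -> (size (visited st))%:R = N.
  by move=> sz; rewrite /visited /= size_map sz.
have v0 (st : hist) : visited st != [::] by [].
set J := H (fun st => regret st p); set K := H (fun st => regret st (avg st)).
have HW : H W <= (1 + kappa) * (L * J) + N * ((1 + kappa^-1) * gvar p xf).
  rewrite -(HZ L) -(HZ (1 + kappa)) -(HC (N * _)) -HD; apply: Hge => st sz Xv.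
  have := avg_noise Xv kappa0; rewrite vN//; apply: le_trans.
  by rewrite /W /visited big_cons big_map lerDr gvar_ge0.
exists (N^-1 * J), (N^-1 * K).
have NJ : N * (N^-1 * J) = J by rewrite mulrA mulfV ?mul1r// gt_eqF.
have NK : N * (N^-1 * K) = K by rewrite mulrA mulfV ?mul1r// gt_eqF.
split.
- rewrite EH ler_pdivlMl// -HZ; apply: Hge => st sz Xv.
  by rewrite -(vN st)//; exact: avg_gap.
- rewrite EH ler_pdivlMl// -!HZ; apply: Hge => st sz Xv.
  by rewrite -(vN st)//; exact: avg_nsq.
- rewrite EH -(ler_pM2l N0) [leRHS](_ : _ = 2 * L * K + 2 * L * J); last first.
    by rewrite mulrCA mulrDr NJ NK mulrDr.
  rewrite -!HZ -HD; apply: Hge => st sz Xv.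
  by rewrite -(vN st)//; exact: avg_gvar.
- rewrite -mulrA NJ; have := hprog_regret_opt k Xx0.
  rewrite (_ : expect _ _ _ = 2 * eta * J - c1 * eta ^+ 2 * H W).
    have h : 0 <= c1 * eta ^+ 2 by rewrite mulr_ge0 ?sqr_ge0// ltW.
    have := ler_wpM2l h HW; rewrite -/b0.
    have -> : N * ((1 + kappa) * L * (N^-1 * J) + (1 + kappa^-1) * gvar p xf) =
      (1 + kappa) * (L * J) + N * ((1 + kappa^-1) * gvar p xf).
      by rewrite mulrDr mulrCA NJ; ring.
    by lra.
  rewrite -mulNr -(HZ _ W) -(HZ _ (fun st => regret st p)) -HD.
  by apply: eq_expect; apply: always_true => st; rewrite mulNr.
- rewrite -mulrA NK EH; have := hprog_regret_avg k Xx0 m0.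
  rewrite (_ : expect _ _ _ = 2 * eta * K - (2 + m) * H (fun st => nsq (avg st - p))
      - (c1 + m^-1) * eta ^+ 2 * H W).
    have h : 0 <= (c1 + m^-1) * eta ^+ 2.
      by rewrite mulr_ge0 ?sqr_ge0// addr_ge0 ?invr_ge0// ltW.
    have := ler_wpM2l h HW; rewrite -/b0.
    have -> : N * ((1 + kappa) * L * (N^-1 * J) + (1 + kappa^-1) * gvar p xf) =
      (1 + kappa) * (L * J) + N * ((1 + kappa^-1) * gvar p xf).
      by rewrite mulrDr mulrCA NJ; ring.
    by lra.
  rewrite -!mulNr -(HZ _ W) -(HZ _ (fun st => regret st (avg st))).
  rewrite -(HZ _ (fun st => nsq (avg st - p))) -!HD.
  by apply: eq_expect; apply: always_true => st; rewrite !mulNr.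
Qed.

End Program.

End Direction.

End Epoch.

(** * Approximate and unbiased proximal points *)

Section ProxOracles.
Context {R : realType} {d n : nat}.
Local Notation V := 'rV[R]_d.
Context (X : set V) (L : R) (f : 'I_n -> V -> R) (G grad : 'I_n -> V -> V).
Hypothesis sp : smooth_problem X L f G.
Hypothesis tg : forall i u x y, X x -> X y ->
  dotv (grad i u) (x - y) = dotv (G i u) (x - y).
Local Notation F := (avgf f).
Local Notation GF := (avgg G).
Let n0 := sp_n sp.
Let L0 := sp_L sp.
Let nR0 : 0 < n%:R :> R. Proof. by rewrite ltr0n. Qed.

Definition rate : R := L / n%:R.
Local Notation lam := rate.

Lemma rate_gt0 : 0 < lam. Proof. by rewrite divr_gt0. Qed.

Lemma rate_le : lam <= L.
Proof. by rewrite ler_pdivrMr// ler_peMr ?(ltW L0)// ler1n. Qed.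

(** Mean square variation of the gradients, scaled like a function value. *)
Definition gdev x y := gvar G x y / L.

Lemma gdevE x y : gdev x y = gvar G x y / L. Proof. by []. Qed.

Lemma gdev_ge0 x y : 0 <= gdev x y.
Proof. by rewrite divr_ge0 ?(ltW L0)// gvar_ge0. Qed.

Lemma prox_stepsE : prox_steps L lam = (1024 * n)%N.
Proof.
rewrite /prox_steps /prox_eta /rate.
have -> : 32 / ((32 * L)^-1 * (L / n%:R)) = (1024 * n)%:R :> R.
  by rewrite natrM; field; rewrite !gt_eqF//= invr_gt0.
by rewrite -[(_ * n)%:R]/((1024 * n)%:~R) intrKceil.
Qed.

Section Approx.
Variables (s xi xp p : V).
Hypothesis Xxi : X xi.
Hypothesis pP : is_prox X G lam s p.
Let Xp : X p := pP.1.

Let query_proxP i x :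
  always grad (query_prox lam s i x) (fun v => v = grad i x + lam *: (x - s)).
Proof. by []. Qed.

Lemma geomfree_approx_prox : geomfree grad (approx_prox X L lam s xi xp).
Proof. exact: geomfree_one_epoch. Qed.

Let eta := prox_eta L.
Let eta0 : 0 < eta. Proof. by rewrite invr_gt0 mulr_gt0. Qed.
Let hc1 : 1 <= 16 / 15 * (1 - eta * (L + lam)).
Proof.
have : eta * (L + lam) <= eta * (L + L) by rewrite ler_pM2l// lerD2l rate_le.
have -> : eta * (L + L) = 1 / 16 by rewrite /eta /prox_eta; field; rewrite gt_eqF.
by lra.
Qed.

Lemma always_approx_prox : always grad (approx_prox X L lam s xi xp) X.
Proof.
rewrite /approx_prox prox_stepsE -(@prednK (1024 * n)) ?muln_gt0//.
exact: (always_one_epoch sp (gam := fun i x => grad i x + lam *: (x - s)) _ _ Xxi query_proxP).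
Qed.

(** With the step size 1/(32 L) and 32 / (eta lambda) steps the error is a small
fraction of the initial distance and of the variance at the reference point. *)
Lemma approx_prox_bounds :
  let E h := expect grad (approx_prox X L lam s xi xp) h in
  let B := lam * nsq (xi - p) in let W := gdev xp p in
  [/\ E (fun x => prox_obj f lam s x - prox_obj f lam s p) <= 7 / 400 * B + 9 / 400 * W,
      E (fun x => lam * nsq (x - p)) <= 7 / 400 * B + 9 / 400 * W &
      E (fun x => gdev x p) <= 11 / 100 * B + 102 / 1000 * W].
Proof.
move=> E B W; have lam0 := rate_gt0.
have c10 : 0 < 16 / 15 :> R by [].
have k5 : 0 < 5 :> R by []. have m8 : 0 < 8 :> R by [].
have [S [M [h1 h2 h3 h4 h5]]] := one_epoch_bounds sp xp (ltW lam0) eta0 c10 hc1 pP tg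
  (fun i x => erefl) Xxi query_proxP (1024 * n).-1 k5 m8.
rewrite prednK ?muln_gt0// -prox_stepsE in h1 h2 h3 h4 h5.
pose q := E (fun x => nsq (x - p)).
rewrite -[expect grad _ (fun x => nsq (x - p))]/q in h2 h5.
have EZ c h : E (fun x => c * h x) = c * E h.
  by rewrite /E expectZ//; apply: geomfree_bounded; exact: geomfree_approx_prox.
have q0 : 0 <= E (fun x => nsq (x - p)).
  rewrite -(expect_cst grad n0 (approx_prox X L lam s xi xp) 0); apply: expect_le => //.
  - by apply: always_true => x; exact: nsq_ge0.
  - by apply: geomfree_bounded; exact: geomfree_approx_prox.
  - by apply: geomfree_bounded; exact: geomfree_approx_prox.
have hb : gvar G xi xp <= 2 * (L ^+ 2 * nsq (xi - p)) + 2 * (L * W).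
  have := @gvar_triangle _ _ _ G 1 xi p xp ltr01; rewrite invr1 => /le_trans; apply.
  apply: lerD; rewrite ler_wpM2l//; first exact: (gvar_le_nsq sp).
  by rewrite /W /gdev gvarC mulrCA mulfV ?mulr1// gt_eqF.
have hb0 : lam * (nsq (xi - p) + 16 / 15 * eta ^+ 2 * gvar G xi xp) <= B + 1 / 480 * (B + W).
  have h0 : 0 <= lam * (16 / 15 * eta ^+ 2) by rewrite !mulr_ge0 ?sqr_ge0// ltW.
  rewrite mulrDr -/B mulrA lerD2l; apply: le_trans (ler_wpM2l h0 hb) _.
  have -> : lam * (16 / 15 * eta ^+ 2) * (2 * (L ^+ 2 * nsq (xi - p)) + 2 * (L * W)) =
     1 / 480 * B + 1 / 480 * (n%:R^-1 * W).
    by rewrite /B /eta /prox_eta /rate; field; rewrite !gt_eqF.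
  have : n%:R^-1 * W <= W by rewrite ler_piMl ?gdev_ge0// invf_le1// ler1n.
  by lra.
have hw : gvar G p xp = L * W.
  by rewrite /W /gdev gvarC mulrCA mulfV ?mulr1// gt_eqF.
have B0 : 0 <= B by rewrite mulr_ge0 ?nsq_ge0// ltW.
have W0 : 0 <= W by exact: gdev_ge0.
have Ne : (prox_steps L lam)%:R = 1024 * n%:R :> R by rewrite prox_stepsE natrM.
move: h4 h5; rewrite Ne hw => h4 h5.
have h4' : 64 * S <= B + 1 / 480 * (B + W) + 16 / 15 * (6 * S + 6 / 5 * W).
  have := ler_wpM2l (ltW lam0) h4; rewrite mulrDr.
  have -> : lam * (2 * eta * (1024 * n%:R) * S) = 64 * S.
    by rewrite /eta /prox_eta /rate; field; rewrite !gt_eqF.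
  have -> : lam * (16 / 15 * eta ^+ 2 * (1024 * n%:R * ((1 + 5) * L * S + (1 + 5^-1) * (L * W)))) =
    16 / 15 * (6 * S + 6 / 5 * W).
    by rewrite /eta /prox_eta /rate; field; rewrite !gt_eqF.
  by lra.
rewrite -/q in q0.
have h5' : 64 * M <= 2 * (B + 1 / 480 * (B + W)) + 10 * (lam * q)
    + (16 / 15 + 1 / 8) * (6 * S + 6 / 5 * W).
  have := ler_wpM2l (ltW lam0) h5; rewrite 2!(mulrDr lam).
  have -> : lam * (2 * eta * (1024 * n%:R) * M) = 64 * M.
    by rewrite /eta /prox_eta /rate; field; rewrite !gt_eqF.
  have -> : lam * ((16 / 15 + 8^-1) * eta ^+ 2 * (1024 * n%:R * ((1 + 5) * L * S + (1 + 5^-1) * (L * W)))) =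
    (16 / 15 + 1 / 8) * (6 * S + 6 / 5 * W).
    by rewrite /eta /prox_eta /rate; field; rewrite !gt_eqF.
  by lra.
split; first by apply: le_trans h1 _; lra.
  by rewrite EZ; apply: le_trans h2 _; lra.
have -> : E (fun x => gdev x p) = L^-1 * E (fun x => gvar G x p).
  by rewrite -EZ; apply: eq_expect; apply: always_true => x; rewrite mulrC.
apply: (@le_trans _ _ (2 * (M + S))); last by lra.
by rewrite ler_pdivrMl// mulrA (mulrC L).
Qed.

End Approx.

Section Unbiased.
Variables (s xp p : V).
Hypothesis Xs : X s.
Hypothesis pP : is_prox X G lam s p.
Let Xp : X p := pP.1.
Let lam0 := rate_gt0.

Let again x : prog V n V := approx_prox X L lam s x x.
Let chain m x := forM m (fun _ : nat => again) x.

Let chain_geomfree m x : geomfree grad (chain m x).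
Proof. by apply: geomfree_forM => t y; exact: geomfree_approx_prox. Qed.

Let always_chain m x : X x -> always grad (chain m x) X.
Proof.
by move=> Xx; apply: (always_forM (Inv := fun=> X)) => // t y _ Xy; exact: always_approx_prox.
Qed.

Let u x := lam * nsq (x - p) + gdev x p.

Let u_ge0 x : 0 <= u x.
Proof. by rewrite addr_ge0 ?gdev_ge0// mulr_ge0 ?nsq_ge0// ltW. Qed.

Let again_dist x : X x -> expect grad (again x) (fun y => lam * nsq (y - p)) <= 9 / 400 * u x.
Proof.
move=> Xx; have [_ h _] := approx_prox_bounds x Xx pP; apply: le_trans h _.
by rewrite /u mulrDr lerD2r ler_wpM2r//; [rewrite mulr_ge0 ?nsq_ge0// ltW|lra].
Qed.

Let again_u x : X x -> expect grad (again x) u <= 1 / 7 * u x.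
Proof.
move=> Xx; have [_ h1 h2] := approx_prox_bounds x Xx pP.
rewrite expectD//; try by apply: geomfree_bounded; exact: geomfree_approx_prox.
have := gdev_ge0 x p; have : 0 <= lam * nsq (x - p) by rewrite mulr_ge0 ?nsq_ge0// ltW.
by move: h1 h2; rewrite -/(again x) /u; lra.
Qed.

Let chain_u m x : X x -> expect grad (chain m x) u <= (1 / 7) ^+ m * u x.
Proof.
move=> Xx; elim: m => [|m IH]; first by rewrite expr0 mul1r /= lexx.
rewrite /= expect_bind exprS -mulrA; apply: (@le_trans _ _ (1 / 7 * expect grad (chain m x) u)).
  rewrite -expectZ//; last by apply: geomfree_bounded; exact: chain_geomfree.
  apply: expect_le => //; try by apply: geomfree_bounded; exact: chain_geomfree.
  by apply: always_sub (always_chain m Xx) => y; exact: again_u.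
by rewrite ler_wpM2l// divr_ge0.
Qed.

Let Q m x := expect grad (chain m x) (fun y => nsq (y - p)).

Let Q_ge0 m x : 0 <= Q m x.
Proof.
rewrite -(expect_cst grad n0 (chain m x) 0); apply: expect_le => //.
- by apply: always_true => y; exact: nsq_ge0.
- by apply: geomfree_bounded; exact: chain_geomfree.
- by apply: geomfree_bounded; exact: chain_geomfree.
Qed.

Let chain_Q m x : X x -> lam * Q m.+1 x <= 9 / 400 * ((1 / 7) ^+ m * u x).
Proof.
move=> Xx; rewrite /Q -expectZ//; last by apply: geomfree_bounded; exact: chain_geomfree.
rewrite /= expect_bind.
apply: (@le_trans _ _ (9 / 400 * expect grad (chain m x) u)).
  rewrite -expectZ//; last by apply: geomfree_bounded; exact: chain_geomfree.
  apply: expect_le => //; try by apply: geomfree_bounded; exact: chain_geomfree.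
  by apply: always_sub (always_chain m Xx) => y; exact: again_dist.
have h : 0 <= 9 / 400 :> R by lra.
exact: ler_wpM2l h _ _ (chain_u m Xx).
Qed.

Let lbody (j : nat) (xs : seq V) := let* x := again (nth 0 xs j) in Ret (rcons xs x).
Let lrun J x := forM J lbody [:: x].

Let lrun_geomfree J x : geomfree grad (lrun J x).
Proof.
by apply: geomfree_forM => t xs; apply: geomfree_bind => //; exact: geomfree_approx_prox.
Qed.

Let lrun_size J x : always grad (lrun J x) (fun xs => size xs = J.+1).
Proof.
apply: (always_forM (Inv := fun t (xs : seq V) => size xs = t.+1)) => // t xs _ sz.
by apply: always_bind; apply: always_true => y /=; rewrite size_rcons sz.
Qed.

(* The m-th entry of the list is distributed like m further calls. *)
Let lrun_nth J m x (phi : V -> R) : (m <= J)%N ->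
  expect grad (lrun J x) (fun xs => phi (nth 0 xs m)) = expect grad (chain m x) phi.
Proof.
elim: J m phi => [|J IH] m phi; first by rewrite leqn0 => /eqP->.
rewrite leq_eqVlt => /predU1P[->|mJ]; rewrite /= expect_bind; last first.
  rewrite -(IH m phi mJ); apply: eq_expect; apply: always_sub (lrun_size J x) => xs sz.
  rewrite expect_bind -[RHS](expect_cst grad n0 (again (nth 0 xs J))).
  by apply: eq_expect; apply: always_true => y /=; rewrite nth_rcons sz mJ.
rewrite expect_bind -(IH J (fun y => expect grad (again y) phi) (leqnn J)).
apply: eq_expect; apply: always_sub (lrun_size J x) => xs sz.
rewrite expect_bind; apply: eq_expect; apply: always_true => y /=.
by rewrite nth_rcons sz ltnn eqxx.
Qed.

Let out J0 (xs : seq V) := nth 0 xs 2 +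
  2 ^+ J0.+1 *: (nth 0 xs (2 + J0) - nth 0 xs (maxn (2 + J0).-1 2)).

Variables (l : V) (c0 c2 : R).
Hypothesis c20 : 0 <= c2.

Let mu m x := expect grad (chain m x) (fun y => dotv l (y - p)).

Let out_le (J0 : nat) x : X x ->
  expect grad (lrun (2 + J0) x) (fun xs => c0 + dotv l (out J0 xs - p) +
    c2 * nsq (out J0 xs - p))
  <= c0 + mu 2 x + 2 * c2 * Q 2 x + (if J0 is J.+1 then
      2 ^+ J0.+1 * (mu (2 + J0) x - mu (1 + J0) x) +
      4 * 4 ^+ J0.+1 * c2 * (Q (2 + J0) x + Q (1 + J0) x) else 0).
Proof.
move=> Xx; set E := expect grad (lrun (2 + J0) x).
have ED h h' : E (fun y => h y + h' y) = E h + E h'.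
  by rewrite /E expectD//; apply: geomfree_bounded; exact: lrun_geomfree.
have EZ c h : E (fun y => c * h y) = c * E h.
  by rewrite /E expectZ//; apply: geomfree_bounded; exact: lrun_geomfree.
have EC c : E (fun=> c) = c by rewrite /E expect_cst.
have Ele h h' : (forall y, h y <= h' y) -> E h <= E h'.
  by move=> hh; apply: expect_le => //; [exact: always_true| |];
    apply: geomfree_bounded; exact: lrun_geomfree.
have Emu m : (m <= 2 + J0)%N -> E (fun xs => dotv l (nth 0 xs m - p)) = mu m x.
  by move=> mJ; rewrite /E (lrun_nth x (fun y => dotv l (y - p)) mJ).
have EQ m : (m <= 2 + J0)%N -> E (fun xs => nsq (nth 0 xs m - p)) = Q m x.
  by move=> mJ; rewrite /E (lrun_nth x (fun y => nsq (y - p)) mJ).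
have h2 := @Emu 2 (leq_addr _ _); have h2' := @EQ 2 (leq_addr _ _).
case: J0 E ED EZ EC Ele Emu EQ h2 h2' => [|J] E ED EZ EC Ele Emu EQ h2 h2'.
  apply: (@le_trans _ _ (E (fun xs => c0 + dotv l (nth 0 xs 2 - p) +
      2 * c2 * nsq (nth 0 xs 2 - p)))); last by rewrite !ED EC EZ h2 h2' addr0.
  apply: Ele => xs; rewrite /out addn0 /= subrr scaler0 addr0 lerD2l.
  by rewrite ler_wpM2r ?nsq_ge0// ler_peMl// ler1n.
have hJ : maxn (2 + J.+1).-1 2 = (1 + J.+1)%N by apply/maxn_idPl.
have hm : (1 + J.+1 <= 2 + J.+1)%N by [].
apply: (@le_trans _ _ (E (fun xs => c0 + dotv l (nth 0 xs 2 - p) +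
      2 * c2 * nsq (nth 0 xs 2 - p) +
      (2 ^+ J.+2 * (dotv l (nth 0 xs (2 + J.+1) - p) + -1 * dotv l (nth 0 xs (1 + J.+1) - p)) +
      4 * 4 ^+ J.+2 * c2 * (nsq (nth 0 xs (2 + J.+1) - p) + nsq (nth 0 xs (1 + J.+1) - p)))))); last first.
  rewrite !ED EC !EZ !ED EZ h2 h2' (Emu (2 + J.+1)%N)// (Emu (1 + J.+1)%N)//.
  by rewrite (EQ (2 + J.+1)%N)// (EQ (1 + J.+1)%N)// mulN1r.
apply: Ele => xs; rewrite /out hJ.
have -> : nth 0 xs 2 + 2 ^+ J.+2 *: (nth 0 xs (2 + J.+1) - nth 0 xs (1 + J.+1)) - p =
    (nth 0 xs 2 - p) + 2 ^+ J.+2 *: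
    ((nth 0 xs (2 + J.+1) - p) - (nth 0 xs (1 + J.+1) - p)).
  by rewrite opprB addrA subrK addrAC.
move: (nth 0 xs 2 - p) (nth 0 xs (2 + J.+1) - p) (nth 0 xs (1 + J.+1) - p) => a b c.
have := nsqD2_le a (2 ^+ J.+2 *: (b - c)); have := nsqD2_le b (- c); rewrite nsqN.
have -> : nsq (2 ^+ J.+2 *: (b - c)) = 4 ^+ J.+2 * nsq (b - c).
  rewrite dotvZl dotvZr mulrA; congr (_ * _).
  by rewrite -exprMn; congr (_ ^+ _); rewrite -natrM.
have k0 : 0 <= 4 ^+ J.+2 :> R by rewrite exprn_ge0.
move=> h3 h4.
have h5 : c2 * nsq (a + 2 ^+ J.+2 *: (b - c)) <=
    c2 * (2 * nsq a + 2 * (4 ^+ J.+2 * (2 * nsq b + 2 * nsq c))).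
  rewrite ler_wpM2l//; apply: le_trans h4 _; rewrite lerD2l ler_wpM2l//.
  exact: ler_wpM2l.
have h6 : dotv l (a + 2 ^+ J.+2 *: (b - c)) = dotv l a + 2 ^+ J.+2 * (dotv l b - dotv l c).
  by rewrite !(dotvDr, dotvZr, dotvNr).
by rewrite h6; move: h5; move: (4 ^+ J.+2) (2 ^+ J.+2) => k k'; lra.
Qed.

Let K0 : R := 9 / 400.
Let K0_ge0 : 0 <= K0. Proof. by rewrite /K0; lra. Qed.
Let u_lam x : 0 <= u x / lam. Proof. by rewrite divr_ge0 // ltW. Qed.

(* Weighted by [2 ^- j.+1], the differences telescope and the second moments form
a geometric series of ratio 2/7. *)
Let geom_sum_le x N : X x ->
  \sum_(0 <= j < N.+1) 2 ^- j.+1 * expect grad (lrun (2 + j) x)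
    (fun xs => c0 + dotv l (out j xs - p) + c2 * nsq (out j xs - p))
  <= (1 - 2 ^- N.+1) * (c0 + mu 2 x + 2 * c2 * Q 2 x) + (mu N.+2 x - mu 2 x) +
     c2 * (64 / 7 * (K0 * (u x / lam))) * (4 / 10 - 14 / 10 * (2 / 7) ^+ N.+1).
Proof.
move=> Xx; elim: N => [|N IH].
  have := out_le 0 Xx; rewrite big_nat1 expr1 addr0 subrr addr0 => h.
  have -> : 4 / 10 - 14 / 10 * (2 / 7) = 0 :> R by lra.
  have -> : 1 - 2^-1 = 2^-1 :> R by lra.
  by rewrite mulr0 addr0 ler_wpM2l.
rewrite big_nat_recr//=.
have := out_le N.+1 Xx => h.
have w0 := @half_pow_ge0 R N.+2.
have {}h := ler_wpM2l w0 h; apply: le_trans (lerD IH h) _.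
have e1 : 2 ^- N.+1 = 2 * 2 ^- N.+2 :> R.
  by rewrite [in RHS]exprS invfM mulrA mulfV// mul1r.
have e2 : 2 ^- N.+2 * 2 ^+ N.+2 = 1 :> R by rewrite mulVf// expf_neq0.
have e3 : 2 ^- N.+2 * 4 ^+ N.+2 = 2 ^+ N.+2 :> R.
  have -> : 4 = 2 * 2 :> R by rewrite -natrM.
  by rewrite exprMn mulrA e2 mul1r.
have hQ : 2 ^+ N.+2 * (Q (2 + N.+1) x + Q (1 + N.+1) x) <=
    16 / 7 * (K0 * (u x / lam)) * (2 / 7) ^+ N.+1.
  have q m : Q m.+1 x <= K0 * (u x / lam) * (1 / 7) ^+ m.
    rewrite -(ler_pM2l lam0); apply: le_trans (chain_Q m Xx) _.
    by rewrite le_eqVlt /K0; apply/orP; left; apply/eqP; field; rewrite gt_eqF.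
  have q1 := q N.+2; have q2 := q N.+1.
  have p0 : 0 <= 2 ^+ N.+2 :> R by rewrite exprn_ge0.
  apply: le_trans (ler_wpM2l p0 (lerD q1 q2)) _.
  have -> : (2 / 7) ^+ N.+1 = 2 ^+ N.+1 * (1 / 7) ^+ N.+1 :> R.
    by rewrite -exprMn mulrA mulr1.
  rewrite [2 ^+ N.+2]exprS [(1 / 7) ^+ N.+2]exprS.
  by move: (2 ^+ N.+1) ((1 / 7) ^+ N.+1) (K0 * _) => a b c; lra.
have hQ' := ler_wpM2l c20 hQ.
move: hQ'; rewrite [(2 / 7) ^+ N.+2]exprS e1.
move: e2 e3; move: (2 ^+ N.+2) (4 ^+ N.+2) ((2 / 7) ^+ N.+1) (2 ^- N.+2) => b c g a e2 e3.
move: (Q (2 + N.+1) x + Q (1 + N.+1) x) => qq hq.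
have e4 : a * (c0 + mu 2 x + 2 * c2 * Q 2 x +
    (b * (mu (2 + N.+1) x - mu (1 + N.+1) x) + 4 * c * c2 * qq)) =
   a * (c0 + mu 2 x + 2 * c2 * Q 2 x) + (mu N.+3 x - mu N.+2 x) + 4 * (c2 * (b * qq)).
  transitivity (a * (c0 + mu 2 x + 2 * c2 * Q 2 x) +
    (a * b) * (mu (2 + N.+1) x - mu (1 + N.+1) x) + 4 * (c2 * ((a * c) * qq))); first by ring.
  by rewrite e2 e3 mul1r.
rewrite e4; move: hq; set kk := K0 * _.
by lra.
Qed.

(* The last term of the telescoping sum vanishes in the limit. *)
Let mu_small m x : X x -> mu m.+1 x <= 2 ^- m * (nsq l + K0 * (u x / lam)).
Proof.
move=> Xx; have t0 : 0 < 2 ^- m :> R by rewrite invr_gt0 exprn_gt0.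
have h : mu m.+1 x <= 2 ^- m / 2 * nsq l + (2 * 2 ^- m)^-1 * Q m.+1 x.
  rewrite -(expect_cst grad n0 (chain m.+1 x) (2 ^- m / 2 * nsq l)) -expectZ//; last first.
    by apply: geomfree_bounded; exact: chain_geomfree.
  rewrite -expectD//; try by apply: geomfree_bounded; exact: chain_geomfree.
  apply: expect_le => //; try by apply: geomfree_bounded; exact: chain_geomfree.
  by apply: always_true => y; exact: dotv_young.
apply: le_trans h _.
have q : Q m.+1 x <= K0 * (u x / lam) * (1 / 7) ^+ m.
  rewrite -(ler_pM2l lam0); apply: le_trans (chain_Q m Xx) _.
  by rewrite le_eqVlt /K0; apply/orP; left; apply/eqP; field; rewrite gt_eqF.
have k0 : 0 <= K0 * (u x / lam) by rewrite mulr_ge0.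
rewrite mulrDr; apply: lerD.
  by rewrite ler_wpM2r ?nsq_ge0// ler_pdivrMr// ler_peMr ?(ltW t0)// ler1n.
have i0 : 0 <= (2 * 2 ^- m)^-1 :> R by rewrite invr_ge0 mulr_ge0// ltW.
apply: le_trans (ler_wpM2l i0 q) _; rewrite mulrCA [leRHS]mulrC ler_wpM2l//.
rewrite invfM invrK -mulrA -exprMn -exprVn.
apply: (@le_trans _ _ (1 * (2 * (1 / 7)) ^+ m)).
  by rewrite ler_wpM2r ?exprn_ge0 ?mulr_ge0//; lra.
by rewrite mul1r; apply: lerXn2r; rewrite ?nnegrE; lra.
Qed.

Let rest x : prog V n V := let* Jp := Geom Ret in
  let* xs := forM (2 + Jp) lbody [:: x] in Ret (out Jp xs).

Let rest_le x (h : V -> R) M : X x -> (forall z, `|h z| <= M) ->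
  (forall z, h z <= c0 + dotv l (z - p) + c2 * nsq (z - p)) ->
  expect grad (rest x) h <= c0 + 111 / 1250 * (c2 / lam) * u x.
Proof.
move=> Xx hM hh.
have bh : bounded_on grad (rest x) h by exists M; exact: always_true.
have cv := expect_geom_cvg n0 bh.
set K := nsq l + K0 * (u x / lam) - (c0 + mu 2 x + 2 * c2 * Q 2 x).
set B := c0 + 111 / 1250 * (c2 / lam) * u x.
have cB : (fun N => B + 2 ^- N.+1 * K) @ \oo --> B.
  have h0 : (fun N => 2 ^- N.+1 : R) @ \oo --> (0 : R).
    by rewrite (cvg_shiftS (fun N => 2 ^- N : R)); exact: cvg_halves.
  have := cvgD (cvg_cst B) (cvgM h0 (cvg_cst K)).
  by rewrite mul0r addr0 => h1; apply: h1.
rewrite -cvg_shiftS in cv.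
apply: ler_cvg_to cv cB _; apply: nearW => N; rewrite /series/=.
apply: (@le_trans _ _ (\sum_(0 <= j < N.+1) 2 ^- j.+1 * expect grad (lrun (2 + j) x)
    (fun xs => c0 + dotv l (out j xs - p) + c2 * nsq (out j xs - p)))).
  apply: ler_sum => j _; rewrite ler_wpM2l ?half_pow_ge0// expect_bind.
  apply: expect_le => //; try exact: geomfree_bounded (lrun_geomfree (2 + j) x).
  by apply: always_true => xs; exact: hh.
apply: le_trans (geom_sum_le N Xx) _.
have := mu_small N.+1 Xx.
have q2 : Q 2 x <= 1 / 7 * (K0 * (u x / lam)).
  rewrite -(ler_pM2l lam0); apply: le_trans (chain_Q 1 Xx) _.
  by rewrite le_eqVlt /K0; apply/orP; left; apply/eqP; field; rewrite gt_eqF.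
have q2' := ler_wpM2l c20 q2.
have g0 : 0 <= (2 / 7) ^+ N.+1 :> R by rewrite exprn_ge0//; lra.
have k0 : 0 <= c2 * (64 / 7 * (K0 * (u x / lam))) by do 3 (apply: mulr_ge0 => //).
have k1 : c2 * (64 / 7 * (K0 * (u x / lam))) * (4 / 10 - 14 / 10 * (2 / 7) ^+ N.+1) <=
    c2 * (64 / 7 * (K0 * (u x / lam))) * (4 / 10).
  by rewrite ler_wpM2l// gerBl mulr_ge0//; lra.
have k2 : 0 <= c2 * (u x / lam) by rewrite mulr_ge0.
have -> : B = c0 + 111 / 1250 * (c2 * (u x / lam)) by rewrite /B; ring.
move: k1 k2 q2'; rewrite /K /K0.
have -> : c2 * (1 / 7 * (9 / 400 * (u x / lam))) = 9 / 2800 * (c2 * (u x / lam)) by field; rewrite gt_eqF.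
have -> : c2 * (64 / 7 * (9 / 400 * (u x / lam))) * (4 / 10) = 576 / 7000 * (c2 * (u x / lam)).
  by field; rewrite gt_eqF.
move: (c2 * (u x / lam)) (c2 * (64 / 7 * _) * _) => a b.
by move: (2 ^- N.+1) => e; lra.
Qed.

(** The telescoping sum over the number of rounds makes the output unbiased,
and the contraction of every round by a factor 1/7, below 1/2, bounds its
second moment. The function [h] is arbitrary below its quadratic bound because it
will be the squared distance of a projected point. *)
Lemma unbiased_prox_le (h : V -> R) M : X xp -> (forall z, `|h z| <= M) ->
  (forall z, h z <= c0 + dotv l (z - p) + c2 * nsq (z - p)) ->
  expect grad (unbiased_prox X L lam s xp) h <=
  c0 + 23 / 2000 * (c2 / lam) * (lam * nsq (s - p) + gdev xp p).
Proof.
move=> Xxp hM hh; rewrite -[unbiased_prox _ _ _ _ _]/(bind (approx_prox X L lam s s xp) rest).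
set q := approx_prox X L lam s s xp.
have gq : geomfree grad q by exact: geomfree_approx_prox.
rewrite expect_bind.
apply: (@le_trans _ _ (expect grad q (fun x => c0 + 111 / 1250 * (c2 / lam) * u x))).
  apply: expect_le => //; try exact: geomfree_bounded.
  have aq : always grad q X by exact: always_approx_prox.
  by apply: always_sub aq => x Xx; exact: rest_le hM hh.
rewrite expectD//; try exact: geomfree_bounded.
rewrite expect_cst// expectZ//; last exact: geomfree_bounded.
rewrite lerD2l.
have [_ h1 h2] := approx_prox_bounds xp Xs pP.
have h3 : expect grad q u <= 51 / 400 * (lam * nsq (s - p)) + 249 / 2000 * gdev xp p.
  rewrite expectD//; try exact: geomfree_bounded.
  by move: h1 h2; rewrite -/q; lra.
have k0 : 0 <= c2 / lam by rewrite divr_ge0// ltW.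
have b0 : 0 <= lam * nsq (s - p) by rewrite mulr_ge0 ?nsq_ge0// ltW.
have w0 := gdev_ge0 xp p.
have h4 : 111 / 1250 * expect grad q u <= 23 / 2000 * (lam * nsq (s - p) + gdev xp p) by lra.
have := ler_wpM2l k0 h4; move: (c2 / lam) (expect _ _ _) (lam * _ + _) => a b c; lra.
Qed.

End Unbiased.

End ProxOracles.

(** * Accelerated proximal steps *)

Section Momentum.
Context {R : realType}.

(** The analysis is in terms of the inverses of the parameters alpha_t, whose
squares are the weights of the function values. *)
Definition momentum (t : nat) : R := (iter t next_alpha 1)^-1.

Lemma next_alphaP (a : R) : 0 < a -> a <= 1 ->
  [/\ 0 < next_alpha a, next_alpha a <= 1 &
    (next_alpha a)^-1 ^+ 2 - (next_alpha a)^-1 = a^-1 ^+ 2].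
Proof.
move=> a0 a1.
have : exists b, [set b | 0 <= b <= 1 /\ (b ^+ 2)^-1 - b^-1 = (a ^+ 2)^-1] b.
  set r := Num.sqrt (1 + 4 * a^-1 ^+ 2).
  have r2 : r ^+ 2 = 1 + 4 * a^-1 ^+ 2.
    by rewrite sqr_sqrtr// addr_ge0// mulr_ge0// sqr_ge0.
  have r0 : 0 <= r by exact: sqrtr_ge0.
  have r1 : 1 <= r.
    have := sqr_ge0 a^-1; set q := a^-1 ^+ 2 in r2 *; nra.
  exists ((1 + r) / 2)^-1 => /=; split.
    by rewrite invr_ge0 divr_ge0 ?addr_ge0//= invf_le1 ?divr_gt0//; lra.
  rewrite -exprVn invrK -exprVn; set q := a^-1 ^+ 2 in r2 *.
  by rewrite expr2; nra.
move=> /(xgetPex 0); rewrite -/(next_alpha a); set b := next_alpha a => -[/andP[b0 b1] h].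
have bn : b != 0.
  apply/eqP => b_0; move: h; rewrite b_0 expr0n/= invr0 subrr => /esym/eqP.
  by rewrite invr_eq0 sqrf_eq0 gt_eqF.
by split => //; [rewrite lt_neqAle eq_sym bn|rewrite !exprVn].
Qed.

Lemma iter_next_alpha t : 0 < iter t next_alpha (1 : R) /\ iter t next_alpha (1 : R) <= 1.
Proof.
elim: t => [|t [IH1 IH2]] /=; first by rewrite ltr01 lexx.
by have [h1 h2 _] := next_alphaP IH1 IH2.
Qed.

Local Notation a := momentum.

Lemma momentum_ge1 t : 1 <= a t.
Proof. by have [h1 h2] := iter_next_alpha t; rewrite invf_ge1. Qed.

Lemma momentumS t : a t.+1 ^+ 2 - a t.+1 = a t ^+ 2.
Proof. by have [h1 h2] := iter_next_alpha t; have [_ _] := next_alphaP h1 h2. Qed.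

Lemma momentum_incr t : a t + 1 / 2 <= a t.+1 /\ a t.+1 <= a t + 1.
Proof.
have := momentumS t; have := momentum_ge1 t; have := momentum_ge1 t.+1.
move: (a t) (a t.+1) => u w w1 u1 h; split; nra.
Qed.

Lemma momentum_lower t : 1 + t%:R / 2 <= a t.
Proof.
elim: t => [|t IH]; first by rewrite mul0r addr0 momentum_ge1.
by have [h _] := momentum_incr t; rewrite -natr1; lra.
Qed.

Lemma momentum_upper t : a t <= 1 + t%:R.
Proof.
elim: t => [|t IH]; first by rewrite /momentum /= invr1 addr0.
by have [_ h] := momentum_incr t; rewrite -natr1; lra.
Qed.

(** The weight of the function value in the correction term of the potential does
not increase. *)
Lemma momentum_telescope t : a t.+2 * (a t.+1 - 1) <= a t.+1 * a t.
Proof.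
have := momentumS t; have := momentumS t.+1; have := momentum_ge1 t.
have [+ _] := momentum_incr t; have [+ _] := momentum_incr t.+1.
move: (a t) (a t.+1) (a t.+2) => u v w h1 h2 u1 e2 e1.
have w0 : 0 <= w by lra. have v0 : 0 <= v by lra. have u0 : 0 <= u by lra.
rewrite -(@ler_pXn2r _ 2)// ?nnegrE ?mulr_ge0//; last by lra.
rewrite !exprMn -e1.
have -> : w ^+ 2 = w + v ^+ 2 by rewrite -e2 addrC subrK.
have : 0 <= (v - 1) * (v * v - (w * (v - 1))).
  apply: mulr_ge0; first lra.
  have -> : v * v = w ^+ 2 - w by rewrite -expr2 e2.
  have : w * (v - 1) <= w * (w - 1) by rewrite ler_wpM2l//; lra.
  by rewrite expr2; lra.
by rewrite !expr2; nra.
Qed.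

End Momentum.

Section AccelStep.
Context {R : realType} {d n : nat}.
Local Notation V := 'rV[R]_d.
Context (X : set V) (L : R) (f : 'I_n -> V -> R) (G : 'I_n -> V -> V).
Hypothesis sp : smooth_problem X L f G.
Local Notation F := (avgf f).
Local Notation GF := (avgg G).
Local Notation lam := (rate (n := n) L).
Local Notation gdev := (gdev L G).
Let lam0 : 0 < lam := rate_gt0 sp.

(* [p] and [p'] are the exact proximal points of two successive steps, [q] and
[s] their centres. *)
Variables (x v q p s p' xs : V) (a1 : R).
Hypothesis Xx : X x.
Hypothesis Xv : X v.
Hypothesis Xxs : X xs.
Hypothesis pP : is_prox X G lam q p.
Hypothesis p'P : is_prox X G lam s p'.
Hypothesis a10 : 0 < a1.
Hypothesis sE : a1 ^+ 2 *: s = (a1 ^+ 2 - a1) *: x + a1 *: v.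
Let Xp : X p := pP.1.
Let Xp' : X p' := p'P.1.

Definition breg y z := F y - F z - dotv (GF z) (y - z).

Lemma breg_ge0 y z : X y -> X z -> 0 <= breg y z.
Proof. by move=> Xy Xz; have := avgf_grad sp Xz Xy; rewrite /breg; lra. Qed.

(** The accelerated proximal step for an exact proximal point [p'], compared with
the previous exact point [p] and with [xs]. The error [x - p] of the actual
iterate only enters through an inner product with [s - p']. *)
Lemma prox_value_step : 0 <= a1 ^+ 2 - a1 ->
  a1 ^+ 2 * (F p' - F xs) <= (a1 ^+ 2 - a1) * (F p - F xs) -
    (a1 ^+ 2 - a1) * breg p p' - a1 ^+ 2 * (lam * nsq (s - p')) +
    (a1 ^+ 2 - a1) * (lam * dotv (s - p') (x - p)) +
    a1 * (lam * dotv (s - p') (v - xs)).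
Proof.
move=> A0; have h1 := is_prox_grad p'P Xp; have h2 := is_prox_le sp p'P Xxs.
have h3 : (a1 ^+ 2 - a1) * (F p') <=
    (a1 ^+ 2 - a1) * (F p - breg p p' - lam * dotv (s - p') (p - p')).
  by rewrite ler_wpM2l// /breg; lra.
have h4 : a1 * (F p' + lam * dotv (s - p') (xs - p')) <= a1 * F xs.
  by rewrite ler_pM2l.
have e : a1 ^+ 2 * dotv (s - p') (s - p') =
   (a1 ^+ 2 - a1) * dotv (s - p') (p - p') + a1 * dotv (s - p') (xs - p') +
   (a1 ^+ 2 - a1) * dotv (s - p') (x - p) + a1 * dotv (s - p') (v - xs).
  rewrite -!(dotvZr _ _ (s - p')) -!(dotvDr _ _ (s - p')); congr dotv.
  rewrite scalerBr sE; apply/rowP => i; rewrite !mxE; ring.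
have e' : a1 ^+ 2 * (lam * nsq (s - p')) = lam * (a1 ^+ 2 * nsq (s - p')) by ring.
rewrite e' e; lra.
Qed.

(* Cocoercivity bounds the change of the gradients by the symmetric divergence
only. Its part [breg p p'] is a gain of [prox_value_step]; [breg_prev_le] supplies
the part [breg p' p]. *)
Lemma gdev_sym_le : gdev p p' <= breg p p' + breg p' p.
Proof.
rewrite !gdevE ler_pdivrMr ?(sp_L sp)// mulrC.
apply: le_trans (gvar_le_sym sp Xp Xp') _; rewrite ler_pM2l ?(sp_L sp)// /breg.
by rewrite dotvDl dotvNl -(opprB p p') dotvNr; lra.
Qed.

Lemma gdev_next_le : gdev x p' <= 2 * gdev x p + 2 * (breg p p' + breg p' p).
Proof.
apply: (@le_trans _ _ (2 * gdev x p + 2 * gdev p p')); last first.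
  by rewrite lerD2l ler_wpM2l// gdev_sym_le.
have := @gvar_triangle _ _ _ G 1 x p p' ltr01; rewrite invr1 => h.
have i0 : 0 <= L^-1 by rewrite invr_ge0 ltW// (sp_L sp).
by have := ler_wpM2r i0 h; rewrite !gdevE; lra.
Qed.

(** The optimality of the previous point [p]. The last term, with [p - v], is not
of second order; it is carried along in the potential. *)
Lemma breg_prev_le : a1 ^+ 2 * breg p' p <= a1 ^+ 2 * (F p' - F p) -
    (a1 ^+ 2 - a1) * (lam * dotv (q - p) (x - p)) +
    a1 ^+ 2 * (lam * dotv (q - p) (s - p')) + a1 * (lam * dotv (q - p) (p - v)).
Proof.
have h1 := is_prox_grad pP Xp'.
have h2 : a1 ^+ 2 * breg p' p <= a1 ^+ 2 * (F p' - F p - lam * dotv (q - p) (p' - p)).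
  by rewrite ler_wpM2l ?sqr_ge0// /breg; lra.
have e : a1 ^+ 2 * dotv (q - p) (p' - p) = (a1 ^+ 2 - a1) * dotv (q - p) (x - p) -
    a1 ^+ 2 * dotv (q - p) (s - p') - a1 * dotv (q - p) (p - v).
  rewrite -!(dotvZr _ _ (q - p)) -!dotvNr -!(dotvDr _ _ (q - p)); congr dotv.
  rewrite (scalerBr _ s) sE; apply/rowP => i; rewrite !mxE; ring.
have := congr1 (fun r => lam * r) e => /= e'; lra.
Qed.

Section Move.
Variable xt : V.
Let z := xt - p'.
Let v' := proj X (v - a1 *: (s - xt)).

Lemma v_next_le : nsq (v' - xs) <= nsq (v - xs) - 2 * a1 * dotv (s - p') (v - xs) +
  a1 ^+ 2 * nsq (s - p') + dotv ((2 * a1) *: ((v - xs) - a1 *: (s - p'))) z + a1 ^+ 2 * nsq z.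
Proof.
have := proj_nsq_le sp Xx (v - a1 *: (s - xt)) Xxs; rewrite -/v' => /le_trans; apply.
have -> : v - a1 *: (s - xt) - xs = (v - xs) - a1 *: (s - p') + a1 *: z.
  by rewrite /z; apply/rowP => i; rewrite !mxE; ring.
move: (v - xs) (s - p') z => u w y; rewrite !dotvE (dotvC w u) (dotvC y u) (dotvC y w); lra.
Qed.

(** Without noise, the point to be projected is an extrapolation of [p'] away
from [x]; the projection itself has the right sign because [v] lies in [X]. *)
Lemma dotv_next_le : dotv (s - p') (p' - v') <= (a1 - 1) * dotv (s - p') (x - p') +
  dotv (proj X (v - a1 *: (s - p')) - v) z + a1 * nsq z.
Proof.
set y := v - a1 *: (s - p').
have yz : v - a1 *: (s - xt) = y + a1 *: z.
  by rewrite /y /z; apply/rowP => i; rewrite !mxE; ring.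
have py : p' - y = (a1 - 1) *: (x - p').
  have a1n : a1 != 0 by rewrite gt_eqF.
  apply: (scalerI a1n); rewrite /y scalerA scalerBr scalerBr scalerA -expr2 scalerBr sE.
  by apply/rowP => i; rewrite !mxE; ring.
have h1 := proj_variational sp Xx (v - a1 *: (s - xt)) Xv.
have h2 := proj_monotone sp Xx (v - a1 *: (s - xt)) y.
rewrite -/v' yz in h1 h2.
have e : a1 * dotv (s - p') (y - v') = dotv (v - y) (y - v').
  by rewrite -dotvZl; congr dotv; rewrite /y subKr.
have -> : dotv (s - p') (p' - v') = (a1 - 1) * dotv (s - p') (x - p') + dotv (s - p') (y - v').
  rewrite -dotvZr -py -(dotvDr _ _ (s - p')); congr dotv.
  by rewrite addrA subrK.
rewrite -[leRHS]addrA lerD2l -(ler_pM2l a10) e.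
move: (proj X y) h2 => vo h2; move: h1 h2 => {e py yz}.
have -> : y + a1 *: z - y = a1 *: z by rewrite addrC addKr.
have -> : y + a1 *: z - v' = (y - v') + a1 *: z by rewrite addrAC.
have -> : v - y = (v - v') - (y - v') by apply/rowP => i; rewrite !mxE; ring.
have -> : vo - v = - (v - v') - (v' - vo) by apply/rowP => i; rewrite !mxE; ring.
move: (y - v') (v - v') (v' - vo) z => r u w t h1 h2.
have h3 := nsq_ge0 r; have h4 := nsq_ge0 (a1 *: t - w).
move: h1 h2 h3 h4; rewrite !dotvE (dotvC w t) (dotvC u r) (dotvC u t).
rewrite !mulrDr !mulrN.
move: (dotv r u) (dotv t u) (dotv w w) (dotv t w) (dotv r r) (dotv t t) => c1 c2 c3 c4 c5 c6.
move: (a1 * c4) (a1 * (a1 * c6)) (a1 * c2) => d1 d2 d3 h1 h2 h3 h4.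
lra.
Qed.

End Move.

Lemma dotv_prox_value : lam * dotv (s - p') (x - p') <=
  F p - F p' - breg p p' + lam * dotv (s - p') (x - p).
Proof.
have := is_prox_grad p'P Xp; rewrite /breg.
have -> : x - p' = (p - p') + (x - p) by rewrite [RHS]addrC addrA subrK.
by rewrite (dotvDr (p - p') (x - p) (s - p')); lra.
Qed.

End AccelStep.

(** * One iteration in expectation *)

Section Bounded.
Context {S : Type} {R : realType}.
Implicit Types (Q : S -> Prop) (h : S -> R).

(** The states range over infinite sets, and expectations add up only for bounded
functions. *)
Definition bounded_where Q h := exists M, forall z, Q z -> `|h z| <= M.

Lemma bounded_where_cst Q c : bounded_where Q (fun=> c).
Proof. by exists `|c|. Qed.

Lemma bounded_whereD Q h h' : bounded_where Q h -> bounded_where Q h' ->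
  bounded_where Q (fun z => h z + h' z).
Proof.
move=> [M hM] [M' hM']; exists (M + M') => z Qz.
by apply: le_trans (ler_normD _ _) _; apply: lerD; [exact: hM|exact: hM'].
Qed.

Lemma bounded_whereZ Q c h : bounded_where Q h -> bounded_where Q (fun z => c * h z).
Proof.
by move=> [M hM]; exists (`|c| * M) => z Qz; rewrite normrM ler_wpM2l//; exact: hM.
Qed.

Lemma bounded_where_between Q h a b : (forall z, Q z -> a <= h z <= b) ->
  bounded_where Q h.
Proof.
move=> hh; exists (`|a| + `|b|) => z /hh /andP[h1 h2].
have := ler_norm b; have := ler_norm (- a); rewrite normrN => ha hb.
by have := normr_ge0 a; have := normr_ge0 b; rewrite ler_norml => *; apply/andP; split; lra.
Qed.

End Bounded.

Section Iteration.
Context {R : realType} {d n : nat}.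
Local Notation V := 'rV[R]_d.
Context (X : set V) (L : R) (f : 'I_n -> V -> R) (G grad : 'I_n -> V -> V).
Hypothesis sp : smooth_problem X L f G.
Hypothesis tg : forall i u x y, X x -> X y ->
  dotv (grad i u) (x - y) = dotv (G i u) (x - y).
Local Notation F := (avgf f).
Local Notation GF := (avgg G).
Local Notation lam := (rate (n := n) L).
Local Notation gdev := (gdev L G).
Let n0 := sp_n sp.
Let lam0 : 0 < lam := rate_gt0 sp.

Definition accel_step (s x v : V) (a : R) : prog V n (V * V) :=
  let* x' := approx_prox X L lam s s x in
  let* xt := unbiased_prox X L lam s x in
  Ret (x', proj X (v - a *: (s - xt))).

Variables (x v p' s xs : V) (a1 : R).
Hypothesis Xx : X x.
Hypothesis Xv : X v.
Hypothesis Xs : X s.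
Hypothesis Xxs : X xs.
Hypothesis p'P : is_prox X G lam s p'.
Hypothesis a10 : 0 < a1.
Hypothesis sE : a1 ^+ 2 *: s = (a1 ^+ 2 - a1) *: x + a1 *: v.
Let Xp' : X p' := p'P.1.

Lemma always_accel_step :
  always grad (accel_step s x v a1) (fun r => X r.1 /\ X r.2).
Proof.
apply: always_bind; have h : always grad (approx_prox X L lam s s x) X by exact: (always_approx_prox grad sp s x Xs).
apply: always_sub h => x' Xx'; apply: always_bind; apply: always_true => xt /=.
by split=> //; exact: (proj_in sp Xx).
Qed.

(** One iteration, for any nonnegative weights. The unbiasedness of the proximal
estimate makes its error enter [v] quadratically, through the last summand. *)
Lemma accel_step_le (B0 B1 B2 B4 BV BH : R) :
  0 <= B1 -> 0 <= B2 -> 0 <= B4 -> 0 <= BV -> 0 <= BH ->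
  expect grad (accel_step s x v a1) (fun r =>
    (B0 + B1 * (lam * nsq (r.1 - p')) + B2 * gdev r.1 p' +
      B4 * (prox_obj f lam s r.1 - prox_obj f lam s p')) +
    (BV * (lam * nsq (r.2 - xs)) + BH * (lam * dotv (s - p') (p' - r.2))))
  <= B0 + (B1 + B4) * (7 / 400 * (lam * nsq (s - p')) + 9 / 400 * gdev x p') +
     B2 * (11 / 100 * (lam * nsq (s - p')) + 102 / 1000 * gdev x p') +
     BV * (lam * nsq (v - xs) - 2 * a1 * (lam * dotv (s - p') (v - xs)) +
       a1 ^+ 2 * (lam * nsq (s - p'))) +
     BH * ((a1 - 1) * (lam * dotv (s - p') (x - p'))) +
     23 / 2000 * (BV * a1 ^+ 2 + BH * a1) * (lam * nsq (s - p') + gdev x p').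
Proof.
move=> B10 B20 B40 BV0 BH0.
set b := lam * nsq (s - p'); set w := gdev x p'.
pose g y := B0 + B1 * (lam * nsq (y - p')) + B2 * gdev y p' +
      B4 * (prox_obj f lam s y - prox_obj f lam s p').
pose vn y := proj X (v - a1 *: (s - y)).
pose h y := BV * (lam * nsq (vn y - xs)) + BH * (lam * dotv (s - p') (p' - vn y)).
have Xvn y : X (vn y) by exact: (proj_in sp Xx).
have [M hM] : bounded_where (fun=> True) h.
  have [D hD] := sp_bounded sp.
  apply: bounded_whereD; apply: bounded_whereZ; apply: bounded_whereZ.
    by apply: (@bounded_where_between _ _ _ _ 0 D) => y _; rewrite nsq_ge0 hD.
  apply: (@bounded_where_between _ _ _ _ (- (1 / 2 * nsq (s - p') + (2 * 1)^-1 * D))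
     (1 / 2 * nsq (s - p') + (2 * 1)^-1 * D)) => y _.
  have h1 := @dotv_young _ _ 1 (s - p') (p' - vn y) ltr01.
  have h2 := @dotv_young _ _ 1 (s - p') (- (p' - vn y)) ltr01.
  have h3 := hD _ _ Xp' (Xvn y); rewrite nsqN dotvNr in h2.
  by apply/andP; split; lra.
have gf : geomfree grad (approx_prox X L lam s s x) by exact: geomfree_approx_prox.
have EZ c k : expect grad (approx_prox X L lam s s x) (fun y => c * k y) =
    c * expect grad (approx_prox X L lam s s x) k.
  by rewrite expectZ//; exact: geomfree_bounded.
have ED k k' : expect grad (approx_prox X L lam s s x) (fun y => k y + k' y) =
    expect grad (approx_prox X L lam s s x) k + expect grad (approx_prox X L lam s s x) k'.
  by rewrite expectD//; exact: geomfree_bounded.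
pose U : prog V n V := unbiased_prox X L lam s x.
have -> : expect grad (accel_step s x v a1) (fun r =>
    (B0 + B1 * (lam * nsq (r.1 - p')) + B2 * gdev r.1 p' +
      B4 * (prox_obj f lam s r.1 - prox_obj f lam s p')) +
    (BV * (lam * nsq (r.2 - xs)) + BH * (lam * dotv (s - p') (p' - r.2)))) =
  expect grad (approx_prox X L lam s s x) g + expect grad U h.
  rewrite expect_bind -[X in _ = _ + X](expect_cst grad n0 (approx_prox X L lam s s x)) -ED.
  apply: eq_expect; apply: always_true => y.
  rewrite expect_bind -/U -[X in _ = X + _](expect_cst grad n0 U) -expectD//.
    by exists `|g y|; apply: always_true.
  by exists M; apply: always_true => z; exact: hM.
have [h1 h2 h3] := approx_prox_bounds sp tg x Xs p'P.
rewrite EZ in h2.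
have hU : expect grad U h <= 
     BV * (lam * nsq (v - xs) - 2 * a1 * (lam * dotv (s - p') (v - xs)) + a1 ^+ 2 * b) +
     BH * ((a1 - 1) * (lam * dotv (s - p') (x - p'))) +
     23 / 2000 * (BV * a1 ^+ 2 + BH * a1) * (b + w).
  pose l := (BV * lam) *: ((2 * a1) *: ((v - xs) - a1 *: (s - p'))) +
    (BH * lam) *: (proj X (v - a1 *: (s - p')) - v).
  pose c2 := lam * (BV * a1 ^+ 2 + BH * a1).
  have c20 : 0 <= c2.
    apply: mulr_ge0; first exact: ltW.
    by apply: addr_ge0; apply: mulr_ge0 => //; [exact: sqr_ge0|exact: ltW].
  have := @unbiased_prox_le _ _ _ _ _ _ _ _ sp tg s x p' Xs p'P l
     (BV * (lam * nsq (v - xs) - 2 * a1 * (lam * dotv (s - p') (v - xs)) + a1 ^+ 2 * b) +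
     BH * ((a1 - 1) * (lam * dotv (s - p') (x - p')))) c2 c20 h M Xx.
  have -> : c2 / lam = BV * a1 ^+ 2 + BH * a1.
    by rewrite /c2 mulrC mulKf// gt_eqF.
  apply => [z|z]; first exact: hM.
  have k1 := v_next_le sp v s p' a1 Xx Xxs z.
  have k2 := dotv_next_le sp p' Xx Xv a10 sE z.
  have l0 := ltW lam0.
  have {}k1 := ler_wpM2l BV0 (ler_wpM2l l0 k1).
  have {}k2 := ler_wpM2l BH0 (ler_wpM2l l0 k2).
  apply: le_trans (lerD k1 k2) _.
  rewrite /l !(dotvDl, dotvZl, dotvNl) /c2 /b !(dotvDl, dotvZl, dotvNl) le_eqVlt; apply/orP; left.
  by apply/eqP; ring.
have hG : expect grad (approx_prox X L lam s s x) g <=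
    B0 + (B1 + B4) * (7 / 400 * b + 9 / 400 * w) + B2 * (11 / 100 * b + 102 / 1000 * w).
  rewrite /g ED ED ED (expect_cst grad n0) !EZ.
  have := ler_wpM2l B10 h2; have := ler_wpM2l B20 h3; have := ler_wpM2l B40 h1.
  by rewrite -/b -/w; lra.
by have := lerD hG hU; move: (_ * (b + w)) => t; lra.
Qed.

End Iteration.

(** * The potential of the accelerated method *)

Section Arithmetic.
Context {R : realType}.

(** The balance of one iteration. Here [ph] and [ph'] are the gaps of [p] and
[p'], [D] and [Rr] the divergences of the two points in the two orders, [b] the
squared distance of the centre to [p'] and [w] the variance at [p'], all in the
units of a function value. The optimality of the previous point is used with weight 3/20:
the term in [Rr] that it yields outweighs the share of [w] in [Rr], whose
coefficient is close to 0.145, and the weight is small enough for the quadratic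
form in [s - p'], [x - p] and [q - p] to stay negative. *)
Lemma refined_arith (A A1 a1 at0 h c ph ph' D Rr b w vv g1 g2 g3 g4 g5 H Q Gd Dl e : R) :
  0 <= A -> A1 = A + a1 -> A1 <= 21 / 20 * A -> 0 <= a1 -> a1 * at0 <= A1 ->
  0 <= h -> 0 <= c -> c <= a1 * at0 -> h * a1 <= 22 / 21 * A1 ->
  [/\ 0 <= ph, 0 <= D, 0 <= Rr, 0 <= b & 0 <= w] ->
  [/\ 0 <= Q, 0 <= Gd, 0 <= Dl & 0 <= e] ->
  A1 * ph' <= A * ph - A * D - A1 * b + A * g3 + a1 * g1 ->
  A1 * Rr <= A1 * (ph' - ph) - A * g4 + A1 * g5 + a1 * H ->
  w <= 2 * Gd + 2 * (D + Rr) -> g2 <= ph - ph' - D + g3 ->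
  g3 <= 17 / 100 * b + 25 / 17 * Q -> - g4 <= 1 / 2 * Dl + 1 / 2 * Q ->
  g5 <= 1 / 2 * b + 1 / 2 * Dl ->
  ((17 / 20 * A1 + 3 / 20 * c) * ph' + 4 / 25 * A1 * b) +
    (21 / 10 * A1 + 1 / 20 * A1) * (7 / 400 * b + 9 / 400 * w) +
    4 / 25 * A1 * (11 / 100 * b + 102 / 1000 * w) +
    1 / 2 * (vv - 2 * (a1 * g1) + A1 * b) + 3 / 20 * (c * g2) +
    23 / 2000 * (1 / 2 * A1 + 3 / 20 * (h * a1)) * (b + w)
  <= (17 / 20 * A + 3 / 20 * (a1 * at0 - a1)) * ph + 1 / 2 * vv + 3 / 20 * a1 * H +
     A * (21 / 10 * Q + 4 / 25 * Gd + 4 / 25 * Dl + 1 / 20 * e).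
Proof.
move=> A0 A1E A1le a10 aale h0 c0 cle hale [ph0 D0 R0 b0 w0] [Q0 G0 Dl0 e0] d1 d2 hw hg y1 y2 y3.
have A10 : 0 <= A1 by lra.
have k1 := ler_wpM2l c0 hg.
have Ac0 : 0 <= A + 3 / 20 * c by lra.
have k2 := ler_wpM2l Ac0 y1.
have k3 := ler_wpM2l A0 y2.
have k4 := ler_wpM2l A10 y3.
have bw : 0 <= b + w by lra.
have k5 := ler_wpM2r bw hale.
have k6 := ler_wpM2l A10 hw.
have k7 := ler_wpM2r ph0 cle.
have cA : c <= 21 / 20 * A by lra.
have k8 := ler_wpM2r b0 cA.
have k9 := ler_wpM2r Q0 cA.
have k10 := mulr_ge0 c0 D0.
have k11 := ler_wpM2r G0 A1le.
have k12 := ler_wpM2r D0 A1le.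
have k13 := ler_wpM2r Dl0 A1le.
have AA1 : A <= A1 by lra.
have k14 := ler_wpM2r b0 AA1.
have k15 := mulr_ge0 A0 e0.
have k16 := mulr_ge0 A10 R0.
have k17 := mulr_ge0 A0 D0.
have k18 := mulr_ge0 A10 b0.
have k19 := mulr_ge0 A0 Q0.
have k20 := mulr_ge0 A0 Dl0.
have k21 := mulr_ge0 A0 G0.
have k22 : A1 * ph = A * ph + a1 * ph by rewrite A1E mulrDl.
move: {A1E A1le aale cle hale hw hg y1 y2 y3 Ac0 cA AA1} d1 d2 k1 k2 k3 k4 k5 k6 k7 k8 k9 k10 k11 k12 k13 k14 k15 k16 k17 k18 k19 k20 k21 k22.
lra.
Qed.

(** While consecutive weights have no ratio close to 1, the errors are only shown
to grow by a bounded factor. *)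
Lemma crude_arith (A1 C ph' P' b w vv g1 : R) : 0 <= A1 -> 0 <= C ->
  ph' <= C -> P' <= 2 * C -> b <= 2 * C -> w <= 18 * C -> vv <= C ->
  - (2 * g1) <= A1 * b + vv ->
  (ph' + P' + b) + (1 + 1) * (7 / 400 * b + 9 / 400 * w) +
    1 * (11 / 100 * b + 102 / 1000 * w) + 1 * (vv - 2 * g1 + A1 * b) + 0 +
    23 / 2000 * A1 * (b + w) <= (10 + 5 * A1) * C.
Proof.
move=> A0 C0 h1 h2 h3 h4 h5 h6.
have k1 := ler_wpM2l A0 h3; have k2 := ler_wpM2l A0 h4.
by have := mulr_ge0 A0 C0; lra.
Qed.

End Arithmetic.

Section Potential.
Context {R : realType} {d n : nat}.
Local Notation V := 'rV[R]_d.
Context (X : set V) (L : R) (f : 'I_n -> V -> R) (G grad : 'I_n -> V -> V).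
Hypothesis sp : smooth_problem X L f G.
Hypothesis tg : forall i u x y, X x -> X y ->
  dotv (grad i u) (x - y) = dotv (G i u) (x - y).
Local Notation F := (avgf f).
Local Notation GF := (avgg G).
Local Notation lam := (rate (n := n) L).
Local Notation gdev := (gdev L G).
Let lam0 : 0 < lam := rate_gt0 sp.
Variable xs : V.
Hypothesis Xxs : X xs.
Hypothesis xs_min : forall y, X y -> F xs <= F y.

Definition prox_gap (q p x : V) := prox_obj f lam q x - prox_obj f lam q p.

(** The usual potential, a weighted gap plus half the squared distance of [v] to
[xs], with two additions: the errors of the current iterate, and with coefficient
[cH] the inner product left over by [breg_prev_le]. *)
Definition pot (cF cH A : R) (x v p q : V) :=
  cF * (F p - F xs) + 1 / 2 * (lam * nsq (v - xs)) + cH * (lam * dotv (q - p) (p - v)) +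
  A * (21 / 10 * (lam * nsq (x - p)) + 4 / 25 * gdev x p + 4 / 25 * (lam * nsq (q - p)) +
    1 / 20 * prox_gap q p x).

Definition crude (x v p q : V) :=
  (F p - F xs) + lam * nsq (v - xs) + lam * nsq (p - xs) + lam * nsq (x - p) +
  lam * nsq (q - p) + gdev x p + prox_gap q p x.

Lemma lam_nsq_ge0 (u : V) : 0 <= lam * nsq u.
Proof. by rewrite mulr_ge0 ?nsq_ge0// ltW. Qed.

Lemma lam_young (c : R) (u w : V) : 0 < c ->
  lam * dotv u w <= c / 2 * (lam * nsq u) + (2 * c)^-1 * (lam * nsq w).
Proof.
move=> c0; have h := dotv_young u w c0.
have := ler_wpM2l (ltW lam0) h; rewrite mulrDr !(mulrCA lam); lra.
Qed.

Lemma prox_gap_ge0 q p x : X x -> is_prox X G lam q p -> 0 <= prox_gap q p x.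
Proof.
move=> Xx pP; rewrite /prox_gap subr_ge0.
by have := prox_obj_ge sp (ltW lam0) pP Xx.
Qed.

Section Step.
Variables (x v q p s p' : V) (a1 : R).
Hypothesis Xx : X x.
Hypothesis Xv : X v.
Hypothesis Xs : X s.
Hypothesis pP : is_prox X G lam q p.
Hypothesis p'P : is_prox X G lam s p'.
Hypothesis a1_ge1 : 1 <= a1.
Hypothesis sE : a1 ^+ 2 *: s = (a1 ^+ 2 - a1) *: x + a1 *: v.
Let Xp : X p := pP.1.
Let Xp' : X p' := p'P.1.
Let a10 : 0 < a1 := lt_le_trans ltr01 a1_ge1.
Let A_ge0 : 0 <= a1 ^+ 2 - a1.
Proof.
have -> : a1 ^+ 2 - a1 = a1 * (a1 - 1) by ring.
by rewrite mulr_ge0 ?subr_ge0// ltW.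
Qed.
Lemma pot_step_le (at0 h : R) : at0 ^+ 2 = a1 ^+ 2 - a1 -> 21 <= a1 ->
  0 <= at0 -> at0 <= a1 -> 0 <= h -> h <= 22 / 21 * a1 -> h * (a1 - 1) <= a1 * at0 ->
  expect grad (accel_step X L s x v a1) (fun r =>
    pot (17 / 20 * a1 ^+ 2 + 3 / 20 * (h * (a1 - 1))) (3 / 20 * h) (a1 ^+ 2) r.1 r.2 p' s)
  <= pot (17 / 20 * at0 ^+ 2 + 3 / 20 * (a1 * at0 - a1)) (3 / 20 * a1) (at0 ^+ 2) x v p q.
Proof.
move=> atE a21 at00 ata h0 ha hc.
have A10 : 0 <= a1 ^+ 2 by rewrite sqr_ge0.
have B1 : 0 <= 21 / 10 * a1 ^+ 2 by rewrite mulr_ge0//; lra.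
have B2 : 0 <= 4 / 25 * a1 ^+ 2 by rewrite mulr_ge0//; lra.
have B4 : 0 <= 1 / 20 * a1 ^+ 2 by rewrite mulr_ge0//; lra.
have BV : 0 <= 1 / 2 :> R by lra.
have BH : 0 <= 3 / 20 * h by rewrite mulr_ge0//; lra.
rewrite (_ : expect _ _ _ = expect grad (accel_step X L s x v a1) (fun r =>
  ((17 / 20 * a1 ^+ 2 + 3 / 20 * (h * (a1 - 1))) * (F p' - F xs) +
    4 / 25 * a1 ^+ 2 * (lam * nsq (s - p')) +
   (21 / 10 * a1 ^+ 2) * (lam * nsq (r.1 - p')) + (4 / 25 * a1 ^+ 2) * gdev r.1 p' +
      (1 / 20 * a1 ^+ 2) * (prox_obj f lam s r.1 - prox_obj f lam s p')) +
    (1 / 2 * (lam * nsq (r.2 - xs)) + (3 / 20 * h) * (lam * dotv (s - p') (p' - r.2))))); last first.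
  by apply: eq_expect; apply: always_true => r; rewrite /pot /prox_gap; ring.
apply: le_trans (accel_step_le sp tg Xx Xv Xs Xxs p'P a10 sE _ B1 B2 B4 BV BH) _.
have := @refined_arith _ (at0 ^+ 2) (a1 ^+ 2) a1 at0 h (h * (a1 - 1)) (F p - F xs)
  (F p' - F xs) (breg f G p p') (breg f G p' p) (lam * nsq (s - p')) (gdev x p')
  (lam * nsq (v - xs)) (lam * dotv (s - p') (v - xs)) (lam * dotv (s - p') (x - p'))
  (lam * dotv (s - p') (x - p)) (lam * dotv (q - p) (x - p)) (lam * dotv (q - p) (s - p'))
  (lam * dotv (q - p) (p - v)) (lam * nsq (x - p)) (gdev x p) (lam * nsq (q - p))
  (prox_gap q p x).
have e1 : at0 ^+ 2 = a1 * (a1 - 1) by rewrite atE; ring.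
have a1a : a1 ^+ 2 = a1 * a1 by rewrite expr2.
have k1 : a1 * at0 <= a1 * a1 by rewrite ler_pM2l.
have k2 : a1 * 21 <= a1 * a1 by rewrite ler_pM2l.
have k3 : h * a1 <= 22 / 21 * a1 * a1 by rewrite ler_wpM2r// ltW.
have k4 : 0 <= h * (a1 - 1) by rewrite mulr_ge0// subr_ge0.
have d1 := prox_value_step sp Xxs pP p'P a10 sE A_ge0.
have d2 := breg_prev_le f pP p'P sE.
rewrite -atE in d1 d2.
have d3 := gdev_next_le sp x pP p'P.
have d4 := dotv_prox_value f x pP p'P.
have p17 : 0 < 17 / 50 :> R by lra.
have y1 := lam_young (s - p') (x - p) p17.
have y2 := lam_young (- (q - p)) (x - p) ltr01.
have y3 := lam_young (q - p) (s - p') ltr01.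
have Q1 := lam_nsq_ge0 (s - p'); have Q2 := lam_nsq_ge0 (q - p); have Q3 := lam_nsq_ge0 (x - p).
rewrite nsqN dotvNl in y2.
have i1 : (2 * 1)^-1 = 1 / 2 :> R by lra.
have i2 : (2 * (17 / 50))^-1 = 25 / 17 :> R by lra.
rewrite ?i1 ?i2 in y1 y2 y3.
move=> h1; apply: le_trans (h1 _ _ _ _ _ _ _ _ _ _ _ _ _ _ _ _ _ _) => {h1}.
- by rewrite le_eqVlt; apply/orP; left; apply/eqP; ring.
- exact: sqr_ge0.
- by rewrite atE subrK.
- by rewrite atE a1a; lra.
- exact: ltW.
- by rewrite a1a.
- exact: h0.
- exact: k4.
- exact: hc.
- by rewrite a1a; lra.
- have t1 := breg_ge0 sp Xp Xp'; have t2 := breg_ge0 sp Xp' Xp.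
  have t3 := gdev_ge0 sp x p'; have t4 : 0 <= F p - F xs by rewrite subr_ge0 xs_min.
  by split.
- have t1 := gdev_ge0 sp x p.
  have t2 : 0 <= prox_gap q p x by exact: prox_gap_ge0.
  by split.
- exact: d1.
- by move: d2; lra.
- exact: d3.
- by lra.
- by lra.
- by lra.
- by lra.
Qed.

Lemma prox_next_crude : (F p' - F xs) + 1 / 2 * (lam * nsq (s - p')) +
    1 / 2 * (lam * nsq (p' - xs)) <= crude x v p q.
Proof.
have h1 := is_prox_strong sp p'P Xxs.
have h2 : nsq (s - xs) <= nsq (x - xs) + nsq (v - xs).
  have A0 : 0 < a1 ^+ 2 by rewrite exprn_gt0.
  rewrite -(ler_pM2l A0) -(ler_pM2l A0).
  have e : a1 ^+ 2 *: (s - xs) = (a1 ^+ 2 - a1) *: (x - xs) + a1 *: (v - xs).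
    by rewrite scalerBr sE; apply/rowP => i; rewrite !mxE; ring.
  have := congr1 (fun u => nsq u) e; rewrite /= !(dotvZl, dotvZr) => ->.
  have k1 := mulr_ge0 A_ge0 (ltW a10).
  have k2 := mulr_ge0 k1 (nsq_ge0 ((x - xs) - (v - xs))).
  move: k2 (nsq_ge0 (x - xs)) (nsq_ge0 (v - xs)).
  move: (x - xs) (v - xs) => u w; rewrite !dotvE (dotvC w u) => k2 u0 w0.
  have k3 := mulr_ge0 (mulr_ge0 (ltW A0) (ltW a10)) u0.
  have k4 := mulr_ge0 (mulr_ge0 (ltW A0) A_ge0) w0.
  by move: (a1 ^+ 2) k2 k3 k4 => A k2 k3 k4; lra.
have h3 := nsqD2_le (x - p) (p - xs); rewrite addrA subrK in h3.
have k2 := ler_wpM2l (ltW lam0) h2; have k3 := ler_wpM2l (ltW lam0) h3.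
have := subr_ge0 (F xs) (F p); rewrite xs_min// => kp.
have kg := gdev_ge0 sp x p; have kq := lam_nsq_ge0 (q - p).
have ke : 0 <= prox_gap q p x by exact: prox_gap_ge0.
have kx := lam_nsq_ge0 (x - p); have kxs := lam_nsq_ge0 (p - xs); have kv := lam_nsq_ge0 (v - xs).
rewrite /crude; move: h1 k2 k3; rewrite (nsqB xs s) (nsqB p' s) (nsqB xs p').
by lra.
Qed.

Lemma crude_ge0 : 0 <= crude x v p q.
Proof.
apply: le_trans prox_next_crude.
have := lam_nsq_ge0 (s - p'); have := lam_nsq_ge0 (p' - xs); have := xs_min Xp'; lra.
Qed.

Lemma crude_step_le : expect grad (accel_step X L s x v a1) (fun r => crude r.1 r.2 p' s)
  <= (10 + 5 * a1 ^+ 2) * crude x v p q.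
Proof.
have Z0 : 0 <= 0 :> R by []. have Z1 : 0 <= 1 :> R by [].
rewrite (_ : expect _ _ _ = expect grad (accel_step X L s x v a1) (fun r =>
  ((F p' - F xs) + lam * nsq (p' - xs) + lam * nsq (s - p') +
   1 * (lam * nsq (r.1 - p')) + 1 * gdev r.1 p' +
      1 * (prox_obj f lam s r.1 - prox_obj f lam s p')) +
    (1 * (lam * nsq (r.2 - xs)) + 0 * (lam * dotv (s - p') (p' - r.2))))); last first.
  by apply: eq_expect; apply: always_true => r; rewrite /crude /prox_gap; ring.
apply: le_trans (accel_step_le sp tg Xx Xv Xs Xxs p'P a10 sE _ Z1 Z1 Z1 Z1 Z0) _.
have C0 := crude_ge0; have hC := prox_next_crude.
have := subr_ge0 (F xs) (F p); rewrite xs_min// => kp.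
have := subr_ge0 (F xs) (F p'); rewrite xs_min// => kp'.
have kg := gdev_ge0 sp x p; have kq := lam_nsq_ge0 (q - p).
have ke : 0 <= prox_gap q p x by exact: prox_gap_ge0.
have kx := lam_nsq_ge0 (x - p); have kxs := lam_nsq_ge0 (p - xs); have kv := lam_nsq_ge0 (v - xs).
have kb := lam_nsq_ge0 (s - p'); have kp's := lam_nsq_ge0 (p' - xs).
set C := crude x v p q in C0 hC *.
have CE : C = crude x v p q by []; rewrite /crude in CE.
have hpp : lam * nsq (p - p') <= 2 * (lam * nsq (p - xs)) + 2 * (lam * nsq (p' - xs)).
  have := nsqD2_le (p - xs) (xs - p'); rewrite addrA subrK (nsqB xs) => h.
  by have := ler_wpM2l (ltW lam0) h; lra.
have hD : breg f G p p' <= 3 * C.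
  have h := is_prox_grad p'P Xp.
  have y := lam_young (- (s - p')) (p - p') ltr01; rewrite nsqN dotvNl in y.
  have i1 : (2 * 1)^-1 = 1 / 2 :> R by lra.
  by rewrite i1 in y; rewrite /breg; lra.
have hR : breg f G p' p <= 3 * C.
  have h := is_prox_grad pP Xp'.
  have y := lam_young (- (q - p)) (p' - p) ltr01; rewrite nsqN dotvNl (nsqB p') in y.
  have i1 : (2 * 1)^-1 = 1 / 2 :> R by lra.
  by rewrite i1 in y; rewrite /breg; lra.
have hw := gdev_next_le sp x pP p'P.
have i1 : (2 * 1)^-1 = 1 / 2 :> R by lra.
have y := lam_young (- (a1 *: (s - p'))) (v - xs) ltr01.
rewrite nsqN dotvNl !(dotvZl, dotvZr) i1 in y.
have y' : - (2 * (a1 * (lam * dotv (s - p') (v - xs)))) <=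
    a1 ^+ 2 * (lam * nsq (s - p')) + lam * nsq (v - xs).
  by rewrite expr2; lra.
have := @crude_arith _ (a1 ^+ 2) C (F p' - F xs) (lam * nsq (p' - xs)) (lam * nsq (s - p'))
  (gdev x p') (lam * nsq (v - xs)) (a1 * (lam * dotv (s - p') (v - xs))) (sqr_ge0 _) C0.
move=> h; apply: le_trans (h _ _ _ _ _ y') => {h}; lra.
Qed.

End Step.

End Potential.

(** * The accelerated method *)

Section PotentialBounds.
Context {R : realType} {d n : nat}.
Local Notation V := 'rV[R]_d.
Context (X : set V) (L : R) (f : 'I_n -> V -> R) (G grad : 'I_n -> V -> V).
Hypothesis sp : smooth_problem X L f G.
Local Notation F := (avgf f).
Local Notation GF := (avgg G).
Local Notation lam := (rate (n := n) L).
Local Notation gdev := (gdev L G).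
Let lam0 : 0 < lam := rate_gt0 sp.
Variable xs : V.
Hypothesis Xxs : X xs.
Hypothesis xs_min : forall y, X y -> F xs <= F y.

Section WithState.
Context {S : Type} (Q : S -> Prop).
Implicit Types u w a b : S -> V.
Local Notation inX u := (forall z, Q z -> X (u z)).

Lemma nsq_bounded_where u w : inX u -> inX w -> bounded_where Q (fun z => nsq (u z - w z)).
Proof.
have [D hD] := sp_bounded sp => Xu Xw.
apply: (@bounded_where_between _ _ _ _ 0 D) => z Qz.
by rewrite nsq_ge0 hD//; [exact: Xu|exact: Xw].
Qed.

Lemma dotv_bounded_where u w a b : inX u -> inX w -> inX a -> inX b ->
  bounded_where Q (fun z => dotv (u z - w z) (a z - b z)).
Proof.
have [D hD] := sp_bounded sp => Xu Xw Xa Xb.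
apply: (@bounded_where_between _ _ _ _ (- D) D) => z Qz.
have h1 := @dotv_young _ _ 1 (u z - w z) (a z - b z) ltr01.
have h2 := @dotv_young _ _ 1 (u z - w z) (- (a z - b z)) ltr01.
have h3 := hD _ _ (Xu _ Qz) (Xw _ Qz); have h4 := hD _ _ (Xa _ Qz) (Xb _ Qz).
by rewrite nsqN dotvNr in h2; apply/andP; split; lra.
Qed.

Lemma gdev_bounded_where u w : inX u -> inX w -> bounded_where Q (fun z => gdev (u z) (w z)).
Proof.
have [D hD] := sp_bounded sp => Xu Xw; have L0 := sp_L sp.
apply: (@bounded_where_between _ _ _ _ 0 (L * D)) => z Qz.
rewrite (gdev_ge0 sp)/= !gdevE ler_pdivrMr//.
apply: le_trans (gvar_le_nsq sp (Xu _ Qz) (Xw _ Qz)) _.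
have -> : L * D * L = L ^+ 2 * D by ring.
by rewrite ler_wpM2l ?sqr_ge0// hD//; [exact: Xu|exact: Xw].
Qed.

Lemma avgf_bounded_where u : inX u -> bounded_where Q (fun z => F (u z)).
Proof.
have [D hD] := sp_bounded sp => Xu.
apply: (@bounded_where_between _ _ _ _ (F xs)
  (F xs + (1 / 2 * nsq (GF xs) + (2 * 1)^-1 * D) + L / 2 * D)) => z Qz.
rewrite xs_min/=; last exact: Xu.
have Xz := Xu z Qz; have h1 := avgf_smooth sp Xxs Xz; have h3 := hD _ _ Xz Xxs.
have h2 := @dotv_young _ _ 1 (GF xs) (u z - xs) ltr01.
have L2 : 0 <= L / 2 by rewrite divr_ge0// ltW// (sp_L sp).
by have := ler_wpM2l L2 h3; lra.
Qed.

Variables x v p q : S -> V.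
Hypotheses (Xx : inX x) (Xv : inX v) (Xp : inX p) (Xq : inX q).
Let Xs : inX (fun=> xs). Proof. by []. Qed.

Lemma gapF_bounded_where : bounded_where Q (fun z => F (p z) - F xs).
Proof. by apply: bounded_whereD; [exact: avgf_bounded_where|exact: bounded_where_cst]. Qed.

Lemma prox_gap_bounded_where : bounded_where Q (fun z => prox_gap L f (q z) (p z) (x z)).
Proof.
have h1 : bounded_where Q (fun z => prox_obj f lam (q z) (x z)).
  apply: bounded_whereD; first exact: avgf_bounded_where.
  by apply: bounded_whereZ; exact: nsq_bounded_where.
have h2 : bounded_where Q (fun z => prox_obj f lam (q z) (p z)).
  apply: bounded_whereD; first exact: avgf_bounded_where.
  by apply: bounded_whereZ; exact: nsq_bounded_where.
have [M hM] := bounded_whereD h1 (bounded_whereZ (-1) h2).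
by exists M => z Qz; have := hM z Qz; rewrite mulN1r.
Qed.

Lemma crude_bounded_where :
  bounded_where Q (fun z => crude L f G xs (x z) (v z) (p z) (q z)).
Proof.
have h1 := gapF_bounded_where; have h2 := prox_gap_bounded_where.
apply: bounded_whereD => //; apply: bounded_whereD; last exact: gdev_bounded_where.
by do 4 (apply: bounded_whereD; last by apply: bounded_whereZ; exact: nsq_bounded_where).
Qed.

Lemma pot_bounded_where cF cH A :
  bounded_where Q (fun z => pot L f G xs cF cH A (x z) (v z) (p z) (q z)).
Proof.
have h1 := gapF_bounded_where; have h2 := prox_gap_bounded_where.
apply: bounded_whereD; last first.
  apply: bounded_whereZ; apply: bounded_whereD; last exact: bounded_whereZ.
  apply: bounded_whereD; last by do 2 apply: bounded_whereZ; exact: nsq_bounded_where.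
  apply: bounded_whereD; last by apply: bounded_whereZ; exact: gdev_bounded_where.
  by do 2 apply: bounded_whereZ; exact: nsq_bounded_where.
apply: bounded_whereD; last first.
  by do 2 apply: bounded_whereZ; exact: dotv_bounded_where.
apply: bounded_whereD; first exact: bounded_whereZ.
by do 2 apply: bounded_whereZ; exact: nsq_bounded_where.
Qed.

End WithState.

(** What the accelerated method makes small, apart from the distance to the
minimizer: the second term measures the variance of stochastic gradients that are
centred at [x]. *)
Definition merit x := F x - F xs + gdev x (prox X G lam x).

Definition center_merit x p q := F p - F xs + lam * nsq (x - p) + gdev x p +
  lam * nsq (q - p) + prox_gap L f q p x.

Section State.
Variables x v p q : V.
Hypotheses (Xx : X x) (Xv : X v) (pP : is_prox X G lam q p).
Let Xp : X p := pP.1.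
Let kF : 0 <= F p - F xs. Proof. by rewrite subr_ge0 xs_min. Qed.
Let kg := gdev_ge0 sp x p.
Let kq := lam_nsq_ge0 sp (q - p).
Let kx := lam_nsq_ge0 sp (x - p).
Let kxs := lam_nsq_ge0 sp (p - xs).
Let kv := lam_nsq_ge0 sp (v - xs).
Let ke := prox_gap_ge0 sp Xx pP.

Lemma merit_ge0 : 0 <= merit x.
Proof. by rewrite addr_ge0 ?(gdev_ge0 sp)// subr_ge0 xs_min. Qed.

Lemma center_merit_ge0 : 0 <= center_merit x p q.
Proof. by rewrite /center_merit; move: kF kg kq kx ke; lra. Qed.

Lemma center_merit_crude : center_merit x p q <= crude L f G xs x v p q.
Proof. by rewrite /center_merit /crude; move: kxs kv; lra. Qed.

Lemma pot_ge cF A : 0 <= A -> A / 20 <= cF ->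
  A / 20 * center_merit x p q <= pot L f G xs cF 0 A x v p q.
Proof.
move=> A0 cFA; rewrite /center_merit /pot mul0r addr0.
have h1 := ler_wpM2r kF cFA.
have := mulr_ge0 A0 kg; have := mulr_ge0 A0 kq; have := mulr_ge0 A0 kx; have := mulr_ge0 A0 ke.
by move: kv; lra.
Qed.

Lemma pot_le_crude cF cH A B : 0 <= cH -> 0 <= A -> cF <= B -> cH <= B -> A <= B ->
  1 <= B -> pot L f G xs cF cH A x v p q <= 3 * B * crude L f G xs x v p q.
Proof.
move=> cH0 A0 cFB cHB AB B1; rewrite /crude /pot.
have y := lam_young sp (q - p) (p - v) ltr01.
have hn : lam * nsq (p - v) <= 2 * (lam * nsq (p - xs)) + 2 * (lam * nsq (v - xs)).
  have := nsqD2_le (p - xs) (xs - v); rewrite addrA subrK (nsqB xs) => h.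
  by have := ler_wpM2l (ltW lam0) h; lra.
have i1 : (2 * 1)^-1 = 1 / 2 :> R by lra.
rewrite i1 in y.
have y' : lam * dotv (q - p) (p - v) <= 1 / 2 * (lam * nsq (q - p)) +
   lam * nsq (p - xs) + lam * nsq (v - xs) by lra.
have k1 := ler_wpM2l cH0 y'.
have k2 := ler_wpM2r kF cFB.
have nn : 0 <= 1 / 2 * (lam * nsq (q - p)) + lam * nsq (p - xs) + lam * nsq (v - xs).
  by move: kxs kq kv; lra.
have k3 := ler_wpM2r nn cHB.
have nn' : 0 <= 21 / 10 * (lam * nsq (x - p)) + 4 / 25 * gdev x p + 4 / 25 * (lam * nsq (q - p)) +
    1 / 20 * prox_gap L f q p x by move: kx kg kq ke; lra.
have k4 := ler_wpM2r nn' AB.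
have B0 : 0 <= B by lra.
have k5 := mulr_ge0 B0 kF; have k6 := mulr_ge0 B0 kg; have k7 := mulr_ge0 B0 kq.
have k8 := mulr_ge0 B0 kx; have k9 := mulr_ge0 B0 kxs; have k10 := mulr_ge0 B0 ke.
have k11 := ler_wpM2r kv B1.
by move: kv; lra.
Qed.

(** The merit of [x] refers to the proximal point of [x] itself and not to the
one that [x] approximates. The two differ at most by the errors of [x]. *)
Lemma merit_le_center : merit x <= 3 * center_merit x p q.
Proof.
have p1P := prox_is_prox sp Xx x (ltW lam0).
rewrite /merit; move: (prox X G lam x) p1P => p1 p1P.
have h1 := gdev_next_le sp x pP p1P.
have h2 := is_prox_grad p1P Xp; have h3 := is_prox_grad pP p1P.1.
have h4 : breg f G p p1 + breg f G p1 p <= 1 / 2 * (lam * nsq (q - p)) + 1 / 2 * (lam * nsq (x - p)).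
  have e : breg f G p p1 + breg f G p1 p = - dotv (GF p1) (p - p1) - dotv (GF p) (p1 - p).
    by rewrite /breg; ring.
  rewrite e.
  apply: (@le_trans _ _ (- (lam * dotv (x - p1) (p - p1)) - lam * dotv (q - p) (p1 - p))).
    by lra.
  have := lam_nsq_ge0 sp (((q - p) - (x - p)) - 2 *: (p - p1)).
  have := lam_nsq_ge0 sp ((q - p) + (x - p)).
  have -> : x - p1 = (x - p) + (p - p1) by rewrite addrA subrK.
  rewrite -(opprB p p1); move: (q - p) (x - p) (p - p1) => a b c.
  rewrite !dotvE (dotvC b a) (dotvC c a) (dotvC c b) => k1 k2.
  by lra.
have h5 : F x - F xs <= F p - F xs + prox_gap L f q p x + 1 / 2 * (lam * nsq (q - p)).
  have := lam_nsq_ge0 sp (x - q); rewrite /prox_gap /prox_obj (nsqB p q); lra.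
rewrite /center_merit; move: kF kg kq kx ke; lra.
Qed.

End State.

Lemma crude_init x : X x -> crude L f G xs x x (prox X G lam x) x <=
  6 * (merit x + lam * nsq (x - xs)).
Proof.
move=> Xx; have pP := prox_is_prox sp Xx x (ltW lam0).
rewrite /merit /crude; move: (prox X G lam x) pP => p pP.
have h1 := is_prox_strong sp pP Xx; rewrite subrr dotv0l in h1.
have h2 := nsqD2_le (p - x) (x - xs); rewrite addrA subrK (nsqB p x) in h2.
have {}h2 := ler_wpM2l (ltW lam0) h2.
have h3 := xs_min pP.1; have h4 := gdev_ge0 sp x p; have h5 := lam_nsq_ge0 sp (x - xs).
have h6 : prox_gap L f x p x = F x - F p - lam / 2 * nsq (x - p).
  by rewrite /prox_gap /prox_obj subrr dotv0l (nsqB p x); ring.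
have := lam_nsq_ge0 sp (x - p); rewrite h6; rewrite (nsqB p x) in h1; lra.
Qed.

End PotentialBounds.

(** The constant comes from the first forty iterations, after which the momentum
parameters vary slowly enough for the potential to decrease. *)
Definition accel_const (R : realType) : R :=
  3 * (80 * (3 * 42 ^+ 2) * (10 + 5 * 41 ^+ 2) ^+ 40) * 6.

Section Loop.
Context {R : realType} {d n : nat}.
Local Notation V := 'rV[R]_d.
Context (X : set V) (L : R) (f : 'I_n -> V -> R) (G grad : 'I_n -> V -> V).
Hypothesis sp : smooth_problem X L f G.
Hypothesis tg : forall i u x y, X x -> X y ->
  dotv (grad i u) (x - y) = dotv (G i u) (x - y).
Local Notation F := (avgf f).
Local Notation lam := (rate (n := n) L).
Let n0 := sp_n sp.
Let lam0 : 0 < lam := rate_gt0 sp.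
Variables xs x0 : V.
Hypothesis Xxs : X xs.
Hypothesis xs_min : forall y, X y -> F xs <= F y.
Hypothesis Xx0 : X x0.
Local Notation a := (@momentum R).

(* The state of the method, the exact proximal point approximated by the current
iterate, and the centre of that proximal point. *)
Let state := ((V * V * R) * (V * V))%type.

(* The exact proximal points are not computed by the method; the loop that
records them has the same law. *)
Let ghost_body (_ : nat) (z : state) : prog V n state :=
  let x := z.1.1.1 in
  let v := z.1.1.2 in
  let alpha := next_alpha z.1.2 in
  let s := (1 - alpha) *: x + alpha *: v in
  let* r := accel_step X L s x v alpha^-1 in Ret ((r, alpha), (prox X G lam s, s)).

Let z0 : state := ((x0, x0, 1), (prox X G lam x0, x0)).

Let body (_ : nat) (st : V * V * R) : prog V n (V * V * R) :=
  let x := st.1.1 in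
  let v := st.1.2 in
  let alpha := next_alpha st.2 in
  let s := (1 - alpha) *: x + alpha *: v in
  let* x' := approx_prox X L lam s s x in
  let* xt := unbiased_prox X L lam s x in
  let v' := proj X (v - alpha^-1 *: (s - xt)) in
  Ret (x', v', alpha).

Let ghost_simulates t z (h : _ -> R) :
  expect grad (ghost_body t z) (h \o fst) = expect grad (body t z.1) h.
Proof.
case: z => -[[x v] al] [p q]; rewrite /ghost_body /body /accel_step /=.
rewrite [LHS]expect_bind [LHS]expect_bind [RHS]expect_bind.
apply: eq_expect; apply: always_true => x' /=.
by rewrite [LHS]expect_bind [RHS]expect_bind.
Qed.

Let Inv (t : nat) (z : state) := [/\ X z.1.1.1, X z.1.1.2,
  z.1.2 = iter t next_alpha 1, X z.2.2 & is_prox X G lam z.2.2 z.2.1].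

Let Inv0 : Inv 0 z0.
Proof. by split=> //; exact: (prox_is_prox sp Xx0 x0 (ltW lam0)). Qed.

Section Pass.
Variables (t : nat) (x v : V).
Hypotheses (Xx : X x) (Xv : X v).
Let al := next_alpha (iter t next_alpha (1 : R)).
Let s := (1 - al) *: x + al *: v.

Let a1 : R := a t.+1.
Let al1 : al = a1^-1. Proof. by rewrite /a1 /momentum invrK. Qed.
Let a1_gt0 : 0 < a1. Proof. exact: lt_le_trans ltr01 (momentum_ge1 _). Qed.

Lemma pass_center : a t.+1 ^+ 2 *: s = (a t.+1 ^+ 2 - a t.+1) *: x + a t.+1 *: v.
Proof.
rewrite /s al1 -/a1 scalerDr !scalerA mulrBr mulr1 expr2 mulfK ?gt_eqF//.
Qed.

Lemma pass_center_in : X s.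
Proof.
have -> : s = al *: v + (1 - al) *: x by rewrite addrC.
have h1 := @momentum_ge1 R t.+1.
apply: (sp_convex sp) => //; rewrite al1; first by rewrite invr_ge0 ltW.
by rewrite invf_le1.
Qed.

End Pass.

Let ghost_inv t z : Inv t z -> always grad (ghost_body t z) (Inv t.+1).
Proof.
case: z => -[[x v] al] [p q] [/= Xx Xv -> Xq pP].
have Xs := pass_center_in t Xx Xv.
apply: always_bind; apply: always_sub (always_accel_step grad sp v _ Xx Xs) => r [X1 X2] /=.
by split=> //; exact: (prox_is_prox sp Xx0 _ (ltW lam0)).
Qed.

Let always_inv t : always grad (forM t ghost_body z0) (Inv t).
Proof. by apply: always_forM => // t' z _; exact: ghost_inv. Qed.

Let E t (h : state -> R) := expect grad (forM t ghost_body z0) h.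

Let E_step t h h' : bounded_where (Inv t) h' -> bounded_where (Inv t.+1) h ->
  (forall z, Inv t z -> expect grad (ghost_body t z) h <= h' z) -> E t.+1 h <= E t h'.
Proof.
move=> [M' bh'] [M bh] hh; rewrite /E /= expect_bind; apply: expect_le => //.
- by apply: always_sub (always_inv t) => z; exact: hh.
- exists M; apply: always_sub (always_inv t) => z /ghost_inv h1.
  by apply: expect_norm_le => //; apply: always_sub h1 => z'; exact: bh.
- by exists M'; apply: always_sub (always_inv t) => z; exact: bh'.
Qed.

Let Pot cF cH A (z : state) := pot L f G xs cF cH A z.1.1.1 z.1.1.2 z.2.1 z.2.2.
Let Crude (z : state) := crude L f G xs z.1.1.1 z.1.1.2 z.2.1 z.2.2.

Let Pot_bounded t cF cH A : bounded_where (Inv t) (Pot cF cH A).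
Proof. by apply: (pot_bounded_where sp Xxs xs_min) => z [? ? ? ? []]. Qed.

Let Crude_bounded t : bounded_where (Inv t) Crude.
Proof. by apply: (crude_bounded_where sp Xxs xs_min) => z [? ? ? ? []]. Qed.

Let Pot_step t h : (40 <= t)%N -> 0 <= h -> h <= a t.+2 ->
  E t.+1 (Pot (17 / 20 * a t.+1 ^+ 2 + 3 / 20 * (h * (a t.+1 - 1))) (3 / 20 * h) (a t.+1 ^+ 2)) <=
  E t (Pot (17 / 20 * a t ^+ 2 + 3 / 20 * (a t.+1 * a t - a t.+1)) (3 / 20 * a t.+1) (a t ^+ 2)).
Proof.
move=> t40 h0 ha; apply: E_step; [exact: Pot_bounded|exact: Pot_bounded|].
case=> -[[x v] al] [p q] [/= Xx Xv -> Xq pP].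
have Xs := pass_center_in t Xx Xv.
have sE := pass_center t x v.
have b1 := @momentum_lower R t; have [b2 b3] := @momentum_incr R t.
have [b4 b5] := @momentum_incr R t.+1; have b6 := @momentum_ge1 R t.+1.
have b7 := @momentum_telescope R t.
have t40R : (40 : R) <= t%:R by rewrite ler_nat.
rewrite expect_bind /= /Pot /=.
have p'P := prox_is_prox sp Xx0 ((1 - next_alpha (iter t next_alpha 1)) *: x +
  next_alpha (iter t next_alpha 1) *: v) (ltW lam0).
have := pot_step_le sp tg Xxs xs_min Xx Xv Xs pP p'P b6 sE
  (at0 := a t) (h := h).
apply; [by rewrite momentumS|lra|lra|lra|by []| |].
- by lra.
- by apply: le_trans b7; rewrite ler_wpM2r// subr_ge0.
Qed.

Let K0 : R := 10 + 5 * 41 ^+ 2.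
Let K0_ge1 : 1 <= K0. Proof. by rewrite /K0; have := sqr_ge0 (41 : R); lra. Qed.

Let Crude_step t : (t < 40)%N -> E t.+1 Crude <= K0 * E t Crude.
Proof.
move=> t40; have [M hM] := Crude_bounded t.
have -> : K0 * E t Crude = E t (fun z => K0 * Crude z).
  by rewrite /E expectZ//; exists M; apply: always_sub (always_inv t) => z; exact: hM.
apply: E_step; [by apply: bounded_whereZ; exists M|exact: Crude_bounded|].
case=> -[[x v] al] [p q] [/= Xx Xv -> Xq pP].
have Xs := pass_center_in t Xx Xv.
have sE := pass_center t x v.
rewrite expect_bind /= /Crude /=.
have p'P := prox_is_prox sp Xx0 ((1 - next_alpha (iter t next_alpha 1)) *: x +
  next_alpha (iter t next_alpha 1) *: v) (ltW lam0).
have b6 := @momentum_ge1 R t.+1.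
apply: le_trans (crude_step_le sp tg Xxs xs_min Xx Xv Xs pP p'P b6 sE) _.
apply: ler_wpM2r; first exact: (crude_ge0 sp Xxs xs_min Xx pP p'P b6 sE).
rewrite /K0 lerD2l ler_wpM2l// ler_pXn2r// ?nnegrE//; last by lra.
apply: le_trans (@momentum_upper R t.+1) _.
by rewrite nat1r ler_nat.
Qed.

Let C0 := crude L f G xs x0 x0 (prox X G lam x0) x0.
Let B : R := 42 ^+ 2.
Let B_ge1 : 1 <= B. Proof. by apply: exprn_ege1; rewrite ler1n. Qed.

Let E_ge0 t h : (forall z, Inv t z -> 0 <= h z) -> bounded_where (Inv t) h -> 0 <= E t h.
Proof.
move=> h0 [M hM]; rewrite -(expect_cst grad n0 (forM t ghost_body z0) 0).
apply: expect_le => //; first by apply: always_sub (always_inv t) => z; exact: h0.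
  by exists 0; apply: always_true => z; rewrite normr0.
by exists M; apply: always_sub (always_inv t) => z; exact: hM.
Qed.

Let E_le t h h' : bounded_where (Inv t) h -> bounded_where (Inv t) h' ->
  (forall z, Inv t z -> h z <= h' z) -> E t h <= E t h'.
Proof.
move=> [M hM] [M' hM'] hh; apply: expect_le => //.
- by apply: always_sub (always_inv t) => z; exact: hh.
- by exists M; apply: always_sub (always_inv t) => z; exact: hM.
- by exists M'; apply: always_sub (always_inv t) => z; exact: hM'.
Qed.

Let EZ t c h : bounded_where (Inv t) h -> E t (fun z => c * h z) = c * E t h.
Proof.
by move=> [M hM]; apply: expectZ => //; exists M; apply: always_sub (always_inv t) => z; exact: hM.
Qed.

Let early t : (t <= 40)%N -> E t Crude <= K0 ^+ t * C0.
Proof.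
elim: t => [|t IH] t40; first by rewrite expr0 mul1r /E /= lexx.
apply: le_trans (Crude_step t40) _; rewrite exprS -mulrA ler_wpM2l//.
  exact: le_trans ler01 K0_ge1.
by apply: IH; exact: ltnW.
Qed.

Let C0_ge0 : 0 <= C0.
Proof.
have pP := prox_is_prox sp Xx0 x0 (ltW lam0).
apply: le_trans (center_merit_ge0 sp xs_min Xx0 pP) _.
exact: (center_merit_crude sp xs x0 x0 _ x0).
Qed.

Let middle N : N = 40%N -> E N (Pot (17 / 20 * a N ^+ 2 +
    3 / 20 * (a N.+1 * a N - a N.+1)) (3 / 20 * a N.+1) (a N ^+ 2)) <= 3 * B * (K0 ^+ N * C0).
Proof.
move=> NE; have b1 := @momentum_ge1 R N; have [b2 b3] := @momentum_incr R N.
have b4 := @momentum_upper R N; have NR : N%:R = 40 :> R by rewrite NE.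
rewrite NR in b4; have N40 : (N <= 40)%N by rewrite NE.
move: (a N) (a N.+1) b1 b2 b3 b4 => u w b1 b2 b3 b4 {NE NR}.
have b5 : u <= 41 by lra.
have b6 : w <= 42 by lra.
have u0 : 0 <= u by lra.
have w0 : 0 <= w by lra.
apply: le_trans (_ : _ <= E N (fun z => 3 * B * Crude z)) _; last first.
  rewrite EZ; last exact: Crude_bounded.
  by rewrite ler_wpM2l//; [rewrite mulr_ge0// (le_trans ler01 B_ge1)|exact: early].
apply: E_le; [exact: Pot_bounded|by apply: bounded_whereZ; exact: Crude_bounded|].
case=> -[[x v] al] [p q] [/= Xx Xv _ Xq pP].
have uw : w * u <= B by rewrite /B expr2; apply: ler_pM => //; lra.
have uu : u ^+ 2 <= B by rewrite /B !expr2; apply: ler_pM => //; lra.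
have wB : w <= B by rewrite /B expr2; lra.
have B1 := B_ge1; move: uw uu wB B1; move: B => B' uw uu wB B1.
apply: (pot_le_crude sp xs_min v Xx pP) => //.
- by rewrite mulr_ge0//; lra.
- exact: sqr_ge0.
- by have := sqr_ge0 u; lra.
- by lra.
Qed.

Let late N t : N = 40%N -> E (N + t) (Pot (17 / 20 * a (N + t) ^+ 2 +
    3 / 20 * (a (N + t).+1 * a (N + t) - a (N + t).+1)) (3 / 20 * a (N + t).+1) (a (N + t) ^+ 2))
  <= 3 * B * (K0 ^+ N * C0).
Proof.
move=> NE; elim: t => [|t IH]; first by rewrite addn0; exact: middle.
have Nt : (40 <= N + t)%N by rewrite -NE leq_addr.
rewrite addnS; apply: le_trans IH.
have := @Pot_step (N + t) (a (N + t).+2) Nt.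
rewrite mulrBr mulr1; apply; last exact: lexx.
exact: le_trans ler01 (momentum_ge1 _).
Qed.

Let Merit (z : state) := center_merit L f G xs z.1.1.1 z.2.1 z.2.2.

Let Merit_bounded t : bounded_where (Inv t) Merit.
Proof.
have [M hM] := Crude_bounded t; exists M => z Iz; apply: le_trans (hM z Iz).
case: z Iz => -[[x v] al] [p q] [/= Xx Xv _ Xq pP].
have m0 := center_merit_ge0 sp xs_min Xx pP.
have mc := center_merit_crude sp xs x v p q.
by rewrite !ger0_norm//; exact: le_trans mc.
Qed.

Let Merit_le T : T%:R ^+ 2 * E T Merit <= 80 * (3 * B) * (K0 ^+ 40 * C0).
Proof.
have B0 : 0 <= B := le_trans ler01 B_ge1.
have K40 : 0 <= K0 ^+ 40 * C0 by rewrite mulr_ge0// exprn_ge0// (le_trans ler01 K0_ge1).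
have [T40|] := leqP T 40.
  have h1 : E T Merit <= K0 ^+ T * C0.
    apply: le_trans (early T40); apply: E_le; [exact: Merit_bounded|exact: Crude_bounded|].
    by case=> -[[x v] al] [p q] _; exact: (center_merit_crude sp).
  have h2 : K0 ^+ T * C0 <= K0 ^+ 40 * C0.
    by rewrite ler_wpM2r//; apply: ler_weXn2l.
  have h3 : T%:R ^+ 2 <= B.
    rewrite /B ler_pXn2r ?nnegrE//.
    by rewrite ler_nat; apply: leq_trans T40 _.
  apply: (@le_trans _ _ (B * (K0 ^+ 40 * C0))).
    apply: (@le_trans _ _ (T%:R ^+ 2 * (K0 ^+ 40 * C0))); last by rewrite ler_wpM2r.
    by rewrite ler_wpM2l ?sqr_ge0//; exact: le_trans h1 h2.
  by rewrite ler_wpM2r//; lra.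
case: T => // T; rewrite ltnS => T40.
have hl := @late 40 (T - 40) erefl; rewrite subnKC// in hl.
have hs := @Pot_step T 0 T40 (lexx _) (le_trans ler01 (momentum_ge1 _)).
have {hl}hs := le_trans hs hl; rewrite !(mul0r, mulr0) addr0 in hs.
set A := a T.+1 ^+ 2 in hs.
have A0 : 0 <= A by exact: sqr_ge0.
have hA : T.+1%:R ^+ 2 / 4 <= A.
  have b1 := @momentum_lower R T.+1.
  have -> : T.+1%:R ^+ 2 / 4 = (T.+1%:R / 2) ^+ 2 :> R by field.
  have t0 : 0 <= T.+1%:R / 2 :> R by rewrite divr_ge0.
  rewrite ler_pXn2r// ?nnegrE//; lra.
have hm : A / 20 * E T.+1 Merit <= 3 * B * (K0 ^+ 40 * C0).
  rewrite -EZ; last exact: Merit_bounded.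
  apply: le_trans hs; apply: E_le; [by apply: bounded_whereZ; exact: Merit_bounded|exact: Pot_bounded|].
  case=> -[[x v] al] [p q] [/= Xx Xv _ Xq pP].
  by apply: (pot_ge sp xs_min v Xx pP) => //; lra.
have m0 : 0 <= E T.+1 Merit.
  apply: E_ge0; last exact: Merit_bounded.
  case=> -[[x v] al] [p q] [/= Xx Xv _ Xq pP].
  exact: (center_merit_ge0 sp xs_min Xx pP).
have := ler_wpM2r m0 hA; move: hm; set W := 3 * B * _.
have -> : 80 * (3 * B) * (K0 ^+ 40 * C0) = 80 * W by rewrite /W; ring.
by move: (E _ _) (T.+1%:R ^+ 2) => m u; lra.
Qed.

Lemma always_recapp_iters T : always grad (recapp_iters X L lam T x0) X.
Proof.
apply: always_bind.
pose I2 (t : nat) (st : V * V * R) := [/\ X st.1.1, X st.1.2 & st.2 = iter t next_alpha 1].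
have : always grad (forM T body (x0, x0, 1)) (I2 T).
  apply: always_forM => // t [[x v] al] _ [/= Xx Xv ->].
  have Xs := pass_center_in t Xx Xv.
  apply: always_bind; apply: always_sub (always_approx_prox grad sp _ x Xs) => x' Xx'.
  by apply: always_bind; apply: always_true => xt /=; split=> //; exact: (proj_in sp Xx).
by apply: always_sub => st [h _ _].
Qed.

(** The rate of the accelerated method, in expectation and for the merit of the
last iterate. *)
Lemma recapp_iters_le T :
  T%:R ^+ 2 * expect grad (recapp_iters X L lam T x0) (merit X L f G xs)
  <= accel_const R * (merit X L f G xs x0 + lam * nsq (x0 - xs)).
Proof.
have -> : expect grad (recapp_iters X L lam T x0) (merit X L f G xs) =
    E T (fun z => merit X L f G xs z.1.1.1).
  rewrite expect_bind -/body.
  rewrite -[LHS](@expect_forM_sim _ _ _ grad _ _ fst ghost_body T body z0 _ (fun st => merit X L f G xs st.1.1)) //.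
have bm : bounded_where (Inv T) (fun z => merit X L f G xs z.1.1.1).
  have [M hM] := bounded_whereZ 3 (Merit_bounded T); exists M => z Iz.
  apply: le_trans (hM z Iz); case: z Iz => -[[x v] al] [p q] [/= Xx Xv _ Xq pP].
  have m1 := merit_le_center sp xs_min Xx pP.
  have m0 := merit_ge0 sp xs_min Xx.
  by rewrite !ger0_norm//; exact: le_trans m1.
have h1 : E T (fun z => merit X L f G xs z.1.1.1) <= 3 * E T Merit.
  rewrite -EZ; last exact: Merit_bounded.
  apply: E_le => //; first by apply: bounded_whereZ; exact: Merit_bounded.
  case=> -[[x v] al] [p q] [/= Xx Xv _ Xq pP]; exact: (merit_le_center sp xs_min Xx pP).
have h2 := Merit_le T; have h3 := crude_init sp xs_min Xx0.
have T0 : 0 <= T%:R ^+ 2 :> R by exact: sqr_ge0.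
have h4 := ler_wpM2l T0 h1; rewrite -/C0 in h3.
have W0 : 0 <= 80 * (3 * B) * K0 ^+ 40.
  apply: mulr_ge0; last by rewrite exprn_ge0// (le_trans ler01 K0_ge1).
  by have := B_ge1; move: B => B' B1; lra.
rewrite mulrA in h2; rewrite /accel_const -/B -/K0.
move: (80 * (3 * B) * K0 ^+ 40) W0 h2 => W W0 h2.
have h5 := ler_wpM2l W0 h3.
move: h2 h4 h5; move: (E T (fun z => merit X L f G xs z.1.1.1)) (E T Merit) (T%:R ^+ 2) (merit _ _ _ _ _ _ + _) => e1 e2 u m.
by move: C0 => c0; lra.
Qed.

End Loop.

(** * The warm start *)

Section Warm.
Context {R : realType} {d n : nat}.
Local Notation V := 'rV[R]_d.
Context (X : set V) (L : R) (f : 'I_n -> V -> R) (G grad : 'I_n -> V -> V).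
Hypothesis sp : smooth_problem X L f G.
Hypothesis tg : forall i u x y, X x -> X y ->
  dotv (grad i u) (x - y) = dotv (G i u) (x - y).
Local Notation F := (avgf f).
Local Notation GF := (avgg G).
Local Notation lam := (rate (n := n) L).
Local Notation gdev := (gdev L G).
Let n0 := sp_n sp.
Let L0 := sp_L sp.
Let lam0 : 0 < lam := rate_gt0 sp.
Let nR0 : 0 < n%:R :> R. Proof. by rewrite ltr0n. Qed.
Variables (xs : V) (D2 : R).
Hypothesis xsP : is_prox X G 0 xs xs.
Hypothesis hD : forall x y, X x -> X y -> nsq (x - y) <= D2.
Let Xxs : X xs := xsP.1.

Lemma prox0_min y : X y -> F xs <= F y.
Proof. by move=> Xy; have := is_prox_le sp xsP Xy; rewrite mul0r addr0. Qed.

(** The factor by which the error after [k] epochs exceeds its target. Every epoch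
replaces it by its square root. *)
Definition excess k : R := n%:R `^ (2 ^- k).
Local Notation nu := excess.

Lemma excess_ge1 k : 1 <= nu k.
Proof.
rewrite -[leLHS](powRr0 n%:R) ler_powR ?ler1n//.
Qed.

Lemma excess_sqr k : nu k.+1 ^+ 2 = nu k.
Proof.
rewrite -powR_mulrn ?powR_ge0// -powRrM.
have -> : 2 ^- k.+1 * 2 = 2 ^- k :> R by rewrite exprS invfM mulrAC mulVf// mul1r.
by [].
Qed.

Lemma excess0 : nu 0 = n%:R.
Proof. by rewrite /excess expr0 invr1 powRr1// ler0n. Qed.

Lemma warm_epochs_excess : nu (@warm_epochs n) <= 2.
Proof.
set K := @warm_epochs n.
have h1 : (n <= 2 ^ (2 ^ K))%N.
  have e2 : (1 < 2)%N by [].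
  apply: leq_trans (up_logP n e2) _; rewrite leq_exp2l//.
  apply: leq_trans (up_logP (up_log 2 n) e2) _; rewrite leq_exp2l//.
  exact: leq_maxr.
have -> : 2 = (2 ^+ (2 ^ K)) `^ (2 ^- K) :> R.
  rewrite -powR_mulrn// -powRrM natrX mulfV ?powRr1//.
have r0 : 0 <= 2 ^- K :> R by rewrite invr_ge0 exprn_ge0.
apply: (ge0_ler_powR r0); rewrite ?nnegrE ?ler0n ?exprn_ge0//.
by rewrite -natrX ler_nat.
Qed.

Section Step.
Variables (x : V) (k : nat).
Hypothesis Xx : X x.
Let eta := warm_eta (n := n) L k.
Let q : prog V n V := one_epoch_svrg X (query (n := n)) x x eta (32 * n).
Let nu1 := excess_ge1 k.+1.

Let etaE : eta = (8 * L * nu k.+1)^-1. Proof. by []. Qed.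
Let eta0 : 0 < eta.
Proof. by rewrite etaE invr_gt0 !mulr_gt0// (lt_le_trans ltr01). Qed.

Let N32 : (32 * n)%N = (32 * n).-1.+1. Proof. by rewrite prednK// muln_gt0. Qed.

Lemma geomfree_warm_step : geomfree grad q.
Proof. exact: geomfree_one_epoch. Qed.

Let queryP i y : always grad (query i y) (fun v => v = grad i y).
Proof. by []. Qed.

Lemma always_warm_step : always grad q X.
Proof. by rewrite /q N32; exact: (always_one_epoch sp _ _ Xx queryP). Qed.

(** The constants make the invariant [gdev <= 7 * lam * D2 * excess] of the loop
reproduce itself, as 5/2 + 7 * 16/25 <= 7. *)
Lemma warm_step_le : let E h := expect grad q h in
  E (fun y => gdev y xs) <= 5 / 2 * (lam * nu k.+1 * D2) + 16 / 25 * (gdev x xs / nu k.+1) /\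
  E (fun y => F y - F xs) <= 1 / 2 * (lam * nu k.+1 * D2) + 1 / 2 * (gdev x xs / nu k.+1).
Proof.
move=> E.
have c10 : 0 < 8 / 7 :> R by lra.
have hc1 : 1 <= 8 / 7 * (1 - eta * (L + 0)).
  have : eta * L <= 1 / 8.
    have -> : eta * L = (8 * nu k.+1)^-1 by rewrite etaE; field; rewrite !gt_eqF// (lt_le_trans ltr01).
    by have n1 := nu1; rewrite mul1r lef_pV2 ?posrE; lra.
  by rewrite addr0; lra.
have k2 : 0 < 2 :> R by []. have m4 : 0 < 4 :> R by [].
have [S [M [h1 h2 h3 h4 h5]]] := one_epoch_bounds sp x (lexx 0) eta0 c10 hc1 xsP tg
  (gam := grad) (fun i x => esym (etrans (congr1 _ (scale0r _)) (addr0 _))) Xx queryP (32 * n).-1 k2 m4.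
rewrite -N32 -/q -/(E _) natrM in h1 h2 h3 h4 h5.
have nu0 : 0 < nu k.+1 := lt_le_trans ltr01 nu1.
have gf : geomfree grad q by exact: geomfree_warm_step.
have Ele h h' : (forall y, X y -> h y <= h' y) -> E h <= E h'.
  move=> hh; apply: expect_le => //; try exact: geomfree_bounded.
  by apply: always_sub always_warm_step => y; exact: hh.
have EC c : E (fun=> c) = c by exact: expect_cst.
have S0 : 0 <= S.
  apply: le_trans h1; rewrite -[leLHS]EC; apply: Ele => y Xy.
  by rewrite subr_ge0; exact: (prox_obj_ge sp (lexx 0) xsP Xy).
have hF : E (fun y => F y - F xs) <= S.
  apply: le_trans h1; apply: Ele => y Xy.
  by rewrite /prox_obj !mul0r !addr0.
have hG : E (fun y => gdev y xs) <= 2 * (M + S).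
  have -> : E (fun y => gdev y xs) = L^-1 * E (fun y => gvar G y xs).
    rewrite /E -expectZ//; last exact: geomfree_bounded.
    by apply: eq_expect; apply: always_true => y; rewrite mulrC.
  by rewrite ler_pdivrMl// mulrA (mulrC L).
have hE : E (fun y => nsq (y - xs)) <= D2.
  by rewrite -(EC D2); apply: Ele => y Xy; exact: hD.
have g0 : gvar G x x = 0.
  by apply/eqP; rewrite eq_le gvar_ge0 andbT (le_trans (gvar_le_nsq sp Xx Xx))// subrr dotv0l mulr0.
have gw : gvar G xs x = L * gdev x xs.
  by rewrite !gdevE gvarC mulrCA mulfV ?mulr1// gt_eqF.
have w0 := gdev_ge0 sp x xs.
rewrite g0 mulr0 addr0 gw in h4 h5.
have hx := hD Xx Xxs.
set u := lam * nu k.+1 * D2; set r := gdev x xs / nu k.+1.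
have c0 : 0 <= lam * nu k.+1 / 8 by rewrite divr_ge0// mulr_ge0// ltW.
have Sn : S / nu k.+1 <= S by rewrite ler_pdivrMr// ler_peMr.
have e1 T' : lam * nu k.+1 / 8 * (2 * eta * (32 * n%:R) * T') = T'.
  by rewrite etaE /rate; field; rewrite !gt_eqF.
have e2 c : lam * nu k.+1 / 8 * (c * eta ^+ 2 *
    (32 * n%:R * ((1 + 2) * L * S + (1 + 2^-1) * (L * gdev x xs)))) =
    c / 16 * (3 * (S / nu k.+1) + 3 / 2 * r).
  by rewrite etaE /rate /r; field; rewrite !gt_eqF.
have h4' : S <= u / 8 + 8 / 7 / 16 * (3 * (S / nu k.+1) + 3 / 2 * r).
  have := ler_wpM2l c0 (le_trans h4 (lerD hx (lexx _))).
  by rewrite e1 mulrDr e2 /u; lra.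
have h5' : M <= u + (8 / 7 + 4^-1) / 16 * (3 * (S / nu k.+1) + 3 / 2 * r).
  have h6 : 2 * nsq (x - xs) + (2 + 4) * E (fun y => nsq (y - xs)) <= 8 * D2 by lra.
  have := ler_wpM2l c0 (le_trans h5 (lerD h6 (lexx _))).
  by rewrite e1 mulrDr e2 /u; lra.
have r0 : 0 <= r by rewrite divr_ge0// ltW.
have u0 : 0 <= u.
  apply: mulr_ge0; first by apply: mulr_ge0; exact: ltW.
  exact: le_trans (nsq_ge0 _) hx.
split; first by apply: le_trans hG _; lra.
by apply: le_trans hF _; lra.
Qed.

End Step.

Let run (k : nat) x0 : prog V n V := forM k
  (fun k x => one_epoch_svrg X (query (n := n)) x x (warm_eta (n := n) L k) (32 * n)) x0.

Let run_geomfree k x0 : geomfree grad (run k x0).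
Proof. by apply: geomfree_forM => t y; exact: geomfree_warm_step. Qed.

Let always_run k x0 : X x0 -> always grad (run k x0) X.
Proof.
by move=> Xx; apply: (always_forM (Inv := fun=> X)) => // t y _ Xy; exact: always_warm_step.
Qed.

Lemma always_warm_start x0 : X x0 -> always grad (warm_start (n := n) X L x0) X.
Proof. exact: always_run. Qed.

Section Run.
Variable x0 : V.
Hypothesis Xx0 : X x0.

Let E k (h : V -> R) := expect grad (run k x0) h.
Let Ele k h h' : (forall y, X y -> h y <= h' y) -> E k h <= E k h'.
Proof.
move=> hh; apply: expect_le => //; try exact: geomfree_bounded (run_geomfree k x0).
by apply: always_sub (always_run k Xx0) => y; exact: hh.
Qed.
Let ED k h h' : E k (fun y => h y + h' y) = E k h + E k h'.
Proof. by apply: expectD => //; exact: geomfree_bounded (run_geomfree k x0). Qed.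
Let EZ k c h : E k (fun y => c * h y) = c * E k h.
Proof. by apply: expectZ => //; exact: geomfree_bounded (run_geomfree k x0). Qed.
Let EC k c : E k (fun=> c) = c. Proof. exact: expect_cst. Qed.

Let u_ge0 : 0 <= lam * D2.
Proof.
apply: mulr_ge0; first exact: ltW.
exact: le_trans (nsq_ge0 _) (hD Xxs Xxs).
Qed.

Let E_step k (h : V -> R) c c' : (forall y, X y ->
    expect grad (one_epoch_svrg X (query (n := n)) y y (warm_eta (n := n) L k) (32 * n)) h
    <= c * (lam * nu k.+1 * D2) + c' * (gdev y xs / nu k.+1)) ->
  0 <= c' -> E k (fun y => gdev y xs) <= 7 * (lam * D2) * nu k ->
  E k.+1 h <= (c + 7 * c') * (lam * D2) * nu k.+1.
Proof.
move=> hh c'0 IH; have nu0 : 0 < nu k.+1 := lt_le_trans ltr01 (excess_ge1 _).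
apply: (@le_trans _ _ (E k (fun y => c * (lam * nu k.+1 * D2) + c' / nu k.+1 * gdev y xs))).
  rewrite /E /= expect_bind; apply: Ele => y Xy; apply: le_trans (hh y Xy) _.
  by rewrite lerD2l -[leRHS]mulrA [in leRHS](mulrC (nu k.+1)^-1).
rewrite ED EC EZ.
have c0 : 0 <= c' / nu k.+1 by rewrite divr_ge0// ltW.
have := ler_wpM2l c0 IH; rewrite -(excess_sqr k).
have -> : c' / nu k.+1 * (7 * (lam * D2) * nu k.+1 ^+ 2) = c' * 7 * (lam * D2) * nu k.+1.
  by field; rewrite gt_eqF.
lra.
Qed.

Let gdev_run k : E k (fun y => gdev y xs) <= 7 * (lam * D2) * nu k.
Proof.
elim: k => [|k IH].
  rewrite /E /= excess0 !gdevE ler_pdivrMr//.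
  apply: le_trans (gvar_le_nsq sp Xx0 Xxs) _.
  have -> : 7 * (lam * D2) * n%:R * L = L ^+ 2 * (7 * D2) by rewrite /rate; field; rewrite gt_eqF.
  rewrite ler_wpM2l ?sqr_ge0//; have := hD Xx0 Xxs; have := nsq_ge0 (x0 - xs); lra.
have c0 : 0 <= 16 / 25 :> R by lra.
have h y : X y -> _ := fun Xy => (@warm_step_le y k Xy).1.
apply: le_trans (E_step h c0 IH) _.
have := mulr_ge0 u_ge0 (le_trans ler01 (excess_ge1 k.+1)).
by move: (lam * D2) (nu k.+1) => u v; lra.
Qed.

(** The target of the warm start is the value [lambda * D ^ 2], from which the
accelerated method continues. *)
Lemma warm_start_le : expect grad (warm_start (n := n) X L x0) (merit X L f G xs) <= 38 * (lam * D2).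
Proof.
have [k kE] : exists k, @warm_epochs n = k.+1.
  by exists (@warm_epochs n).-1; rewrite prednK// leq_max.
have nk := warm_epochs_excess; rewrite kE in nk.
rewrite /warm_start kE -/(run _ _) -/(E _ _).
have h2 : 0 <= 1 / 2 :> R by lra.
have h y : X y -> _ := fun Xy => (@warm_step_le y k Xy).2.
have hF := E_step h h2 (gdev_run k); have hG := gdev_run k.+1.
have u0 := u_ge0.
have k1 := ler_wpM2l u0 nk.
have m y : X y -> merit X L f G xs y <= (F y - F xs) + (2 * gdev y xs + 2 * (lam * D2)).
  move=> Xy; rewrite /merit lerD2l; have p1P := prox_is_prox sp Xy y (ltW lam0).
  move: (prox X G lam y) p1P => p1 p1P.
  have t1 : gdev y p1 <= 2 * gdev y xs + 2 * gdev xs p1.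
    have := @gvar_triangle _ _ _ G 1 y xs p1 ltr01; rewrite invr1 => t.
    have i0 : 0 <= L^-1 by rewrite invr_ge0 ltW.
    by have := ler_wpM2r i0 t; rewrite !gdevE; lra.
  apply: le_trans t1 _; rewrite lerD2l ler_wpM2l//.
  rewrite !gdevE ler_pdivrMr// mulrC; apply: le_trans (gvar_le_sym sp Xxs p1P.1) _.
  rewrite ler_pM2l//; have t2 := is_prox_grad p1P Xxs.
  have t3 := is_prox_grad xsP p1P.1; rewrite mul0r in t3.
  have t4 := lam_young sp (- (y - p1)) (xs - p1) ltr01.
  have t5 := ler_wpM2l (ltW lam0) (hD Xy p1P.1).
  have t6 := ler_wpM2l (ltW lam0) (hD Xxs p1P.1).
  rewrite nsqN dotvNl in t4.
  have i1 : (2 * 1)^-1 = 1 / 2 :> R by lra.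
  rewrite -(opprB xs p1) dotvNr in t3.
  by rewrite i1 in t4; rewrite dotvDl dotvNl; lra.
apply: le_trans (Ele _ m) _.
rewrite (ED _ (fun y => F y - F xs)) (ED _ (fun y => 2 * gdev y xs)) EC (EZ _ 2 (fun y => gdev y xs)).
by lra.
Qed.

End Run.

End Warm.

(** * Numbers of gradient queries *)

Section Queries.
Context {R : realType} {d n : nat}.
Local Notation V := 'rV[R]_d.
Context (X : set V) (L : R) (f : 'I_n -> V -> R) (G grad : 'I_n -> V -> V).
Hypothesis sp : smooth_problem X L f G.
Let n0 := sp_n sp.
Local Notation lam := (rate (n := n) L).
Local Notation cost := (cost (R := R) grad).

Section Epoch.
Variable gphi : 'I_n -> V -> prog V n V.
Hypothesis gphi1 : forall i x, (cost (gphi i x) <= 1%:E)%E.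

Lemma cost_full_gradient x : (cost (full_gradient gphi x) <= (n%:R)%:E)%E.
Proof.
rewrite -[n%:R]addr0; apply: cost_bind_le => //.
have -> : n%:R = (size (enum 'I_n))%:R :> R by rewrite size_enum_ord.
elim: (enum 'I_n) => //= i l IH.
rewrite -[_.+1%:R]natr1; apply: cost_bind_le => // u.
by rewrite -[1]addr0; apply: cost_bind_le.
Qed.

Lemma cost_one_epoch xf x0 eta k :
  (cost (one_epoch_svrg X gphi xf x0 eta k) <= (n%:R + k%:R * 2)%:E)%E.
Proof.
apply: cost_bind_le => [//||| mu]; [by rewrite mulr_ge0|exact: cost_full_gradient|].
rewrite -[k%:R * 2]addr0; apply: cost_bind_le => //.
apply: cost_forM_le => // t st.
have -> : 2 = 0 + (1 + (1 + 0)) :> R by lra.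
apply: cost_bind_le => //.
  by rewrite /= big1 ?mule0.
move=> i; apply: cost_bind_le => // u.
by apply: cost_bind_le.
Qed.

End Epoch.

Lemma cost_approx_prox s xi xp :
  (cost (approx_prox X L lam s xi xp) <= (2 ^+ 12 * n%:R)%:E)%E.
Proof.
rewrite /approx_prox (prox_stepsE sp); apply: le_trans (cost_one_epoch _ _ _ _ _) _.
  by move=> i x; rewrite /= adde0.
rewrite lee_fin natrM (exprD _ 10 2); have -> : 2 ^+ 10 = 1024 :> R by rewrite -natrX.
by have := ler1n R n; rewrite n0; lra.
Qed.

Let geom_sum N : \sum_(0 <= j < N) 2 ^- j.+1 * (j%:R + 2) = 3 - (N%:R + 3) * 2 ^- N :> R.
Proof.
elim: N => [|N IH]; first by rewrite big_nil expr0 invr1; ring.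
rewrite big_nat_recr//= IH [in RHS]exprS.
have -> : 2 ^- N = 2 * 2 ^- N.+1 :> R by rewrite exprS invfM mulrA mulfV// mul1r.
by rewrite -natr1 -exprS; ring.
Qed.

(** Besides the first call, the expected number of calls is three. *)
Lemma cost_unbiased_prox s xp :
  (cost (unbiased_prox X L lam s xp) <= (4 * (2 ^+ 12 * n%:R))%:E)%E.
Proof.
have c0 : 0 <= 2 ^+ 12 * n%:R :> R by rewrite mulr_ge0 ?exprn_ge0.
have -> : 4 * (2 ^+ 12 * n%:R) = 2 ^+ 12 * n%:R + 3 * (2 ^+ 12 * n%:R) :> R by lra.
apply: cost_bind_le => [//|||x]; [by rewrite mulr_ge0|exact: cost_approx_prox|].
rewrite /=; move: (2 ^+ 12 * n%:R) c0 (cost_approx_prox) => c c0 hc.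
pose k j : prog V n V := bind (forM (2 + j) (fun (j : nat) (xs : seq V) =>
    let* x0 := approx_prox X L lam s (nth 0 xs j) (nth 0 xs j) in Ret (rcons xs x0)) [:: x])
    (fun xs => Ret (nth 0 xs 2 + 2 ^+ j.+1 *:
      (nth 0 xs (2 + j) - nth 0 xs (maxn (2 + j).-1 2)))).
have body_le j : (cost (k j) <= (c * (j%:R + 2))%:E)%E.
  rewrite -[c * _]addr0; apply: cost_bind_le => //.
  rewrite mulrC addrC -natrD; apply: cost_forM_le => // t xs.
  by rewrite -[c]addr0; apply: cost_bind_le.
apply: lime_le.
  by apply: is_cvg_nneseries => j _ _; rewrite mule_ge0 ?lee_fin ?half_pow_ge0 ?cost_ge0.
apply: nearW => N.
apply: (@le_trans _ _ (\sum_(0 <= j < N) (2 ^- j.+1 * (c * (j%:R + 2)))%:E)%E).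
  apply: lee_sum => j _; rewrite EFinM lee_wpmul2l ?lee_fin ?half_pow_ge0//.
  exact: body_le.
rewrite sumEFin lee_fin; under eq_bigr do rewrite mulrCA.
rewrite -mulr_sumr geom_sum mulrC ler_wpM2r// gerBl.
by rewrite mulr_ge0 ?half_pow_ge0// addr_ge0.
Qed.

Lemma cost_recapp_iters T x0 :
  (cost (recapp_iters X L lam T x0) <= (T%:R * (2 ^+ 15 * n%:R))%:E)%E.
Proof.
rewrite -[_ * _]addr0; apply: cost_bind_le => //.
apply: cost_forM_le => [//||t st]; first by rewrite mulr_ge0 ?exprn_ge0.
have c0 : 0 <= 2 ^+ 12 * n%:R :> R by rewrite mulr_ge0 ?exprn_ge0.
apply: (@le_trans _ _ (2 ^+ 12 * n%:R + (4 * (2 ^+ 12 * n%:R) + 0))%:E); last first.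
  by rewrite lee_fin (exprD _ 12 3); move: (2 ^+ 12) c0 => q c0; lra.
apply: cost_bind_le => [//|||x'].
- by rewrite addr0 mulr_ge0.
- exact: cost_approx_prox.
apply: cost_bind_le => //; exact: cost_unbiased_prox.
Qed.

Lemma cost_warm_start x0 :
  (cost (warm_start (n := n) X L x0) <= ((@warm_epochs n)%:R * (65 * n%:R))%:E)%E.
Proof.
apply: cost_forM_le => [//||t x]; first by rewrite mulr_ge0.
apply: le_trans (cost_one_epoch _ _ _ _ _) _.
  by move=> i y; rewrite /= adde0.
by rewrite lee_fin natrM; lra.
Qed.

Lemma cost_recapp T x0 : (cost (recapp X L lam T x0) <=
  ((@warm_epochs n)%:R * (65 * n%:R) + T%:R * (2 ^+ 15 * n%:R))%:E)%E.
Proof.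
apply: cost_bind_le => [//|||x]; [by rewrite !mulr_ge0 ?exprn_ge0|exact: cost_warm_start|].
exact: cost_recapp_iters.
Qed.

Lemma cost_restarted_recapp T K x0 : (cost (restarted_recapp X L lam T K x0) <=
  ((@warm_epochs n)%:R * (65 * n%:R) + K%:R * (T%:R * (2 ^+ 15 * n%:R)))%:E)%E.
Proof.
apply: cost_bind_le => [//|||x]; [by rewrite !mulr_ge0 ?exprn_ge0|exact: cost_warm_start|].
apply: cost_forM_le => [//||t y]; first by rewrite !mulr_ge0 ?exprn_ge0.
exact: cost_recapp_iters.
Qed.

End Queries.

Section WarmEpochs.
Context {R : realType}.

Lemma ln2_ge_half : 1 / 2 <= ln 2 :> R.
Proof.
have h : 2^-1 <= expR (- (1 / 2)) :> R.
  by apply: le_trans (expR_ge1Dx _); lra.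
have := ler_ln; move/(_ R); rewrite /prop_in2 => hl.
have := h; rewrite -(hl 2^-1 (expR _)) ?posrE ?expR_gt0// expRK lnV ?posrE//; lra.
Qed.

Lemma ln_pow2_ge k : k%:R / 2 <= ln (2 ^+ k) :> R.
Proof. by rewrite lnXn// -[leRHS]mulr_natl ler_wpM2l//; have := ln2_ge_half; lra. Qed.

Lemma warm_epochs_le n : (@warm_epochs n)%:R <= 4 * Num.max 1 (ln (ln n%:R)) :> R.
Proof.
rewrite /warm_epochs; set m := up_log 2 n; set j := up_log 2 m.
have m1 : 1 <= Num.max 1 (ln (ln n%:R)) :> R by rewrite le_max lexx.
have [j2|j2] := leqP j 1.
  by lra.
have m2 : (1 < m)%N.
  by rewrite ltnNge; apply/negP => m_le; move: j2; rewrite /j (_ : up_log 2 m = 0%N)//;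
    apply/eqP; rewrite up_log_eq0 m_le orbT.
have n2 : (1 < n)%N.
  by rewrite ltnNge; apply/negP => n_le; move: m2; rewrite /m (_ : up_log 2 n = 0%N)//;
    apply/eqP; rewrite up_log_eq0 n_le orbT.
have h1 := up_log_gtn (isT : 1 < 2)%N m2; have h2 := up_log_gtn (isT : 1 < 2)%N n2.
rewrite -/j -/m in h1 h2.
have h3 : (2 ^ (2 ^ j.-1) <= n)%N.
  apply: leq_trans (ltnW h2); rewrite leq_exp2l//.
  by rewrite -ltnS prednK// ltnW.
have [j' jE] : exists j', j = j'.+2 by exists j.-2; case: (j) j2 => [|[|]].
rewrite jE /= in h3.
have h4 : 2 ^+ j' <= ln n%:R :> R.
  apply: (@le_trans _ _ (ln (2 ^+ (2 ^ j'.+1)))).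
    apply: le_trans (ln_pow2_ge _); rewrite natrX exprS mulrAC mulfV// mul1r//.
  by rewrite ler_ln ?posrE ?exprn_gt0 ?ltr0n ?(ltnW n2)// -natrX ler_nat.
have p0 : 0 < 2 ^+ j' :> R by rewrite exprn_gt0.
have h5 : j'%:R / 2 <= ln (ln n%:R) :> R.
  apply: le_trans (ln_pow2_ge j') _.
  by rewrite ler_ln ?posrE// (lt_le_trans p0).
have h6 : ln (ln n%:R) <= Num.max 1 (ln (ln n%:R)) :> R by rewrite le_max lexx orbT.
rewrite jE -addn2 natrD; lra.
Qed.

End WarmEpochs.

(** * Guarantees of the output *)

Section Output.
Context {R : realType} {d n : nat}.
Local Notation V := 'rV[R]_d.
Variables (grad : 'I_n -> V -> V).
Hypothesis n0 : (0 < n)%N.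

Lemma always_lawc {A : pointedType} (p : prog V n A) c (Q : A -> Prop) :
  always grad p Q -> lawc grad p c [set o | Q o.1] = 1%:E :> \bar R.
Proof.
elim: p c => [a|i x k IH|k IH|k IH] c /= hp.
- by rewrite diracE mem_set.
- exact: IH.
- under eq_bigr do rewrite IH//.
  rewrite sumEFin -EFinM sumr_const card_ord mulVf//.
  by rewrite pnatr_eq0 -lt0n.
- under eq_eseriesr do rewrite IH//.
  exact: eseries_halves.
Qed.

(** A function may be unbounded outside the possible outcomes, so its integral is
split into positive and negative parts. *)
Lemma integral_expect {A : pointedType} (p : prog V n A) (h : A -> R) : bounded_on grad p h ->
  (\int[Defs.law R grad p]_o (h o.1)%:E)%E = (expect grad p h)%:E.
Proof.
move=> [M hM].
pose hp a := Num.max (h a) 0; pose hm a := Num.max (- h a) 0.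
have mx (x : R) : `|x| <= M -> `|Num.max x 0| <= M.
  by move=> hx; case: (leP x 0) => // _; rewrite normr0 (le_trans _ hx).
have bp : bounded_on grad p hp by exists M; apply: always_sub hM => a; exact: mx.
have bm : bounded_on grad p hm.
  by exists M; apply: always_sub hM => a ha; apply: mx; rewrite normrN.
have hE a : h a = hp a + -1 * hm a.
  rewrite /hp /hm mulN1r; case: (leP (h a) 0) => h1; case: (leP (- h a) 0) => h2; lra.
have ep a : 0 <= hp a by rewrite le_max lexx orbT.
have em a : 0 <= hm a by rewrite le_max lexx orbT.
have -> : expect grad p h = expect grad p hp - expect grad p hm.
  rewrite (eq_expect (h' := fun a => hp a + -1 * hm a)); last by apply: always_true.
  rewrite expectD//; first by rewrite expectZ// mulN1r.
  by have [M' hM'] := bm; exists M'; apply: always_sub hM' => a; rewrite mulN1r normrN.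
rewrite integralE EFinB; congr (_ - _)%E.
  rewrite -(eint_expect n0 0 ep bp) -integral_law => [|o]; last by rewrite lee_fin.
  apply: eq_integral => o _; by rewrite funeposE /hp EFin_max.
rewrite -(eint_expect n0 0 em bm) -integral_law => [|o]; last by rewrite lee_fin.
by apply: eq_integral => o _; rewrite funenegE /hm EFin_max.
Qed.

End Output.

(** * Complexity *)

Lemma accel_const_gt0 (R : realType) : 0 < accel_const R.
Proof.
rewrite /accel_const; move: 40%N => N.
have K0 : 0 < 10 + 5 * 41 ^+ 2 :> R by rewrite addr_gt0 ?mulr_gt0 ?exprn_gt0.
by rewrite pmulr_lgt0// pmulr_rgt0// mulr_gt0 ?exprn_gt0 ?mulr_gt0 ?exprn_gt0.
Qed.

Section Complexity.
Context {R : realType} {d n : nat}.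
Local Notation V := 'rV[R]_d.
Context (X : set V) (L : R) (f : 'I_n -> V -> R) (G grad : 'I_n -> V -> V).
Hypothesis sp : smooth_problem X L f G.
Hypothesis tg : forall i u x y, X x -> X y ->
  dotv (grad i u) (x - y) = dotv (G i u) (x - y).
Local Notation F := (avgf f).
Local Notation lam := (rate (n := n) L).
Local Notation Ca := (accel_const R).
Let n0 := sp_n sp.
Let L0 := sp_L sp.
Let lam0 : 0 < lam := rate_gt0 sp.
Variables (D : R) (x0 : V).
Hypothesis hD : forall x y, X x -> X y -> nsq (x - y) <= D ^+ 2.
Hypothesis Xx0 : X x0.

Let xs := prox X G 0 x0.
Let xsP : is_prox X G 0 xs xs.
Proof.
have [Xp h] := prox_is_prox sp Xx0 x0 (lexx 0); split=> // y Xy.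
by have := h y Xy; rewrite !scale0r.
Qed.
Let Xxs : X xs := xsP.1.
Let xs_min y : X y -> F xs <= F y. Proof. exact: (prox0_min sp xsP). Qed.
Local Notation mer := (merit X L f G xs).

Let in_bounded_on (p : prog V n V) (h : V -> R) : bounded_where X h -> always grad p X -> bounded_on grad p h.
Proof. by move=> [M hM] pX; exists M; apply: always_sub pX => y; exact: hM. Qed.

Let prox_in y : X y -> X (prox X G lam y).
Proof. by move=> Xy; exact: (prox_is_prox sp Xx0 y (ltW lam0)).1. Qed.

Let F_bounded : bounded_where X F.
Proof. exact: (avgf_bounded_where sp Xxs xs_min). Qed.

Let mer_bounded : bounded_where X mer.
Proof.
apply: bounded_whereD; last exact: (gdev_bounded_where sp).
by apply: bounded_whereD => //; exact: bounded_where_cst.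
Qed.

Let nsq_bounded : bounded_where X (fun y => nsq (y - xs)).
Proof. exact: (nsq_bounded_where sp). Qed.

Let approx_min_of_merit eps (p : prog V n V) : always grad p X ->
  expect grad p mer <= eps -> finds_approx_min grad X F eps p.
Proof.
move=> pX pe; split; first exact: (always_lawc n0 0 pX).
exists (F xs); first by split; [exists xs|exact: xs_min].
have bF := in_bounded_on F_bounded pX.
rewrite (integral_expect n0 bF) -EFinB lee_fin; apply: le_trans pe.
have -> : expect grad p F - F xs = expect grad p (fun y => F y + - F xs).
  rewrite expectD//; first by rewrite expect_cst.
  by apply: in_bounded_on => //; exact: bounded_where_cst.
apply: expect_le => //.
- by apply: always_sub pX => y Xy; rewrite /merit lerDl (gdev_ge0 sp).
- by apply: in_bounded_on => //; apply: bounded_whereD => //; exact: bounded_where_cst.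
- exact: in_bounded_on.
Qed.

Let ws : prog V n V := warm_start (n := n) X L x0.
Let wsX : always grad ws X. Proof. exact: (always_warm_start grad sp Xx0). Qed.
Let ws_le : expect grad ws mer <= 38 * (lam * D ^+ 2).
Proof. exact: (warm_start_le sp tg xsP hD Xx0). Qed.
Let itX T y : X y -> always grad (recapp_iters X L lam T y) X.
Proof. by move=> Xy; exact: (always_recapp_iters grad sp Xy T). Qed.

Let lamD_ge0 : 0 <= lam * D ^+ 2. Proof. by rewrite mulr_ge0 ?sqr_ge0// ltW. Qed.

Lemma recapp_bound eps T : (T = 0%N /\ 38 * (lam * D ^+ 2) <= eps) \/
   39 * Ca * (lam * D ^+ 2) <= T%:R ^+ 2 * eps /\ (0 < T)%N ->
  finds_approx_min grad X F eps (recapp X L lam T x0).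
Proof.
have aX : always grad (recapp X L lam T x0) X.
  by apply: always_bind; apply: always_sub wsX => y Xy; exact: itX.
case=> [[T0 he]|[he T0]]; apply: approx_min_of_merit => //.
  apply: le_trans he; rewrite T0 /recapp expect_bind /recapp_iters /=; exact: ws_le.
have TR : 0 < T%:R ^+ 2 :> R by rewrite exprn_gt0// ltr0n.
rewrite -(ler_pM2l TR); apply: le_trans he.
rewrite /recapp expect_bind -/ws -expectZ//; last first.
  have [M hM] := mer_bounded; exists M; apply: always_sub wsX => y Xy.
  by apply: expect_norm_le => //; apply: always_sub (itX T Xy) => z; exact: hM.
have bws (h : V -> R) : bounded_on grad ws h.
  apply: geomfree_bounded; apply: geomfree_forM => t y; exact: geomfree_warm_step.
apply: (@le_trans _ _ (expect grad ws (fun y => Ca * mer y + Ca * (lam * D ^+ 2)))).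
  apply: expect_le => //; apply: always_sub wsX => y Xy.
  apply: le_trans (recapp_iters_le sp tg Xxs xs_min Xy T) _.
  rewrite -mulrDr; apply: ler_wpM2l; first exact: ltW (accel_const_gt0 R).
  by rewrite lerD2l ler_wpM2l ?(ltW lam0)//; exact: hD.
rewrite expectD// expectZ// expect_cst//.
have := ler_wpM2l (ltW (accel_const_gt0 R)) ws_le.
by move: (expect _ _ _) (lam * _) => e u; lra.
Qed.

(** Strong convexity bounds the distance to the minimizer by the merit, so that a
long enough run halves the merit. *)
Lemma restarted_bound eps gamma T K : 0 < gamma ->
  (forall y, X y -> gamma / 2 * nsq (y - xs) <= F y - F xs) ->
  2 * Ca * (1 + 2 * (lam / gamma)) <= T%:R ^+ 2 -> (0 < T)%N ->
  38 * (lam * D ^+ 2) <= 2 ^+ K * eps ->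
  finds_approx_min grad X F eps (restarted_recapp X L lam T K x0).
Proof.
move=> g0 sc hT T0 he.
pose p k : prog V n V := bind ws (forM k (fun _ y => recapp_iters X L lam T y)).
have pX k : always grad (p k) X.
  apply: always_bind; apply: always_sub wsX => y Xy.
  by apply: (always_forM (Inv := fun=> X)) => // t z _; exact: itX.
have TR : 0 < T%:R ^+ 2 :> R by rewrite exprn_gt0// ltr0n.
have half y : X y -> expect grad (recapp_iters X L lam T y) mer <= 1 / 2 * mer y.
  move=> Xy; rewrite -(ler_pM2l TR); apply: le_trans (recapp_iters_le sp tg Xxs xs_min Xy T) _.
  have m0 := merit_ge0 sp xs_min Xy.
  have hF : F y - F xs <= mer y by rewrite /merit lerDl (gdev_ge0 sp).
  have h1 : lam * nsq (y - xs) <= 2 * (lam / gamma) * mer y.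
    have c0 : 0 <= 2 * (lam / gamma) by rewrite mulr_ge0// divr_ge0// ltW.
    apply: le_trans (ler_wpM2l c0 (le_trans (sc y Xy) hF)).
    by rewrite le_eqVlt; apply/orP; left; apply/eqP; field; rewrite gt_eqF.
  have Ca0 := ltW (accel_const_gt0 R).
  have h2 := ler_wpM2l Ca0 h1.
  have h3 := ler_wpM2r m0 hT.
  by move: h2 h3; move: (lam / gamma) (mer y) (lam * _) Ca => u m w c; lra.
have step k : expect grad (p k) mer <= 2 ^- k * (38 * (lam * D ^+ 2)).
  elim: k => [|k IH].
    by rewrite /p expect_bind /= expr0 invr1 mul1r; exact: ws_le.
  have -> : expect grad (p k.+1) mer =
      expect grad (p k) (fun y => expect grad (recapp_iters X L lam T y) mer).
    by rewrite /p !expect_bind; apply: eq_expect; apply: always_true => y /=; rewrite expect_bind.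
  have -> : 2 ^- k.+1 * (38 * (lam * D ^+ 2)) = 1 / 2 * (2 ^- k * (38 * (lam * D ^+ 2))).
    by rewrite exprS invfM mul1r -[LHS]mulrA.
  have h2 : 0 <= 1 / 2 :> R by lra.
  apply: le_trans (ler_wpM2l h2 IH).
  rewrite -expectZ//; last exact: in_bounded_on.
  apply: expect_le => //.
  - by apply: always_sub (pX k) => y; exact: half.
  - have [M hM] := mer_bounded; exists M; apply: always_sub (pX k) => y Xy.
    by apply: expect_norm_le => //; apply: always_sub (itX T Xy) => z; exact: hM.
  - by apply: in_bounded_on => //; exact: bounded_whereZ.
apply: approx_min_of_merit; first exact: (pX K).
apply: le_trans (step K) _.
by rewrite ler_pdivrMl ?exprn_gt0.
Qed.

Lemma strongly_convex_growth gamma : strongly_convex_on X gamma F (avgg grad) ->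
  forall y, X y -> gamma / 2 * nsq (y - xs) <= F y - F xs.
Proof.
move=> sc y Xy; have := sc xs y Xxs Xy; rewrite enorm_sqr.
have -> : dotv (avgg grad xs) (y - xs) = dotv (avgg G xs) (y - xs).
  by rewrite !dotv_avgg; apply: eq_mean => i; exact: tg.
by have := is_prox_grad xsP Xy; rewrite mul0r; lra.
Qed.

Lemma restarted_bound_strong eps gamma T K : 0 < gamma ->
  strongly_convex_on X gamma F (avgg grad) ->
  2 * Ca * (1 + 2 * (lam / gamma)) <= T%:R ^+ 2 -> (0 < T)%N ->
  38 * (lam * D ^+ 2) <= 2 ^+ K * eps ->
  finds_approx_min grad X F eps (restarted_recapp X L lam T K x0).
Proof. by move=> g0 /strongly_convex_growth; exact: restarted_bound. Qed.

End Complexity.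

(** * Lengths and numbers of runs *)

Section RunLengths.
Context {R : realType}.

Lemma nsq_le_of_enorm_le (d : nat) (u : 'rV[R]_d) D : enorm u <= D -> nsq u <= D ^+ 2.
Proof.
move=> h; rewrite -enorm_sqr ler_pXn2r// nnegrE ?enorm_ge0//.
exact: le_trans (enorm_ge0 _) h.
Qed.

(** If the bound is below 1, no iteration is allowed, and the warm start alone is
accurate enough. Otherwise rounding down loses at most a factor 2. *)
Lemma run_length (Ca w eps : R) : 0 < Ca -> 0 <= w -> 0 < eps ->
  let C := 156 * Ca + 38 in let T := Num.truncn (C * w) in
  T%:R <= C * w /\ ((T = 0%N /\ 38 * (w ^+ 2 * eps) <= eps) \/
   39 * Ca * (w ^+ 2 * eps) <= T%:R ^+ 2 * eps /\ (0 < T)%N).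
Proof.
move=> Ca0 w0 e0 C T.
have C38 : 38 <= C by rewrite /C; lra.
have C0 : 0 <= C by lra.
have Cw0 : 0 <= C * w by rewrite mulr_ge0.
have h1 : T%:R <= C * w by rewrite truncn_le.
have h2 : C * w < T.+1%:R by rewrite truncnS_gt.
split=> //; have [T0|T0] := posnP T.
  left; split=> //; rewrite T0 in h2.
  have k1 := ler_wpM2r w0 C38.
  have w1 : w <= 1 by lra.
  have k2 := ler_wpM2r w0 w1.
  rewrite mulrA ler_piMl ?(ltW e0)// expr2; lra.
right; split=> //; rewrite mulrA ler_pM2r//.
have T1 : 1 <= T%:R :> R by rewrite ler1n.
have k1 : C * w / 2 <= T%:R by rewrite -natr1 in h2; lra.
have k2 : (C * w / 2) ^+ 2 <= T%:R ^+ 2.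
  by rewrite ler_pXn2r// nnegrE; [rewrite divr_ge0|rewrite ler0n].
apply: le_trans k2; rewrite exprMn exprMn.
have k3 : 156 * Ca <= C ^+ 2.
  by rewrite expr2; have := ler_wpM2r C0 C38; rewrite /C; lra.
have k4 := ler_wpM2r (sqr_ge0 w) k3.
by rewrite exprVn; have -> : (2 ^+ 2)^-1 = 1 / 4 :> R; [field|lra].
Qed.

(** As [c * q ^ 2] is at least 1, rounding up is absorbed in a multiple of [q]. *)
Lemma epoch_length (Ca c q : R) : 0 < Ca -> 0 < c -> 0 <= q -> 1 <= c * q ^+ 2 ->
  let C := 2 * Ca * (c + 2) + 1 in let T := (Num.truncn (C * q)).+1 in
  T%:R <= (C + c + 1) * q /\ 2 * Ca * (1 + 2 * q ^+ 2) <= T%:R ^+ 2.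
Proof.
move=> Ca0 c0 q0 cq C T.
have C1 : 1 <= C.
  by rewrite /C lerDr mulr_ge0 ?addr_ge0 ?mulr_ge0 ?(ltW Ca0) ?(ltW c0).
have C0 : 0 <= C by lra.
have Cq0 : 0 <= C * q by rewrite mulr_ge0.
have h1 : (Num.truncn (C * q))%:R <= C * q by rewrite truncn_le.
have h2 : C * q < T%:R by rewrite truncnS_gt.
split.
  have k1 : 1 <= (c + 1) * q.
    rewrite leNgt; apply/negP => h.
    have cq1 : 0 <= c * q by rewrite mulr_ge0// ltW.
    have q1 : q <= 1 by lra.
    have := ler_wpM2l cq1 q1; rewrite expr2 in cq; lra.
  by rewrite /T -natr1; lra.
have k2 : (C * q) ^+ 2 <= T%:R ^+ 2 by rewrite ler_pXn2r ?nnegrE ?(ltW h2).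
apply: le_trans k2; rewrite exprMn.
have k3 : 2 * Ca * (c + 2) <= C ^+ 2.
  have -> : 2 * Ca * (c + 2) = C - 1 by rewrite /C addrK.
  by rewrite expr2; have := ler_wpM2r C0 C1; lra.
have k4 := ler_wpM2r (sqr_ge0 q) k3.
have k5 := ler_wpM2l (ltW Ca0) cq.
by lra.
Qed.

Lemma epoch_number (y : R) : 0 < y ->
  let K := up_log 2 (Num.truncn (38 * y)).+1 in
  38 * y <= 2 ^+ K /\ K%:R <= 155 * Num.max 1 (ln y).
Proof.
move=> y0 K; have y38 : 0 <= 38 * y by lra.
have h1 : (Num.truncn (38 * y))%:R <= 38 * y by rewrite truncn_le.
have h2 : 38 * y < (Num.truncn (38 * y)).+1%:R by rewrite truncnS_gt.
have m1 : 1 <= Num.max 1 (ln y) by rewrite le_max lexx.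
have m2 : ln y <= Num.max 1 (ln y) by rewrite le_max lexx orbT.
split.
  apply: le_trans (ltW h2) _; rewrite -natrX ler_nat.
  exact: up_logP.
have [K0|K0] := posnP K; first by rewrite K0; lra.
have N1 : (1 < (Num.truncn (38 * y)).+1)%N by move: K0; rewrite /K up_log_gt0.
have := up_log_gtn (isT : 1 < 2)%N N1; rewrite -/K => h3.
have N1R : 1 <= (Num.truncn (38 * y))%:R :> R by rewrite ler1n.
have h4 : 2 ^+ K.-1 <= 76 * y.
  have : 2 ^+ K.-1 <= (Num.truncn (38 * y)).+1%:R :> R by rewrite -natrX ler_nat ltnW.
  by rewrite -natr1; lra.
have h5 : K.-1%:R / 2 <= ln 76 + ln y.
  apply: le_trans (ln_pow2_ge _) _; rewrite -lnM ?posrE//.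
  by rewrite ler_ln ?posrE ?exprn_gt0 ?mulr_gt0.
have h6 : ln 76 <= 76 :> R by apply: ltW; exact: ln_sublinear.
have -> : K%:R = K.-1%:R + 1 :> R by rewrite natr1 prednK.
by lra.
Qed.

Lemma query_rate (n : nat) (L t : R) : (0 < n)%N -> 0 < L -> 0 < t ->
  n%:R * Num.sqrt (L / n%:R / t) = Num.sqrt (n%:R * L / t).
Proof.
move=> n0 L0 t0; have nR : 0 < n%:R :> R by rewrite ltr0n.
rewrite -[X in X * _](ger0_norm (ltW nR)) -sqrtr_sqr -sqrtrM ?sqr_ge0//.
by congr Num.sqrt; field; rewrite !gt_eqF.
Qed.

End RunLengths.

Theorem theorem2 (R : realType) :
  (exists (C : R) (T : nat -> R -> R -> R -> nat), 0 < C /\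
    forall (d n : nat) (X : set 'rV[R]_d) (D L eps : R)
      (f : 'I_n -> 'rV[R]_d -> R) (grad : 'I_n -> 'rV[R]_d -> 'rV[R]_d)
      (xinit : 'rV[R]_d),
    (0 < n)%N -> 0 < D -> 0 < L -> 0 < eps ->
    closed X -> @convex_set R 'rV[R]_d X ->
    (forall x y, X x -> X y -> enorm (x - y) <= D) ->
    (forall i, @convex_function R 'rV[R]_d X (f i)) ->
    (forall i, smooth_on X L (f i) (grad i)) ->
    X xinit ->
    let t := T n L D eps in
    let alg := recapp X L (L / n%:R) t xinit in
    [/\ t%:R <= C * (D * Num.sqrt (L / n%:R / eps)),
        finds_approx_min grad X (avgf f) eps alg &
        (expected_queries grad alg <=
          (C * (n%:R * Num.max 1 (ln (ln n%:R))
                + Num.sqrt (n%:R * L * D ^+ 2 / eps)))%:E)%E]) /\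
  (forall c : R, 0 < c ->
    exists (C : R) (T K' : nat -> R -> R -> R -> R -> nat), 0 < C /\
    forall (d n : nat) (X : set 'rV[R]_d) (D L eps gamma : R)
      (f : 'I_n -> 'rV[R]_d -> R) (grad : 'I_n -> 'rV[R]_d -> 'rV[R]_d)
      (xinit : 'rV[R]_d),
    (0 < n)%N -> 0 < D -> 0 < L -> 0 < eps ->
    0 < gamma -> gamma <= c * (L / n%:R) ->
    closed X -> @convex_set R 'rV[R]_d X ->
    (forall x y, X x -> X y -> enorm (x - y) <= D) ->
    (forall i, @convex_function R 'rV[R]_d X (f i)) ->
    (forall i, smooth_on X L (f i) (grad i)) ->
    strongly_convex_on X gamma (avgf f) (avgg grad) ->
    X xinit ->
    let alg := restarted_recapp X L (L / n%:R)
                 (T n L D eps gamma) (K' n L D eps gamma) xinit in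
    finds_approx_min grad X (avgf f) eps alg /\
    (expected_queries grad alg <=
      (C * (n%:R * Num.max 1 (ln (ln n%:R))
            + Num.sqrt (n%:R * L / gamma)
              * Num.max 1 (ln (L * D ^+ 2 / (n%:R * eps)))))%:E)%E).
Proof.
have Ca0 := accel_const_gt0 R; split.
  pose C0 := 156 * accel_const R + 38.
  have C00 : 0 <= C0 by rewrite /C0; lra.
  exists (260 + 2 ^+ 15 * C0 + C0), (fun n L D eps => Num.truncn (C0 * (D * Num.sqrt (L / n%:R / eps)))).
  have p15 : 0 <= 2 ^+ 15 :> R by rewrite exprn_ge0.
  have pC := mulr_ge0 p15 C00.
  split; first by lra.
  move=> d n X D L eps f grad xinit n0 D0 L0 e0 clX cX bX cf sf Xx t alg.
  have [G [sp tg]] := tangent_smooth_problem n0 L0 clX cX bX cf sf Xx.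
  have nR : 0 < n%:R :> R by rewrite ltr0n.
  have hD x y : X x -> X y -> nsq (x - y) <= D ^+ 2.
    by move=> Xx' Xy; apply: nsq_le_of_enorm_le; exact: bX.
  set w := D * Num.sqrt (L / n%:R / eps).
  have w0 : 0 <= w by rewrite mulr_ge0 ?sqrtr_ge0// ltW.
  have wE : w ^+ 2 * eps = rate (n := n) L * D ^+ 2.
    rewrite exprMn sqr_sqrtr ?divr_ge0 ?(ltW L0) ?(ltW nR) ?(ltW e0)//.
    by rewrite /rate; field; rewrite !gt_eqF.
  have [tC tB] := run_length Ca0 w0 e0; rewrite -/C0 -/w wE in tC tB.
  split.
  - apply: le_trans tC _; rewrite ler_wpM2r//; lra.
  - exact: (recapp_bound sp tg hD Xx).
  - rewrite /expected_queries (expected_queriesE grad n0).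
    apply: le_trans (cost_recapp grad sp t xinit) _; rewrite lee_fin.
    have k1 := ler_wpM2r (ltW nR) (@warm_epochs_le R n).
    have k2 : n%:R * w = Num.sqrt (n%:R * L * D ^+ 2 / eps).
      rewrite /w mulrCA query_rate// -{1}(ger0_norm (ltW D0)) -sqrtr_sqr -sqrtrM ?sqr_ge0//.
      by congr Num.sqrt; rewrite [RHS]mulrAC mulrC.
    have k3 : 2 ^+ 15 * t%:R * n%:R <= 2 ^+ 15 * (C0 * w) * n%:R.
      exact: ler_wpM2r (ltW nR) _ _ (ler_wpM2l p15 tC).
    rewrite -k2.
    have m0 : 0 <= n%:R * Num.max 1 (ln (ln n%:R)) :> R.
      by rewrite mulr_ge0 ?(ltW nR)// le_max ler01.
    have k4 := mulr_ge0 pC m0; have k5 := mulr_ge0 C00 m0.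
    have nw := mulr_ge0 (ltW nR) w0; have k6 := mulr_ge0 C00 nw.
    clear alg tB; clearbody C0 t; move: k1 k3 m0 k4 k5 k6 nw.
    move: (@warm_epochs n)%:R (t%:R : R) (Num.max _ _) (2 ^+ 15 : R) => K T M P; lra.
move=> c c0.
pose c1 := 2 * accel_const R * (c + 2) + 1.
have c10 : 0 <= c1.
  have : 0 <= 2 * accel_const R * (c + 2).
    apply: mulr_ge0; last lra.
    by apply: mulr_ge0; [lra|exact: ltW].
  by rewrite /c1; lra.
have p15 : 0 <= 2 ^+ 15 :> R by rewrite exprn_ge0.
pose C2 := 2 ^+ 15 * (c1 + c + 1).
have C20 : 0 <= C2 by rewrite mulr_ge0//; lra.
exists (260 + 155 * C2),
  (fun n L D eps gamma => (Num.truncn (c1 * Num.sqrt (L / n%:R / gamma))).+1),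
  (fun n L D eps gamma => up_log 2 (Num.truncn (38 * (L * D ^+ 2 / (n%:R * eps)))).+1).
split; first by lra.
move=> d n X D L eps gamma f grad xinit n0 D0 L0 e0 g0 gc clX cX bX cf sf sc Xx alg.
have [G [sp tg]] := tangent_smooth_problem n0 L0 clX cX bX cf sf Xx.
have nR : 0 < n%:R :> R by rewrite ltr0n.
have hD x y : X x -> X y -> nsq (x - y) <= D ^+ 2.
  by move=> Xx' Xy; apply: nsq_le_of_enorm_le; exact: bX.
set q := Num.sqrt (L / n%:R / gamma) in alg *.
have q0 : 0 <= q by exact: sqrtr_ge0.
have qE : q ^+ 2 = rate (n := n) L / gamma.
  by rewrite sqr_sqrtr ?divr_ge0 ?(ltW L0) ?(ltW nR) ?(ltW g0).
have cq : 1 <= c * q ^+ 2 by rewrite qE mulrA ler_pdivlMr// mul1r.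
have [tC tB] := epoch_length Ca0 c0 q0 cq; rewrite -/c1 qE in tC tB.
have y0 : 0 < L * D ^+ 2 / (n%:R * eps) by rewrite divr_gt0 ?mulr_gt0 ?exprn_gt0.
have [kB kC] := epoch_number y0.
split.
  apply: (restarted_bound_strong sp tg hD Xx g0 sc tB) => //.
  have := ler_wpM2r (ltW e0) kB; apply: le_trans.
  by rewrite /rate le_eqVlt; apply/orP; left; apply/eqP; field; rewrite !gt_eqF.
rewrite /expected_queries (expected_queriesE grad n0).
apply: le_trans (cost_restarted_recapp grad sp _ _ xinit) _; rewrite lee_fin.
have k1 := ler_wpM2r (ltW nR) (@warm_epochs_le R n).
have k2 := query_rate n0 L0 g0; rewrite -/q in k2.
rewrite -k2; set T := _.+1 in tC *; set K := up_log _ _ in kC *.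
have k3 := ler_wpM2l p15 tC.
have k4 : K%:R * (2 ^+ 15 * T%:R) <= 155 * Num.max 1 (ln (L * D ^+ 2 / (n%:R * eps))) * (C2 * q).
  apply: ler_pM; [exact: ler0n|exact: mulr_ge0 p15 (ler0n _ _)|exact: kC|].
  by rewrite /C2 -[leRHS]mulrA.
have k5 := ler_wpM2r (ltW nR) k4.
have m0 : 0 <= n%:R * Num.max 1 (ln (ln n%:R)) :> R.
  by rewrite mulr_ge0 ?(ltW nR)// le_max ler01.
have m1 : 0 <= n%:R * q * Num.max 1 (ln (L * D ^+ 2 / (n%:R * eps))).
  by rewrite mulr_ge0 ?le_max ?ler01// mulr_ge0// ltW.
have k6 := mulr_ge0 C20 m0.
clear alg kC tC tB kB; clearbody C2 T K q; move: k1 k5 m0 m1 k6.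
move: (@warm_epochs n)%:R (T%:R : R) (K%:R : R) (Num.max _ _) (Num.max 1 (ln (ln _))) (2 ^+ 15 : R).
by move=> W T' K' M1 M2 P; lra.
Qed.
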